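(* Let $n\ge 4$, let $\lambda\in D(n)$ be a partition of $n$ into distinct parts, and let $\mu$ be a partition of $n$ such that $[\mu](\lambda)\neq 0$, i.e. the irreducible character $[\mu]$ of $S_n$ does not vanish on elements of cycle type $\lambda$. Then $[\mu]$ is a constituent of $\langle\lambda\rangle_{(\pm)}\cdot\widehat{\langle\lambda\rangle}$ (for either choice of $\langle\lambda\rangle_{(\pm)}$), i.e. $[\mu]$ is a constituent of $\langle\lambda\rangle_{(\pm)}\cdot\langle\lambda\rangle_{(\pm)}$ for a suitable (independent) choice of associates in the two factors.
   Context: All characters are complex characters. $P(n)$ is the set of partitions of $n$; $l(\lambda)$ is the number of positive parts of $\lambda$; $O(n)$ is the set of partitions of $n$ into odd parts; $D(n)$ is the set of partitions of $n$ into distinct parts; $D^+(n)$ (resp. $D^-(n)$) is the set of $\lambda\in D(n)$ with $n-l(\lambda)$ even (resp. odd). $[\mu]$ denotes the irreducible character of the symmetric group $S_n$ labelled by $\mu\in P(n)$, and $[\mu](\lambda)$ its value on elements of cycle type $\lambda$. $\tilde S_n$ denotes one of the two double covers of $S_n$: it is generated by a central element $z$ of order 2 and $t_1,\dots,t_{n-1}$ (with $t_i$ mapping to the transposition $(i\ i{+}1)$), with relations either $t_i^2=z$, $(t_it_{i+1})^3=z$, $t_it_j=zt_jt_i$ for $|i-j|>1$; or $t_i^2=1$, $(t_it_{i+1})^3=1$, $t_it_j=zt_jt_i$ for $|i-j|>1$. Characters of $S_n$ are identified with their inflations to $\tilde S_n$; $\mathrm{sgn}$ is the inflated sign character. Spin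 characters of $\tilde S_n$ are those whose kernel does not contain $z$. By Schur's classification, the irreducible spin characters are: one character $\langle\lambda\rangle=\mathrm{sgn}\cdot\langle\lambda\rangle$ for each $\lambda\in D^+(n)$, and a pair of distinct associate characters $\langle\lambda\rangle_+$, $\langle\lambda\rangle_-=\mathrm{sgn}\cdot\langle\lambda\rangle_+$ for each $\lambda\in D^-(n)$. The labelling is determined as follows: for a suitable choice of one class $C^+_\alpha$ of $\tilde S_n$ among the two classes projecting to cycle type $\alpha$, for each $\alpha\in O(n)$ (with $C^+_{(1^n)}=\{1\}$ and such that the spin characters labelled by $(n)$ have value $2^{\lfloor (l(\alpha)-1)/2\rfloor}$ on $C^+_\alpha$), the value $\varphi^\lambda_\alpha$ of the spin character(s) labelled $\lambda$ on $C_\alpha^+$ is given by $Q_\lambda=\sum_{\alpha\in O(n)}2^{(l(\lambda)+l(\alpha)+\varepsilon(\lambda))/2}z_\alpha^{-1}\varphi^\lambda_\alpha\, p_\alpha$, where $Q_\lambda$ is Schur's Q-function, $p_\alpha$ the power sum, $z_\alpha$ the centralizer order of an element of type $\alpha$ in $S_n$, and $\varepsilon(\lambda)=0$ or $1$ according to $\lambda\in D^+(n)$ or $D^-(n)$. $\langle\lambda\rangle_{(\pm)}$ denotes $\langle\lambda\rangle$ if $\lambda\in D^+(n)$, and either one of $\langle\lambda\rangle_+,\langle\lambda\rangle_-$ if $\lambda\in D^-(n)$. Finally $\widehat{\langle\lambda\rangle}=\langle\lambda\rangle$ if $\lambda\in D^+(n)$ and $\widehat{\langle\lambda\rangle}=\langle\lambda\rangle_++\langle\lambda\rangle_-$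 if $\lambda\in D^-(n)$. Products are pointwise (Kronecker) products of characters of $\tilde S_n$. *)

(* Defs.v *)
From HB Require Import structures.
From mathcomp Require Import all_boot all_order all_algebra all_fingroup.
From mathcomp Require Import all_solvable all_field all_character.
From mathcomp Require Import zify.
From mathcomp Require Import mpoly.

Set Implicit Arguments.
Unset Strict Implicit.
Unset Printing Implicit Defensive.

Import Order.TTheory GRing.Theory Num.Theory.

Local Open Scope ring_scope.

(** * Partitions *)

Definition is_partn (n : nat) (s : seq nat) : bool :=
  [&& sorted geq s, 0%N \notin s & sumn s == n].

Record intpartn (n : nat) : predArgType :=
  IntPartn { pparts :> seq nat; pparts_proof : is_partn n pparts }.

HB.instance Definition _ n := [isSub for @pparts n].
HB.instance Definition _ n := [Countable of intpartn n by <:].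

Fixpoint partn_seqs (k n : nat) : seq (seq nat) :=
  if k is k'.+1 then
    [::] :: [seq i :: s | i <- iota 1 n, s <- partn_seqs k' n]
  else [:: [::]].

Lemma mem_partn_seqs k n (s : seq nat) :
  (size s <= k)%N -> all (fun i => (0 < i <= n)%N) s -> s \in partn_seqs k n.
Proof.
elim: k s => [|k IH] [|i s] //= sz /andP[le_in le_sn].
rewrite inE; apply/orP; right.
by apply/allpairsP; exists (i, s); split; rewrite ?mem_iota ?IH //=; lia.
Qed.

Lemma partn_bounds n (s : intpartn n) :
  (size s <= n)%N && all (fun i => (0 < i <= n)%N) s.
Proof.
case: s => s /= /and3P[_ s0 /eqP <-] {n}.
elim: s s0 => //= i s IH; rewrite inE negb_or eq_sym -lt0n => /andP[i0 /IH].
case/andP=> szs /allP les; apply/and3P; split; [lia | lia |].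
by apply/allP=> j /les; lia.
Qed.

Definition intpartn_enum (n : nat) : seq (intpartn n) :=
  undup (pmap insub (partn_seqs n n)).

Lemma mem_intpartn_enum n : intpartn_enum n =i predT.
Proof.
move=> s; rewrite mem_undup mem_pmap_sub; apply: mem_partn_seqs;
  by case/andP: (partn_bounds s).
Qed.

HB.instance Definition _ n := isFinite.Build (intpartn n)
  (Finite.uniq_enumP (undup_uniq _) (@mem_intpartn_enum n)).

(** [O(n)], [D(n)], and the parity of [n - l(la)] ([D^-(n)] when odd). *)
Definition odd_parts (n : nat) (a : intpartn n) : bool := all odd a.
Definition distinct_parts (n : nat) (la : intpartn n) : bool := uniq la.
Definition eps (n : nat) (la : intpartn n) : bool := odd (n - size la).

Definition cycle_type (n : nat) (s : 'S_n) : seq nat :=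
  sort geq [seq #|(X : {set 'I_n})| | X in porbits s].

(** * Irreducible characters of the symmetric group *)

Definition fibre_perms (n : nat) (f : 'I_n -> nat) : {set 'S_n} :=
  [set s : 'S_n | [forall i, f (s i) == f i]].

Lemma fibre_perms_group_set n (f : 'I_n -> nat) : group_set (fibre_perms f).
Proof.
apply/group_setP; split=> [|s t].
  by rewrite inE; apply/forallP=> i; rewrite perm1.
rewrite !inE => /forallP fs /forallP ft; apply/forallP=> i.
by rewrite permM (eqP (ft _)) fs.
Qed.

Canonical fibre_perms_group n f := Group (@fibre_perms_group_set n f).

(** Row and column stabilisers of the tableau of shape [mu] whose rows are
    filled with 0, 1, ..., n-1 in reading order.  The column stabiliser is a
    Young subgroup for the conjugate partition of [mu]. *)
Definition row_stab (n : nat) (mu : intpartn n) : {group 'S_n} :=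
  fibre_perms_group (fun i : 'I_n => reshape_index mu i).
Definition col_stab (n : nat) (mu : intpartn n) : {group 'S_n} :=
  fibre_perms_group (fun i : 'I_n => reshape_offset mu i).

Lemma sym_sgn_subproof n :
  is_class_fun <<[set: 'S_n]>>%g [ffun s : 'S_n => (-1) ^+ odd_perm s].
Proof.
apply: intro_class_fun => [s t _ _ | s]; last by rewrite mem_gen ?inE.
by rewrite odd_permJ.
Qed.

Definition sym_sgn (n : nat) : 'CF([set: 'S_n]) := Cfun 0 (@sym_sgn_subproof n).

(** [mu]: the unique common irreducible constituent of the trivial character
    induced from the Young subgroup of [mu] and of the sign character induced
    from the Young subgroup of the conjugate partition (James-Kerber, 2.1).
    It always exists, so the default value of [odflt] is never used. *)
Definition sym_Iirr (n : nat) (mu : intpartn n) : Iirr [set: 'S_n] :=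
  odflt 0 [pick i : Iirr [set: 'S_n] |
      (i \in irr_constt ('Ind[[set: 'S_n], row_stab mu] 1))
   && (i \in irr_constt ('Ind[[set: 'S_n], col_stab mu]
                           ('Res[col_stab mu] (sym_sgn n))))].

Definition sym_chi (n : nat) (mu : intpartn n) : 'CF([set: 'S_n]) :=
  'chi_(sym_Iirr mu).

(** * Schur's Q-functions

    They are taken in [n] variables; since a symmetric function of degree [n]
    is determined by its restriction to [n] variables, identities in degree
    [n] may be read in [{mpoly algC[n]}]. *)

(** The coefficient of [t ^ k] in [\prod_i (1 + x_i t) / (1 - x_i t)], where
    [(1 + x t) / (1 - x t) = 1 + \sum_(j > 0) 2 x^j t^j]. *)
Definition schur_q (n k : nat) : {mpoly algC[n]} :=
  \sum_(m : 'X_{1..n < k.+1} | mdeg m == k)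
     (2 ^+ #|[set i : 'I_n | (m : 'X_{1..n}) i != 0%N]|) *: 'X_[m].

(** [Q_(a, b)], for [a > b >= 0]; in particular [Q_(a, 0) = q_a]. *)
Definition schur_Q2 (n a b : nat) : {mpoly algC[n]} :=
  schur_q n a * schur_q n b
  + 2 * \sum_(1 <= i < b.+1) (-1) ^+ i * (schur_q n (a + i) * schur_q n (b - i)).

(** The Pfaffian of the skew-symmetric matrix with entries
    [Q_(s_i, s_j)], [i < j], for [s] of size [2 k], expanded along its first
    row. *)
Fixpoint schur_pf (n k : nat) (s : seq nat) : {mpoly algC[n]} :=
  if k is k'.+1 then
    if s is a :: s' then
      \sum_(j < size s') (-1) ^+ j * schur_Q2 n a (nth 0%N s' j)
                         * schur_pf n k' (take j s' ++ drop j.+1 s')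
    else 1
  else 1.

(** Partitions of odd length are completed by a part equal to 0. *)
Definition schur_Q (n : nat) (la : intpartn n) : {mpoly algC[n]} :=
  schur_pf n (uphalf (size la))
    (if odd (size la) then rcons la 0%N else la).

Definition power_sum (n : nat) (a : intpartn n) : {mpoly algC[n]} :=
  \prod_(k <- pparts a) \sum_(i < n) 'X_i ^+ k.

(** * Double covers of the symmetric group *)

(** [G] is the double cover of ['S_n] with central element [z], generators
    [t 0, ..., t (n - 2)] and projection [p] to ['S_n].  The relations are
    [t_i ^ 2 = (t_i t_(i+1)) ^ 3 = z] if [b] holds, and
    [t_i ^ 2 = (t_i t_(i+1)) ^ 3 = 1] otherwise.  As [p] has kernel [{1, z}]
    with [z] of order 2, [G] has order [2 * n!], and so there are no further
    relations. *)
Record double_cover (n : nat) (b : bool) (gT : finGroupType) (G : {group gT})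
    (z : gT) (t : nat -> gT) (p : {morphism G >-> 'S_n}) : Prop := DoubleCover {
  dc_gen : G :=: <<z |: [set t i | i : 'I_n.-1]>>%g;
  dc_central : z \in 'Z(G)%g;
  dc_order : #[z]%g = 2%N;
  dc_square : forall i, (i.+1 < n)%N ->
    (t i ^+ 2 = if b then z else 1)%g;
  dc_braid : forall i, (i.+2 < n)%N ->
    ((t i * t i.+1) ^+ 3 = if b then z else 1)%g;
  dc_far : forall i j, (i.+1 < j)%N -> (j.+1 < n)%N ->
    (t i * t j = z * t j * t i)%g;
  dc_proj : forall i j : 'I_n, j = i.+1 :> nat -> p (t i) = tperm i j;
  dc_ker : ('ker p = <[z]>)%g
}.

(** Since [p] is onto, restricting to [p @* G] changes nothing; it only adjusts
    the type. *)
Definition inflate (n : nat) (gT : finGroupType) (G : {group gT})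
    (p : {morphism G >-> 'S_n}) (chi : 'CF([set: 'S_n])) : 'CF(G) :=
  cfMorph ('Res[(p @* G)%g] chi).

Definition irr_spin (gT : finGroupType) (G : {group gT}) (z : gT)
    (chi : 'CF(G)) : bool :=
  (chi \in irr G) && (z \notin cfker chi).

(** [c a] is a representative of the class [C^+_a] for [a] in [O(n)].  The spin
    characters labelled by [la] in [D(n)] are [sp la true] and [sp la false]:
    these coincide if [la] is in [D^+(n)], and are the two distinct associates
    if [la] is in [D^-(n)].  Values of [c] and [sp] at other partitions are
    irrelevant. *)
Record spin_labelling (n : nat) (gT : finGroupType) (G : {group gT})
    (z : gT) (p : {morphism G >-> 'S_n}) (c : intpartn n -> gT)
    (sp : intpartn n -> bool -> 'CF(G)) : Prop := SpinLabelling {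
  sl_class : forall a, odd_parts a ->
    c a \in G /\ cycle_type (p (c a)) = a;
  sl_class1 : forall a : intpartn n, a = nseq n 1%N :> seq nat -> c a = 1%g;
  sl_spin : forall la b, distinct_parts la -> irr_spin z (sp la b);
  sl_assoc : forall la b, distinct_parts la ->
    sp la (~~ b) = inflate p (sym_sgn n) * sp la b;
  sl_self : forall la, distinct_parts la ->
    (sp la true == sp la false) = ~~ eps la;
  sl_inj : forall la la' b b', distinct_parts la -> distinct_parts la' ->
    sp la b = sp la' b' -> la = la';
  sl_all : forall chi : 'CF(G), irr_spin z chi ->
    exists la b, distinct_parts la /\ chi = sp la b;
  sl_basic : forall (la a : intpartn n) b, la = [:: n] :> seq nat ->
    odd_parts a -> sp la b (c a) = 2 ^+ (size a).-1./2;
  sl_Q : forall la b, distinct_parts la ->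
    schur_Q la =
      \sum_(a : intpartn n | odd_parts a)
        (2 ^+ (size la + size a + eps la)./2
         * (#|('C[p (c a)])%g|%:R)^-1 * sp la b (c a)) *: power_sum a
}.

Definition spin_hat (n : nat) (gT : finGroupType) (G : {group gT})
    (sp : intpartn n -> bool -> 'CF(G)) (la : intpartn n) : 'CF(G) :=
  if eps la then sp la true + sp la false else sp la true.

(** For an irreducible [chi], this is membership in [irr_constt phi]. *)
Definition constituent (gT : finGroupType) (G : {group gT})
    (chi phi : 'CF(G)) : bool := '[phi, chi] != 0.

(* Main.v *)
Require Import Defs.
From mathcomp Require Import all_boot all_order all_algebra all_fingroup.
From mathcomp Require Import all_solvable all_field all_character.
From mathcomp Require Import zify ring.
From mathcomp Require Import mpoly.

Set Implicit Arguments.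
Unset Strict Implicit.
Unset Printing Implicit Defensive.

Import Order.TTheory GRing.Theory Num.Theory.

Local Open Scope ring_scope.

(** Let [Y] be the preimage in the double cover of the Young subgroup of [la], and
    [zeta] a basic spin character; in its representation the [t_i] become simple
    roots in a Clifford algebra.  Rotating a product of roots around the trace
    shows that a constituent [th] of [zeta] on [Y] is proportional to [zeta] at
    even elements; a vector of the root space fixed up to sign by [y] shows that
    [th] and its associate (its conjugate, on the even subgroup) agree at [y]
    unless the cycles of [y] are the blocks of [la].  The coefficient of [x ^ la]
    in [Q_la] being [2 ^ l(la)], the inner product over [Y] of [zeta] with the
    spin character of [la] is known; a comparison with the norm of [zeta] shows
    that this spin character contains [th] and its associate once in total.  The
    parts of [la] being distinct, inducing the difference of [th] and its
    associate preserves its norm 2, so the induced class function is, up to sign,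
    the difference [d] of the two associate spin characters of [la] (of the two
    halves on the even subgroup, if it is self-associate).  So [d] is supported on
    the elements of type [la] and [d ^ 2] is a nonzero constant there, whence
    [d ^ 2] is not orthogonal to a character of the symmetric group that is
    nonzero at [la].  It remains to expand [d ^ 2]. *)

(** * Schur's Pfaffians *)

(** The labelling fixes spin characters only on the classes with odd parts, which does not give [d]
    where it is nonzero; the access to the character of [la] is [Q_la]. The character [zeta] is the
    right partner for it: in the expansion of [Q_la] the power of 2 that depends on [l(a)] is, up to
    a factor common to all [a], the value of [zeta] at the class of [a], and the coefficient of
    [x ^ la] in [p_a] is the permutation character of the Young subgroup at [a]. So this coefficient
    of [Q_la] is, up to a power of 2, an inner product over the even elements of [Y], and that of
    [Q_(n)] gives the norm of [zeta] in the same way.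

    Let [M] be the total multiplicity of [th], and [i] the inner product of [th] with its associate
    (or conjugate). The two coefficients give [M ^ 2 = 1 + i], and the norm [2 - 2 i] of the
    difference is nonnegative, so [M = 1] and [i = 0]. Any constituent [th] will do, and its values
    are never computed.

    The Clifford relations cannot be assumed, as [zeta] is known through values only: its degree, a
    power of 2, and its value at a 3-cycle force them. *)

Section Pfaffian.

Definition del (T : Type) j (s : seq T) := take j s ++ drop j.+1 s.

Arguments del : simpl never.

Lemma size_del (T : Type) j (s : seq T) :
  (j < size s)%N -> size (del j s) = (size s).-1.
Proof. by move=> js; rewrite size_cat size_take size_drop js; lia. Qed.

Lemma nth_del (T : Type) x j (s : seq T) i :
  (j < size s)%N -> nth x (del j s) i = nth x s (bump j i).
Proof.
move=> js; rewrite nth_cat size_take js /bump leqNgt.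
by case: ltnP => ij /=; rewrite ?nth_take ?nth_drop //; congr nth; lia.
Qed.

Lemma del_catl (T : Type) j (s1 s2 : seq T) :
  (j < size s1)%N -> del j (s1 ++ s2) = del j s1 ++ s2.
Proof.
move=> js; rewrite /del take_cat js drop_cat.
case: ltnP => [_|js']; first by rewrite catA.
by rewrite (drop_oversize js') cats0 (_ : (_ - _)%N = 0%N) ?drop0 //; lia.
Qed.

Lemma del_mid (T : Type) (s1 s2 : seq T) x :
  del (size s1) (s1 ++ x :: s2) = s1 ++ s2.
Proof. by rewrite /del take_size_cat // -cat_rcons drop_size_cat ?size_rcons. Qed.

Lemma del_catr (T : Type) j (s1 s2 : seq T) :
  del (size s1 + j) (s1 ++ s2) = s1 ++ del j s2.
Proof.
rewrite /del take_cat ltnNge leq_addr /= drop_cat ltnNge.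
rewrite (leq_trans (leq_addr j _)) // -addnS ?leq_addr //=.
by rewrite !addKn catA.
Qed.

Lemma del_delC (T : Type) i j (s : seq T) : (i <= j)%N -> (j.+1 < size s)%N ->
  del j (del i s) = del i (del j.+1 s).
Proof.
move=> ij js; case: s js => // x s js.
apply: (@eq_from_nth _ x); first by rewrite !size_del //; rewrite /= in js *; lia.
by move=> k _; rewrite !nth_del ?size_del /bump //; (try congr nth); rewrite /= in js *; lia.
Qed.

Variable R : comNzRingType.

(** The expansion of [schur_pf] over any index type: parts will be replaced by vectors and [K] by a
    bilinear form. It is meaningful for lists of length [2 k]. *)
Fixpoint pf (T : Type) (K : T -> T -> R) (k : nat) (s : seq T) : R :=
  if k is k'.+1 then
    if s is a :: s' then
      \sum_(j < size s') (-1) ^+ j * K a (nth a s' j) * pf K k' (del j s')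
    else 1
  else 1.

Arguments pf : simpl never.

Lemma pf_cons (T : Type) (K : T -> T -> R) k a s : pf K k.+1 (a :: s) =
  \sum_(j < size s) (-1) ^+ j * K a (nth a s j) * pf K k (del j s).
Proof. by []. Qed.

Lemma eq_pf (T T' : Type) (K : T -> T -> R) (K' : T' -> T' -> R) x x' k s s' :
    size s = size s' ->
    (forall i j, (i < j < size s)%N ->
       K (nth x s i) (nth x s j) = K' (nth x' s' i) (nth x' s' j)) ->
  pf K k s = pf K' k s'.
Proof.
elim: k s s' => [|k IH] [|a s] [|a' s'] //= [ss] KK.
rewrite !pf_cons ss.
apply: eq_bigr => j _; congr (_ * _ * _).
  rewrite !(set_nth_default x) ?ss // !(set_nth_default x' a') //.
  by apply: (KK 0%N j.+1); rewrite /= ltnS ss ltn_ord.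
have js : (j < size s)%N by rewrite ss.
apply: IH => [|i l /andP[il ls]]; first by rewrite !size_del ?ss.
rewrite size_del // in ls; rewrite !nth_del -?ss //.
by apply: (KK (bump j i).+1 (bump j l).+1); rewrite /bump; lia.
Qed.

Section Alternating.

Variables (T : Type) (K : T -> T -> R).

(** [u] behaves as [v + c w] with respect to the members of [s]. *)
Definition comb_on c (u v w : T) (s : seq T) := forall x, List.In x s ->
  K u x = K v x + c * K w x /\ K x u = K x v + c * K x w.

Lemma In_del j (s : seq T) x : List.In x (del j s) -> List.In x s.
Proof.
rewrite /del; elim: s j => [|y s IH] [|j] //=; first by rewrite drop0; right.
by case=> [->|/IH]; [left | right].
Qed.

Lemma In_nth y (s : seq T) i : (i < size s)%N -> List.In (nth y s i) s.
Proof. by elim: s i => //= x s IH [|i] si; [left | right; apply: IH]. Qed.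

Lemma In_catl (s1 s2 : seq T) x : List.In x s1 -> List.In x (s1 ++ s2).
Proof. by elim: s1 => //= y s1 IH [->|/IH]; [left | right]. Qed.

Lemma In_catr (s1 s2 : seq T) x : List.In x s2 -> List.In x (s1 ++ s2).
Proof. by elim: s1 => //= y s1 IH /IH; right. Qed.

Lemma In_catP (s1 s2 : seq T) x :
  List.In x (s1 ++ s2) -> List.In x s1 \/ List.In x s2.
Proof.
elim: s1 => [|y s1 IH] /=; first by right.
by case=> [->|/IH[]]; [left; left | left; right | right].
Qed.

(** In the expansion along the first entry, [u] is that entry, or its partner, or survives in the
    smaller Pfaffian. The length condition keeps away the default value 1 of [pf], which is not
    linear. *)
Lemma pf_lin c u v w k s1 s2 : comb_on c u v w (s1 ++ s2) ->
  size (s1 ++ s2) = k.*2.-1 -> (0 < k)%N ->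
  pf K k (s1 ++ u :: s2) = pf K k (s1 ++ v :: s2) + c * pf K k (s1 ++ w :: s2).
Proof.
elim: k s1 s2 => // k IH [|a s1] s2 uvw sz _; rewrite ?cat_cons ?cat0s !pf_cons.
  rewrite mulr_sumr -big_split; apply: eq_bigr => j _ /=.
  have [uj _] := uvw _ (In_nth u (ltn_ord j)).
  rewrite (set_nth_default u v) // (set_nth_default u w) // uj; ring.
rewrite !size_cat /= mulr_sumr -big_split; apply: eq_bigr => j _ /=.
have [j1|j1|j1] := ltngtP j (size s1).
- rewrite !nth_cat j1 !del_catl // IH; last 1 first.
  + by move: sz => /=; rewrite size_cat; lia.
  + by ring.
  + move=> x /In_catP xs; apply: uvw; right.
    by case: xs => [/In_del/In_catl|/In_catr].
  + by move: sz; rewrite /= !(size_del, size_cat) //; lia.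
- have [l jl] : exists l, (j : nat) = (size s1 + l.+1)%N.
    by exists (j - size s1).-1; lia.
  rewrite !nth_cat ltnNge (ltnW j1) /= jl addKn /= !del_catr.
  have ls2 : (l < size s2)%N by have := ltn_ord j; rewrite jl; lia.
  have dell y : del l.+1 (y :: s2) = y :: del l s2 by [].
  rewrite !dell IH; last 1 first.
  + by move: sz => /=; rewrite size_cat; lia.
  + by ring.
  + move=> x /In_catP xs; apply: uvw; right.
    by case: xs => [/In_catl|/In_del/In_catr].
  + by move: sz; rewrite /= !(size_del, size_cat) //; lia.
rewrite !nth_cat j1 ltnn subnn /= !del_mid.
by have [_ ->] := uvw a (or_introl erefl); ring.
Qed.

Hypothesis two_reg : forall x : R, x + x = 0 -> x = 0.
Hypothesis K0 : forall x, K x x = 0.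

(** Adjacent equal entries suffice, since the row operations below add multiples of a neighbour.
    With the equal entries in front, the terms are indexed by ordered pairs of other entries, and
    exchanging the pair changes the sign; otherwise the two terms that delete one of the equal
    entries cancel and the others vanish by induction. *)
Lemma pf_adj k s1 s2 x : size (s1 ++ s2) = k.-1.*2 -> (0 < k)%N ->
  pf K k (s1 ++ x :: x :: s2) = 0.
Proof.
elim: k s1 s2 => // k IH [|a s1] s2 sz _; rewrite ?cat_cons ?cat0s pf_cons.
  rewrite /= big_ord_recl /= K0 mulr0 mul0r add0r.
  case: k IH sz => [|k] IH /= sz; first by rewrite (size0nil sz) big_ord0.
  have [m sz2] : exists m, size s2 = m.+1 by exists (size s2).-1; lia.
  rewrite sz2.
  have fE (i : 'I_m.+1) : pf K k.+1 (del (bump 0 i) (x :: s2)) =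
    \sum_(j < m) (-1) ^+ j * K x (nth x s2 (lift i j)) * pf K k (del j (del i s2)).
    rewrite (_ : del _ _ = x :: del i s2) // pf_cons size_del ?sz2 //=.
    by apply: eq_bigr => j _; rewrite nth_del // sz2.
  under eq_bigr => i _ do rewrite fE.
  (* The Pfaffian without the entries [i] and [j] of [s2]; the second deletion is shifted by the
     first. It is symmetric in [i] and [j]. *)
  pose h (i j : nat) := pf K k (if (i < j)%N then del j.-1 (del i s2) else del j (del i s2)).
  pose F (i j : 'I_m.+1) := (-1) ^+ (i + unbump i j).+1 * K x (nth x s2 i) * K x (nth x s2 j) * h i j.
  transitivity (\sum_(i < m.+1) \sum_(j < m.+1 | j != i) F i j).
    apply: eq_bigr => i _; rewrite mulr_sumr.
    rewrite (big_mkcond (fun j => j != i)) (bigD1_ord i) //= eqxx add0r.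
    apply: eq_bigr => j _; rewrite eq_sym neq_lift /F /h.
    have -> : unbump i (lift i j) = j by rewrite bumpK.
    have -> : (if (i < lift i j)%N then del (lift i j).-1 (del i s2)
              else del (lift i j) (del i s2)) = del j (del i s2).
      by rewrite /= /bump; case: ifP => // ij; congr del; lia.
    rewrite -addSn exprD -[bump 0 i]/(i.+1) /=; ring.
  apply: two_reg; rewrite {2}(exchange_big_dep xpredT) //= -big_split /=.
  rewrite big1 // => i _.
  have -> : \sum_(j < m.+1 | i != j) F j i = \sum_(j < m.+1 | j != i) F j i.
    by apply: eq_bigl => j; rewrite eq_sym.
  rewrite -big_split big1 //= => j ji.
  have hC : h j i = h i j.
    have swap (a b : 'I_m.+1) : (a < b)%N -> h b a = h a b.
      move=> ab; rewrite /h ab ltnNge (ltnW ab) /=; congr pf.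
      by rewrite (del_delC (i := a) (j := b.-1)) ?(ltn_predK ab) // ?sz2; have := ltn_ord b; lia.
    have [/swap //|/swap //|ij] := ltngtP i j.
    by rewrite (val_inj ij) eqxx in ji.
  rewrite /F hC.
  (* Exactly one of the two [unbump] terms lowers its argument, so the exponents differ in
     parity. *)
  have -> : (-1 : R) ^+ (i + unbump i j).+1 = - (-1) ^+ (j + unbump j i).+1.
    have ij : (i : nat) <> j by move=> /val_inj /eqP; rewrite eq_sym (negPf ji).
    rewrite -[RHS]mulN1r -exprS -[LHS]signr_odd -[RHS]signr_odd.
    congr (_ ^+ nat_of_bool _).
    by rewrite /unbump; case: (ltngtP i j) => // ?; lia.
  ring.
rewrite size_cat /=.
have lt1 : (size s1 < size s1 + (size s2).+2)%N by lia.
have lt2 : ((size s1).+1 < size s1 + (size s2).+2)%N by lia.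
rewrite (bigD1 (Ordinal lt1)) //= (bigD1 (Ordinal lt2)) /=; last first.
  by rewrite -val_eqE /=; lia.
rewrite !nth_cat ltnn subnn ltnNge leqnSn /= subSnn /= del_mid.
have -> : del (size s1).+1 (s1 ++ [:: x, x & s2]) = s1 ++ x :: s2.
  by rewrite -[(size s1).+1]addn1 del_catr /del /= drop0.
rewrite addrA exprS !mulN1r !mulNr addrN add0r.
apply: big1 => j /andP[]; rewrite -!val_eqE /= => j1 j2.
rewrite /= size_cat /= in sz.
have [j3|j3] := ltnP j (size s1).
  by rewrite del_catl // IH ?mulr0 // ?(size_del, size_cat) //; lia.
have [l jl] : exists l, (j : nat) = (size s1 + l.+2)%N.
  by exists (j - size s1).-2; lia.
have := ltn_ord j; rewrite jl => jlt.
rewrite del_catr (_ : del _ _ = x :: x :: del l s2) //.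
by rewrite IH ?mulr0 // ?(size_del, size_cat); lia.
Qed.

Lemma pf_rowop c u v x k s1 s2 :
    comb_on c u v x (s1 ++ x :: s2) ->
    size (s1 ++ x :: s2) = k.*2.-1 -> (0 < k)%N ->
  pf K k (s1 ++ u :: x :: s2) = pf K k (s1 ++ v :: x :: s2).
Proof.
move=> uvx sz k0; rewrite (pf_lin uvx) // pf_adj ?mulr0 ?addr0 //.
by move: sz; rewrite !size_cat /=; lia.
Qed.

End Alternating.

End Pfaffian.

Arguments del : simpl never.
Arguments pf : simpl never.

(** * The pairs [Q_(a, b)] and the effect of one more variable *)

Section QPairs.

Variable R : comNzRingType.

Definition Qpair (q : nat -> R) a b : R :=
  q a * q b + 2 * \sum_(1 <= i < b.+1) (-1) ^+ i * (q (a + i)%N * q (b - i)%N).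

(** The pair [(0, 0)] is excluded: [Qpair q 0 0] is 1 when [q 0 = 1]. *)
Definition Qskew q := forall a b, (0 < a + b)%N -> Qpair q a b = - Qpair q b a.

Lemma Qpair0 q a : q 0%N = 1 -> Qpair q a 0%N = q a.
Proof. by move=> q0; rewrite /Qpair big_geq // mulr0 addr0 q0 mulr1. Qed.

Lemma Qpair_rec q a b :
  Qpair q a b.+1 = q a * q b.+1 - q a.+1 * q b - Qpair q a.+1 b.
Proof.
rewrite /Qpair big_nat_recl // subSS subn0 addn1 expr1.
have -> : \sum_(1 <= i < b.+1) (-1) ^+ i.+1 * (q (a + i.+1)%N * q (b.+1 - i.+1)%N) =
   - \sum_(1 <= i < b.+1) (-1) ^+ i * (q (a.+1 + i)%N * q (b - i)%N) :> R.
  rewrite big_nat [in RHS]big_nat -sumrN; apply: eq_bigr => i _.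
  by rewrite subSS addSnnS exprS; ring.
ring.
Qed.

Variables (x : R) (q q' : nat -> R).
Hypotheses (q0 : q 0%N = 1) (q'0 : q' 0%N = 1).
(** In generating functions, [(1 - x t) q'(t) = (1 + x t) q(t)]: a variable [x] is added. *)
Hypothesis q'S : forall a, q' a.+1 = x * q' a + q a.+1 + x * q a.

(** Read at positive exponents of [t] and [u], this is the identity [(1 - x t) (1 - x u) Q'(t, u) =
    (1 + x t) (1 + x u) Q(t, u)] for the generating functions of the pairs. *)
Lemma Qpair_step a b : Qpair q' a.+1 b.+1 =
  x * Qpair q' a b.+1 + x * Qpair q' a.+1 b - x ^+ 2 * Qpair q' a b
  + Qpair q a.+1 b.+1 + x * (Qpair q a b.+1 + Qpair q a.+1 b)
  + x ^+ 2 * Qpair q a b.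
Proof.
elim: b a => [|b IH] a.
  by rewrite !Qpair_rec !Qpair0 // !q'S q0 q'0; ring.
rewrite Qpair_rec IH (Qpair_rec q' a b.+1) (Qpair_rec q a.+1 b.+1).
rewrite (Qpair_rec q a b.+1) ![Qpair q' _.+1 b.+1]Qpair_rec ![Qpair q _.+1 b.+1]Qpair_rec.
rewrite ![Qpair q' a b.+1]Qpair_rec ![Qpair q a b.+1]Qpair_rec !q'S; ring.
Qed.

Hypothesis qsk : Qskew q.

(** By [Qpair_rec] the symmetrised pair [S] only changes sign along antidiagonals, so the values
    [S n 0] decide; for these [Qpair_step] gives a recursion from which the skew pairs of [q] drop
    out. *)
Lemma Qskew_step : Qskew q'.
Proof.
pose S a b := Qpair q' a b + Qpair q' b a.
have SC a b : S a b.+1 = - S a.+1 b.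
  have -> : S a b.+1 = Qpair q' a b.+1 + Qpair q' b.+1 a by [].
  have e := Qpair_rec q' b a; rewrite Qpair_rec.
  have -> : Qpair q' b.+1 a = q' b * q' a.+1 - q' b.+1 * q' a - Qpair q' b a.+1.
    by rewrite e; ring.
  rewrite /S; ring.
have Sstep a b : (0 < a + b)%N -> S a.+1 b.+1 =
    x * S a b.+1 + x * S a.+1 b - x ^+ 2 * S a b.
  move=> ab; rewrite /S (Qpair_step a) (Qpair_step b).
  by rewrite (qsk (a := a) ab) (qsk (a := a.+1) (b := b.+1)) //
     (qsk (a := a) (b := b.+1)) ?addnS // (qsk (a := a.+1) (b := b)) //; ring.
(* The recursion has depth two, so two consecutive values are carried along. [S 2 0] is computed
   apart because it involves the exceptional pair [(0, 0)]. *)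
have sigma n : S n.+1 0%N = 0 /\ S n.+2 0%N = 0.
  have S1 : S 1%N 0%N = 0.
    by rewrite /S Qpair_rec !Qpair0 // q'0; ring.
  elim: n => [|n [IH1 IH2]]; split => //.
    apply/eqP; rewrite -oppr_eq0 -SC; apply/eqP.
    rewrite /S Qpair_step.
    have E11 := qsk (a := 1%N) (b := 1%N) isT.
    have E10 := qsk (a := 1%N) (b := 0%N) isT.
    rewrite -{2}[Qpair q 1%N 1%N]opprK -E11.
    move: S1; rewrite /S !(Qpair0 0%N) // q0 q'0 => /eqP; rewrite addr_eq0 => /eqP ->.
    by rewrite E10; ring.
  apply/eqP; rewrite -oppr_eq0 -SC; apply/eqP.
  by rewrite Sstep // SC IH1 IH2; ring.
have S0 a b : (0 < a + b)%N -> S a b = 0.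
  elim: b a => [|b IH] [|a] //; try by case: (sigma a).
    by rewrite SC IH ?oppr0.
  by rewrite SC IH ?oppr0.
by move=> a b /S0 /eqP; rewrite addr_eq0 => /eqP.
Qed.

End QPairs.

Lemma Qpair_rmorph (R S : comNzRingType) (f : {rmorphism R -> S}) q a b :
  Qpair (fun i => f (q i)) a b = f (Qpair q a b).
Proof.
rewrite /Qpair rmorphD !rmorphM /= rmorph_nat rmorph_sum; congr (_ + _ * _).
by apply: eq_bigr => i _; rewrite !rmorphM /= rmorph_sign.
Qed.

(** * Degrees and top coefficients of Pfaffians of polynomials *)

Section PfaffianTop.

Variable R : comNzRingType.
Implicit Types (p : {poly R}) (c : R).

Definition has_top d p c := (size p <= d.+1)%N /\ p`_d = c.

Lemma has_topM d e p r c b :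
  has_top d p c -> has_top e r b -> has_top (d + e) (p * r) (c * b).
Proof.
case=> sp <- [sr <-]; split; first by have := size_polyMleq p r; lia.
have ltd : (d < (d + e).+1)%N by lia.
rewrite coefM (bigD1 (Ordinal ltd)) //= addKn big1 ?addr0 // => i ni.
have [id|id] := ltnP i d; last first.
  rewrite nth_default ?mul0r // (leq_trans sp) //.
  by move: ni id; rewrite -val_eqE /=; lia.
by rewrite [r`__]nth_default ?mulr0 // (leq_trans sr) //; lia.
Qed.

Lemma has_top_sum (I : finType) d (F : I -> {poly R}) f :
  (forall i, has_top d (F i) (f i)) -> has_top d (\sum_i F i) (\sum_i f i).
Proof.
move=> Ff; split; last by rewrite coef_sum; apply: eq_bigr => i _; case: (Ff i).
by apply: (leq_trans (size_sum _ _ _)); apply/bigmax_leqP => i _; case: (Ff i).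
Qed.

Lemma has_topC c : has_top 0 c%:P c.
Proof. by split; rewrite ?coefC ?size_polyC_leq1. Qed.

Lemma has_topD d p r c b :
  has_top d p c -> has_top d r b -> has_top d (p + r) (c + b).
Proof.
case=> sp <- [sr <-]; split; rewrite ?coefD //.
by have := size_polyD p r; lia.
Qed.

Lemma has_topXM d p c : has_top d p c -> has_top d.+1 ('X * p) c.
Proof.
case=> sp <-; split; last by rewrite coefXM.
by rewrite mulrC (leq_trans (size_polyMleq _ _)) // size_polyX; lia.
Qed.

Lemma has_topS d p c : has_top d p c -> has_top d.+1 p 0.
Proof. by case=> sp _; split; [apply: leqW | rewrite nth_default]. Qed.

(** Every term of the Pfaffian uses each entry once, so degree bounds attached to the entries add
    up. *)
Lemma pf_has_top (T : Type) (K : T -> T -> {poly R}) (K0 : T -> T -> R)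
    (d : T -> nat) k s : size s = k.*2 ->
    (forall x y, List.In x s -> List.In y s ->
       has_top (d x + d y) (K x y) (K0 x y)) ->
  has_top (\sum_(x <- s) d x)%N (pf K k s) (pf K0 k s).
Proof.
elim: k s => [|k IH] [|a s] //= sz top.
  by rewrite big_nil; apply: has_topC.
rewrite !pf_cons; apply: has_top_sum => j.
have -> : (\sum_(x <- a :: s) d x =
    0 + (d a + d (nth a s j)) + \sum_(x <- del j s) d x)%N.
  rewrite big_cons add0n -addnA; congr (_ + _)%N.
  rewrite -{1}(cat_take_drop j s) (drop_nth a) // big_cat big_cons /del big_cat /=.
  by rewrite addnCA.
apply: has_topM; first apply: has_topM.
- by rewrite -polyCN -polyC_exp; apply: has_topC.
- by apply: top; [left | right; apply: In_nth].
apply: IH; first by rewrite size_del ?ltn_ord //; lia.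
by move=> x y xs ys; apply: top; right; apply: (In_del (j := j)).
Qed.

End PfaffianTop.

Section PfaffianMore.

Variable R : comNzRingType.

Lemma pf_map (T T' : Type) (f : T -> T') (K : T' -> T' -> R) k s :
  pf K k (map f s) = pf (fun x y => K (f x) (f y)) k s.
Proof.
case: s => [|a s]; first by case: k.
apply: (@eq_pf _ _ _ _ _ (f a) a); first by rewrite size_map.
by move=> i j /andP[ij js]; rewrite size_map in js; rewrite !(nth_map a) // (ltn_trans ij).
Qed.

Variables (T : Type) (K : T -> T -> R).

Lemma pf_last0 k l w : (forall x, List.In x l -> K x w = 0) ->
  size l = k.*2.-1 -> (0 < k)%N -> pf K k (l ++ [:: w]) = 0.
Proof.
elim: k l => // k IH [|a l] lw sz _; first by move: sz => /=; lia.
rewrite cat_cons pf_cons big1 // => -[j /=]; rewrite size_cat addn1 ltnS => jl _.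
move: jl; rewrite leq_eqVlt => /orP[/eqP->|jl].
  by rewrite nth_cat ltnn subnn /= lw ?mulr0 ?mul0r //; left.
rewrite del_catl // IH ?mulr0 ?size_del //; rewrite /= in sz; try lia.
by move=> x xl; apply: lw; right; apply: In_del xl.
Qed.

(** In any matching with nonzero contribution, [w] is paired with [y]. *)
Lemma pf_end k l w y : (forall x, List.In x l -> K x w = 0) -> K w y = 1 ->
  size l = k.*2 -> pf K k.+1 (l ++ [:: w; y]) = pf K k l.
Proof.
move=> + wy; elim: k l => [|k IH] [|a l] // lw sz.
  by rewrite pf_cons big_ord_recl big_ord0 /= wy expr0 !mul1r addr0.
rewrite cat_cons !pf_cons size_cat addn2 big_ord_recr big_ord_recr /=.
rewrite nth_cat ltnn subnn /= lw ?mulr0 ?mul0r ?addr0; last by left.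
have -> : del (size l).+1 (l ++ [:: w; y]) = l ++ [:: w].
  by rewrite -[(size l).+1]addn1 del_catr.
rewrite pf_last0 ?mulr0 ?addr0 //; last 2 first.
- by move=> x xl; apply: lw; right.
- by case: sz => ->.
apply: eq_bigr => j _; rewrite nth_cat ltn_ord del_catl // IH //.
- by move=> x xl; apply: lw; right; apply: In_del xl.
- by rewrite size_del //; rewrite /= in sz; lia.
Qed.

End PfaffianMore.

(** * The bilinear form behind the pairs *)

Section QForm.

(** Coordinate 0 of the row space stands for the completing symbol [*] and
    coordinate [a + 1] for the part [a].  Parts equal to 0 arise during the
    reduction of the Pfaffian, hence the distinction. *)
Definition Kmat (R : comNzRingType) (q : nat -> R) (i j : nat) : R :=
  match i, j with
  | 0%N, 0%N => 0
  | 0%N, b.+1 => - q b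
  | a.+1, 0%N => q a
  | a.+1, b.+1 => if (a == 0)%N && (b == 0)%N then 0 else Qpair q a b
  end.

Variable N : nat.

Definition bform (R : comNzRingType) (M : 'M[R]_N.+1) (u v : 'rV[R]_N.+1) : R :=
  (u *m M *m v^T) 0 0.

Definition evec (R : comNzRingType) i : 'rV[R]_N.+1 := delta_mx 0 (inord i).

Section Bilinear.

Variables (R : comNzRingType) (M : 'M[R]_N.+1).
Let B := bform M.

Lemma bformDl c u v w : B (u + c *: v) w = B u w + c * B v w.
Proof. by rewrite /B /bform !mulmxDl -!scalemxAl !mxE. Qed.

Lemma bformDr c u v w : B u (v + c *: w) = B u v + c * B u w.
Proof. by rewrite /B /bform linearD linearZ /= mulmxDr -scalemxAr !mxE. Qed.

Lemma bform_delta i j : B (delta_mx 0 i) (delta_mx 0 j) = M i j.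
Proof. by rewrite /B /bform -rowE trmx_delta -colE !mxE. Qed.

Hypothesis two_reg : forall x : R, x + x = 0 -> x = 0.
Hypothesis Msk : M^T = - M.

Lemma bformC u v : B u v = - B v u.
Proof.
rewrite /B /bform -[in LHS](trmxK (u *m M *m v^T)) mxE !trmx_mul trmxK Msk.
by rewrite mulNmx mulmxN mulmxA mxE.
Qed.

Lemma bform0 u : B u u = 0.
Proof. by apply: two_reg; rewrite {1}bformC addNr. Qed.

End Bilinear.

Lemma Kmat_skew (R : comNzRingType) (q : nat -> R) i j :
  Qskew q -> Kmat q i j = - Kmat q j i.
Proof.
move=> sk; case: i j => [|i] [|j] /=; rewrite ?oppr0 ?opprK // andbC.
by case: ifP => [_|/negbT]; rewrite ?oppr0 // => ij; apply: sk; lia.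
Qed.

End QForm.

Section QTop.

Variables (R : comNzRingType) (q : nat -> R) (q' : nat -> {poly R}).
Hypothesis two_reg : forall x : R, x + x = 0 -> x = 0.
Hypotheses (q0 : q 0%N = 1) (q'0 : q' 0%N = 1) (qsk : Qskew q).
Hypothesis q'S :
  forall a, q' a.+1 = 'X * q' a + (q a.+1)%:P + 'X * (q a)%:P.

Variable N : nat.

Let M : 'M[R]_N.+1 := \matrix_(i, j) Kmat q i j.
Let MP : 'M[{poly R}]_N.+1 := map_mx polyC M.
Let BP := bform MP.
Let B := bform M.
Notation star := (evec N _ 0).
Notation e R a := (evec N R a.+1).

Let qskP : Qskew (fun a => (q a)%:P).
Proof.
move=> a b ab; by rewrite !(Qpair_rmorph polyC) (qsk ab) rmorphN.
Qed.

Lemma two_reg_poly (x : {poly R}) : x + x = 0 -> x = 0.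
Proof.
by move=> /polyP xx; apply/polyP => i; have := xx i; rewrite coefD !coef0 => /two_reg.
Qed.

Lemma M_skew : M^T = - M.
Proof. by apply/matrixP => i j; rewrite !mxE Kmat_skew. Qed.

Lemma MP_skew : MP^T = - MP.
Proof. by apply/matrixP => i j; rewrite !mxE Kmat_skew // rmorphN. Qed.

Lemma B_e i j : (i <= N)%N -> (j <= N)%N ->
  B (evec N R i) (evec N R j) = Kmat q i j.
Proof. by move=> iN jN; rewrite /B /evec bform_delta mxE !inordK. Qed.

Lemma BP_e i j : (i <= N)%N -> (j <= N)%N ->
  BP (evec N _ i) (evec N _ j) = (Kmat q i j)%:P.
Proof. by move=> iN jN; rewrite /BP /evec bform_delta !mxE !inordK. Qed.

(** The generating function of [ev] is that of the [e a] multiplied by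
    [(1 + x t) / (1 - x t)]. *)
Fixpoint ev (a : nat) : 'rV[{poly R}]_N.+1 :=
  if a is b.+1 then e _ a + 'X *: e _ b + 'X *: ev b else e _ 0.

Lemma BP_ev_star a : (a < N)%N -> BP (ev a) star = q' a.
Proof.
elim: a => [|a IH] aN; first by rewrite BP_e //= q0 q'0.
rewrite /BP /= !bformDl -!/(BP _ _) IH 1?ltnW // !BP_e /=; try lia.
by rewrite q'S; ring.
Qed.

Lemma BP_ev0 a : (a < N)%N -> BP (ev a) (ev 0%N) = q' a - 'X ^+ a - (a != 0)%:R * 'X ^+ a.
Proof.
elim: a => [|a IH] aN; first by rewrite BP_e //= q'0; ring.
rewrite /BP /= !bformDl -!/(BP _ _) IH 1?ltnW // !BP_e /=; try lia.
rewrite !Qpair0 // q'S.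
case: a {IH aN} => [|a] /=; last by rewrite !exprS; ring.
by rewrite q0 expr0 expr1 q'0 polyC0; ring.
Qed.

Let hvec a := e {poly R} a.+1 + 'X *: e _ a.

Lemma BP_h a b : (a.+1 < N)%N -> (b.+1 < N)%N ->
  BP (hvec a) (hvec b) = Qpair (fun a => (q a)%:P) a.+1 b.+1
     + 'X * (Qpair (fun a => (q a)%:P) a b.+1 + Qpair (fun a => (q a)%:P) a.+1 b)
     + 'X ^+ 2 * (Qpair (fun a => (q a)%:P) a b - ((a == 0)%N && (b == 0)%N)%:R).
Proof.
move=> aN bN.
rewrite /BP /hvec !bformDl !bformDr -!/(BP _ _) !BP_e /=; try lia.
rewrite !andbF !(Qpair_rmorph polyC); case ab: ((a == 0)%N && (b == 0)%N) => /=; last by ring.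
move/andP: ab => [/eqP-> /eqP->].
by rewrite !Qpair0 // q0 polyC0; ring.
Qed.

(** The pairs in the larger set of variables are values of the old bilinear form at the vectors
    [ev]. The new variable thus enters through the vectors alone, and row operations can lower its
    degree. *)
Lemma BP_ev a b : (a.+1 < N)%N -> (b.+1 < N)%N ->
  BP (ev a.+1) (ev b.+1) = Qpair q' a.+1 b.+1.
Proof.
have sk' : Qskew q' by apply: (@Qskew_step _ 'X (fun a => (q a)%:P)); rewrite ?q0.
have BPC u v : BP u v = - BP v u by apply: bformC MP_skew _ _.
move: a b.
(* The corrections at index 0 arise because [e_0] pairs to 0 with itself while [Qpair] has the value
   1 there; the induction has to carry them. *)
suff Z a b : (a < N)%N -> (b < N)%N -> BP (ev a) (ev b) =
    (if (a == 0)%N && (b == 0)%N then 0 else Qpair q' a b)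
     - ((b == 0)%N && (a != 0)%N)%:R * 'X ^+ a *+ 2
     + ((a == 0)%N && (b != 0)%N)%:R * 'X ^+ b *+ 2.
  by move=> a b aN bN; rewrite Z //= !mul0r mul0rn subr0 addr0.
elim: a b => [|a IHa] b aN bN.
  rewrite BPC BP_ev0 //; case: b bN => [|b] bN /=.
    by rewrite q'0; ring.
  by rewrite (sk' 0%N b.+1) //= Qpair0 //; ring.
elim: b bN => [|b IHb] bN; first by rewrite BP_ev0 //= Qpair0 //; ring.
have evS c : ev c.+1 = hvec c + 'X *: ev c by [].
have E1 : BP (ev a.+1) (ev b.+1) = BP (hvec a) (hvec b)
    + 'X * BP (ev a) (ev b.+1) + 'X * BP (ev a.+1) (ev b) - 'X ^+ 2 * BP (ev a) (ev b).
  by rewrite !evS /BP !bformDl !bformDr; ring.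
have [aN' bN'] := (ltnW aN, ltnW bN).
rewrite E1 IHb // !IHa // BP_h //.
rewrite (@Qpair_step _ 'X (fun a => (q a)%:P) q') ?q0 //.
case: a b {IHa IHb aN bN E1 aN' bN'} => [|a] [|b] /=.
- have := sk' 0%N 1%N isT; rewrite !Qpair0 ?q0 // => ->.
  rewrite !exprS !expr0 ?q'0 ?q0 polyC1; ring.
- by rewrite !exprS; ring.
- by rewrite !exprS; ring.
by ring.
Qed.

End QTop.

(** * The leading coefficient of a Q-function in a new variable *)

Section LeadingCoefficient.

Definition Qpf (R : comNzRingType) (q : nat -> R) (s : seq nat) : R :=
  pf (Qpair q) (uphalf (size s)) (if odd (size s) then rcons s 0%N else s).

Variables (R : comNzRingType) (q : nat -> R) (q' : nat -> {poly R}).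
Hypothesis two_reg : forall x : R, x + x = 0 -> x = 0.
Hypotheses (q0 : q 0%N = 1) (q'0 : q' 0%N = 1) (qsk : Qskew q).
Hypothesis q'S :
  forall a, q' a.+1 = 'X * q' a + (q a.+1)%:P + 'X * (q a)%:P.

Section Vectors.

Variable N : nat.
Let M : 'M[R]_N.+1 := \matrix_(i, j) Kmat q i j.
Let MP : 'M[{poly R}]_N.+1 := map_mx polyC M.
Let BP := bform MP.
Let B := bform M.
Notation star S := (evec N S 0).
Notation e S a := (evec N S a.+1).
Notation ev := (ev R N).

Definition vtop d (v : 'rV[{poly R}]_N.+1) (w : 'rV[R]_N.+1) :=
  forall i, has_top d (v 0 i) (w 0 i).

Lemma vtop_bform d d' v v' w w' :
  vtop d v w -> vtop d' v' w' -> has_top (d + d') (BP v v') (B w w').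
Proof.
move=> vw vw'; rewrite /BP /B /bform !mxE; apply: has_top_sum => j.
rewrite [v'^T _ _]mxE [w'^T _ _]mxE; apply: has_topM => //.
rewrite !mxE -[d]addn0; apply: has_top_sum => i; apply: has_topM => //.
by rewrite mxE; apply: has_topC.
Qed.

Lemma vtop_evec i : vtop 0 (evec N _ i) (evec N _ i).
Proof. by move=> j; rewrite !mxE -[_%:R]polyC_natr; apply: has_topC. Qed.

Lemma vtopD d v v' w w' :
  vtop d v w -> vtop d v' w' -> vtop d (v + v') (w + w').
Proof. by move=> vw vw' i; rewrite !mxE; apply: has_topD. Qed.

Lemma vtopXM d v w : vtop d v w -> vtop d.+1 ('X *: v) w.
Proof. by move=> vw i; rewrite mxE; apply: has_topXM. Qed.

Lemma vtopS d v w : vtop d v w -> vtop d.+1 v 0.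
Proof. by move=> vw i; rewrite [X in has_top _ _ X]mxE; apply: has_topS (vw i). Qed.

Lemma vtop_evecS d i : vtop d.+1 (evec N _ i) 0.
Proof. by elim: d => [|d IH]; [apply: vtopS (vtop_evec i) | apply: vtopS IH]. Qed.

(** As [ev a = e_a + 2 X e_(a-1) + ... + 2 X ^ a e_0], the terms of degree above [d] cancel in the
    difference, and of the two copies of [X ^ d e_b] one remains. *)
Lemma vtop_ev_sub b d : (0 < d)%N ->
  vtop d (ev (b + d) + - 'X ^+ d *: ev b) (e _ b).
Proof.
case: d => // d _; elim: d => [|d IH].
  rewrite addn1 /= [_ + - _ *: _](_ : _ = e _ b.+1 + 'X *: e _ b).
    rewrite -[evec _ R _]add0r; apply: vtopD.
      by apply: vtopS; apply: vtop_evec.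
    by apply: vtopXM; apply: vtop_evec.
  by rewrite expr1 scaleNr addrK.
rewrite [_ + - _ *: _](_ : _ = e _ (b + d.+2) + 'X *: e _ (b + d.+1)
    + 'X *: (ev (b + d.+1) + - 'X ^+ d.+1 *: ev b)).
  rewrite -[evec _ R _]add0r -[0]addr0; apply: vtopD.
    apply: vtopD; first exact: vtop_evecS.
    by apply: vtopXM; apply: vtop_evecS.
  exact: vtopXM.
by rewrite addnS /= scalerDr scalerA exprS mulrN -!addrA.
Qed.

Lemma vtop_ev a : (0 < a)%N -> vtop a (ev a) (e _ 0 + 1 *: e _ 0).
Proof.
move=> a0; rewrite -[ev a](addrNK ('X ^+ a *: ev 0)) -scaleNr.
apply: vtopD; first by have := @vtop_ev_sub 0%N a a0; rewrite add0n.
rewrite scale1r; elim: a {a0} => [|a IH]; first by rewrite expr0 scale1r; apply: vtop_evec.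
by rewrite exprS -scalerA; apply: vtopXM.
Qed.

(** Entries are triples: degree bound, polynomial vector, top coefficient. Subtracting a multiple of
    the next vector leaves the degrees [a - b], which telescope to the largest part. The top vectors
    are those of the remaining parts, then twice [e_0], written as a sum to suit [pf_lin]. *)
Fixpoint reduced (s : seq nat) : seq (nat * 'rV[{poly R}]_N.+1 * 'rV[R]_N.+1) :=
  if s is a :: r then
    (if r is b :: _ then ((a - b)%N, ev a + - 'X ^+ (a - b) *: ev b, e _ b)
     else (a, ev a, e _ 0 + 1 *: e _ 0)) :: reduced r
  else [::].

Lemma reduced_vtop s x : sorted gtn s -> 0%N \notin s ->
  List.In x (reduced s) -> vtop x.1.1 x.1.2 x.2.
Proof.
elim: s => // a [|b r] IH /= srt; rewrite in_cons negb_or => /andP[a0 s0].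
  by case=> // <- /=; apply: vtop_ev; rewrite lt0n eq_sym.
case/andP: srt => ba rs [<- /=|]; last exact: IH.
have := @vtop_ev_sub b (a - b)%N; rewrite subn_gt0 subnKC; last exact: ltnW.
by apply.
Qed.

Lemma reduced_sum a s : sorted gtn (a :: s) ->
  (\sum_(x <- reduced (a :: s)) x.1.1)%N = a.
Proof.
elim: s a => [|b s IH] a; first by rewrite big_cons big_nil addn0.
move=> /= /andP[ab bs]; rewrite big_cons IH //=; lia.
Qed.

Lemma reduced_vec a s : [seq x.2 | x <- reduced (a :: s)] =
  [seq e R b | b <- s] ++ [:: e _ 0 + 1 *: e _ 0].
Proof. by elim: s a => //= b s IH a; congr cons; apply: (IH b). Qed.

Let BPC u v : BP u v = - BP v u.
Proof. by apply: bformC; apply: MP_skew. Qed.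
Let BP0 u : BP u u = 0.
Proof. by apply: bform0; [apply: two_reg_poly | apply: MP_skew]. Qed.
Let B0 u : B u u = 0.
Proof. by apply: bform0; [|apply: M_skew]. Qed.

Lemma pf_reduced k (l : seq (nat * 'rV[{poly R}]_N.+1 * 'rV[R]_N.+1)) s tl :
    (size l + size s + size tl)%N = k.*2 ->
  pf BP k ([seq x.1.2 | x <- l] ++ [seq ev a | a <- s] ++ tl) =
  pf BP k ([seq x.1.2 | x <- l ++ reduced s] ++ tl).
Proof.
elim: s l => [|a s IH] l sz; first by rewrite /= cats0.
case: s IH sz => [|b s] IH sz; first by rewrite map_cat -catA.
rewrite [reduced _]/= -/(reduced (b :: s)) -cat_rcons -IH; last first.
  by move: sz; rewrite size_rcons /=; lia.
rewrite map_rcons cat_rcons /=; symmetry; apply: (@pf_rowop _ _ _ _ _ (- 'X ^+ (a - b))).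
- exact: two_reg_poly.
- exact: BP0.
- by move=> x _; rewrite /BP bformDl bformDr.
- by move: sz; rewrite !size_cat /= !(size_cat, size_map) /=; lia.
by move: sz; rewrite /=; lia.
Qed.

(** For odd length [e_0] itself acts as the completing symbol. For even length both are present:
    [e_0 - star] is orthogonal to the positive parts and pairs to 1 with the symbol, so the two
    split off. *)
Lemma pf_evec_end s k : (0 < N)%N -> 0%N \notin s -> all (fun p => p < N)%N s ->
    (if odd (size s) then k = uphalf (size s) else k = (size s)./2.+1) ->
  pf B k ([seq e R b | b <- s] ++
          e _ 0 :: (if odd (size s) then [::] else [:: star R])) = Qpf q s.
Proof.
move=> N0 s0 /allP sN; have pos p : p \in s -> (0 < p < N)%N.
  move=> ps; rewrite sN // andbT lt0n; apply: contraNneq s0 => <-//.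
have nthP i : (i < size s)%N -> (0 < nth 0%N s i < N)%N by move=> /(mem_nth 0%N)/pos.
have Bee p r : (0 < p < N)%N -> (r < N)%N -> B (e R p) (e R r) = Qpair q p r.
  by move=> /andP[p0 pN] rN; rewrite /B B_e //= (negPf (lt0n_neq0 p0)).
rewrite /Qpf; case: ifP => odds ->.
  apply: (@eq_pf _ _ _ _ _ (star R) 0%N).
    by rewrite size_cat size_rcons size_map addn1.
  move=> i j /andP[ij]; rewrite size_cat size_map addn1 ltnS => js.
  have lis := leq_trans ij js.
  rewrite !nth_cat !size_map !nth_rcons lis (nth_map 0%N) // ltn_neqAle js andbT.
  have [->|js'] := eqVneq j (size s); first by rewrite subnn /= Bee ?nthP //; case/andP: (nthP i lis); lia.
  have js2 : (j < size s)%N by rewrite ltn_neqAle js'.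
  by rewrite /= (nth_map 0%N) // Bee ?nthP //; case/andP: (nthP j js2).
have -> : uphalf (size s) = (size s)./2 by rewrite uphalf_half odds.
have szs : size s = (size s)./2.*2 by rewrite -[LHS]odd_double_half odds.
have B0star : B (e R 0) (star R) = 1 by rewrite /B B_e.
have Bstar0 : B (star R) (star R) = 0 by exact: B0.
rewrite -(@pf_rowop _ _ _ _ _ (-1) (e R 0 + -1 *: star R)).
- rewrite pf_end; last 1 first.
  + by rewrite size_map.
  + rewrite pf_map; apply: (@eq_pf _ _ _ _ _ 0%N 0%N) => // i j /andP[ij js].
    by rewrite Bee ?nthP ?(ltn_trans ij) //; case/andP: (nthP j js).
  + move=> x; elim: (s) pos => //= p r IH pos [<-|]; last first.
      by apply: IH => t tr; apply: pos; rewrite inE tr orbT.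
    have /andP[p0 pN] : (0 < p < N)%N by apply: pos; rewrite inE eqxx.
    rewrite /B bformDr -/B Bee ?p0 // ?(leq_ltn_trans _ pN) //.
    by rewrite /B B_e //= Qpair0 // mulN1r subrr.
  + by rewrite /B bformDl -/B B0star Bstar0 mulr0 addr0.
- exact: two_reg.
- exact: B0.
- by move=> x _; rewrite /B bformDl bformDr.
- by rewrite size_cat size_map /=; lia.
by [].
Qed.

End Vectors.

(** Subtracting multiples of neighbouring rows of the Pfaffian brings the total
    degree in the new variable down to the largest part [a]. *)
Lemma Qpf_top a s : sorted gtn (a :: s) -> 0%N \notin a :: s ->
  has_top a (Qpf q' (a :: s)) (Qpf q s + Qpf q s).
Proof.
move=> srt s0; set N := a.+1.
pose M : 'M[R]_N.+1 := \matrix_(i, j) Kmat q i j.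
pose MP : 'M[{poly R}]_N.+1 := map_mx polyC M.
set S := a :: s; pose o := odd (size S).
pose k := uphalf (size S).
pose tl (T : comNzRingType) : seq 'rV[T]_N.+1 := if o then [:: evec N T 0] else [::].
have sN p : p \in S -> (0 < p < N)%N.
  move=> ps; have p0 : (0 < p)%N by rewrite lt0n; apply: contraNneq s0 => <-.
  rewrite p0 /= ltnS; move: ps; rewrite inE => /orP[/eqP->//|ps].
  have /allP/(_ p ps) := order_path_min (rev_trans ltn_trans) srt.
  exact: ltnW.
have nthP i : (i < size S)%N -> (0 < nth 0%N S i < N)%N by move=> /(mem_nth 0%N)/sN.
have sztl T : (size S + size (tl T))%N = k.*2.
  rewrite /tl /k /o; move: (size S) => m.
  by rewrite uphalf_half; have := odd_double_half m; case: (odd m) => /=; lia.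
have step1 : Qpf q' S = pf (bform MP) k ([seq ev R N b | b <- S] ++ tl _).
  rewrite /Qpf; apply: (@eq_pf _ _ _ _ _ 0%N (evec N _ 0)).
    by rewrite size_cat size_map /tl /o; case: ifP; rewrite ?size_rcons ?addn1 ?addn0.
  move=> i j /andP[ij js].
  have lis : (i < size S)%N.
    by move: js; case: ifP => _; rewrite ?size_rcons; move: ij; lia.
  have -> : nth 0%N (if odd (size S) then rcons S 0%N else S) i = nth 0%N S i.
    by case: ifP => // _; rewrite nth_rcons lis.
  have -> : nth 0%N (if odd (size S) then rcons S 0%N else S) j = nth 0%N S j.
    case: ifP => // _; rewrite nth_rcons; case: ltnP => // h.
    by rewrite (nth_default _ h) if_same.
  rewrite !nth_cat size_map lis (nth_map 0%N) //.
  have /andP[i0 iN] := nthP i lis.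
  case: ltnP => h.
    rewrite (nth_map 0%N) //; have /andP[j0 jN] := nthP j h.
    by rewrite -(prednK i0) -(prednK j0) (@BP_ev _ q q') ?prednK.
  have o1 : odd (size S) by case: ifP js => // _; rewrite ltnNge h.
  rewrite o1 size_rcons ltnS in js.
  have -> : j = size S by apply/eqP; rewrite eqn_leq js h.
  rewrite (nth_default _ (leqnn _)) Qpair0 // /tl /o o1 subnn [nth _ [:: _] 0]/=.
  by rewrite (@BP_ev_star _ q q').
pose tr : seq (nat * 'rV[{poly R}]_N.+1 * 'rV[R]_N.+1) :=
  if o then [:: (0%N, evec N _ 0, evec N _ 0)] else [::].
rewrite step1 -[_ ++ _]cat0s (@pf_reduced N k [::] S) // cat0s.
have -> : tl _ = [seq x.1.2 | x <- tr] by rewrite /tl /tr; case: (o).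
rewrite -map_cat pf_map.
have -> : Qpf q s + Qpf q s =
    pf (fun x y => bform M x.2 y.2) k (reduced N S ++ tr).
  rewrite -pf_map map_cat reduced_vec -catA /=.
  have -> : [seq x.2 | x <- tr] = tl R by rewrite /tl /tr; case: (o).
  rewrite (@pf_lin _ _ _ 1 _ (evec N R 1) (evec N R 1)) ?mul1r; first last.
  - by rewrite /k.
  - by rewrite size_cat size_map; have := sztl R; rewrite [size S]/=; lia.
  - by move=> x _; rewrite bformDl bformDr.
  rewrite /tl /o /=.
  suff -> : pf (bform M) k ([seq evec N R b.+1 | b <- s] ++
     evec N R 1 :: (if ~~ odd (size s) then [:: evec N R 0] else [::])) = Qpf q s by [].
  rewrite if_neg pf_evec_end //.
  - by move: s0; rewrite inE negb_or => /andP[].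
  - by apply/allP => p ps; have /andP[] // : (0 < p < N)%N; apply: sN; rewrite inE ps orbT.
  by rewrite /k /= uphalf_half; case: ifP; lia.
rewrite -[X in has_top X](reduced_sum N srt) -[X in has_top X]addn0.
have -> : (\sum_(x <- reduced N S) x.1.1 + 0 = \sum_(x <- reduced N S ++ tr) x.1.1)%N.
  by rewrite big_cat /tr; case: (o); rewrite ?big_seq1 ?big_nil.
apply: pf_has_top.
  by rewrite -(sztl R) size_cat -(size_map snd (reduced N S)) reduced_vec size_cat
     size_map addn1 /tr /tl; case: (o).
suff tp x : List.In x (reduced N S ++ tr) -> vtop x.1.1 x.1.2 x.2.
  by move=> x y /tp tx /tp ty; apply: vtop_bform.
move=> xs; case: (In_catP xs); first exact: reduced_vtop.
by rewrite /tr; case: (o) => // -[<-|[]] /=; apply: vtop_evec.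
Qed.

End LeadingCoefficient.

(** * Q-functions built up variable by variable, and their coefficients *)

Section SchurQSeq.

Definition qstep (R : comNzRingType) (x : R) (q : nat -> R) : nat -> R :=
  fix f a := if a is b.+1 then x * f b + q b.+1 + x * q b else 1.

Definition qvars (R : comNzRingType) (xs : seq R) : nat -> R :=
  foldr (@qstep R) (fun a => (a == 0)%N%:R) xs.

Lemma qvars0 (R : comNzRingType) (xs : seq R) : qvars xs 0 = 1.
Proof. by case: xs. Qed.

Lemma qvars_skew (R : comNzRingType) (xs : seq R) : Qskew (qvars xs).
Proof.
elim: xs => [|x xs IH]; last by apply: (@Qskew_step _ x (qvars xs)); rewrite ?qvars0.
suff Q0 a b : (0 < a + b)%N -> Qpair (fun a => (a == 0)%N%:R : R) a b = 0.
  by move=> a b ab; rewrite !Q0 ?oppr0 // addnC.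
move=> ab; rewrite /Qpair big_nat big1 ?mulr0 => [|i /andP[i0 _]].
  by rewrite addr0; case: a b ab => [|a] [|b] //=; rewrite ?mul0r ?mulr0.
by rewrite addn_eq0 (negPf (lt0n_neq0 i0)) andbF mul0r mulr0.
Qed.

Section Morph.

Variables (R S : comNzRingType) (f : {rmorphism R -> S}).

Lemma pf_rmorph (T : Type) (K : T -> T -> R) (K' : T -> T -> S) k s :
  (forall x y, K' x y = f (K x y)) -> pf K' k s = f (pf K k s).
Proof.
move=> KK; elim: k s => [|k IH] [|a s]; rewrite ?rmorph1 // !pf_cons.
by rewrite rmorph_sum; apply: eq_bigr => j _; rewrite !rmorphM rmorph_sign KK IH.
Qed.

Lemma Qpf_rmorph (q : nat -> R) (q' : nat -> S) s :
  (forall a, q' a = f (q a)) -> Qpf q' s = f (Qpf q s).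
Proof.
move=> qq; apply: pf_rmorph => a b; rewrite -Qpair_rmorph /Qpair !qq.
by congr (_ + _ * _); apply: eq_bigr => i _; rewrite !qq.
Qed.

Lemma qstep_rmorph x (q : nat -> R) (q' : nat -> S) a :
  (forall a, q' a = f (q a)) -> qstep (f x) q' a = f (qstep x q a).
Proof. by move=> qq; elim: a => [|a IH] /=; rewrite ?rmorph1 // IH !qq !rmorphD !rmorphM. Qed.

End Morph.

Section MPoly.

Variables (n : nat) (F : idomainType).
Local Notation MP := {mpoly F[n]}.

Lemma mcoeffMXE (p : MP) k m :
  (p * 'X_[k])@_m = if (k <= m)%MM then p@_(m - k) else 0.
Proof.
case: ifP => [km|/negP nkm]; first by rewrite -{1}(submK km) addmC mcoeffMX.
apply/eqP; rewrite mcoeff_eq0 (perm_mem (msuppMX _ _)); apply/negP => /mapP[k' _ mE].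
by apply: nkm; rewrite mE lem_addr.
Qed.

Definition qidx (vs : seq 'I_n) : nat -> MP := qvars [seq 'X_i | i <- vs].

Definition msuppc (m : 'X_{1..n}) := #|[set i | m i != 0%N]|.

Lemma mcoeffXvM (p : MP) v m :
  ('X_v * p)@_m = if m v != 0%N then p@_(m - U_(v)) else 0.
Proof.
rewrite mulrC mcoeffMXE; congr (if _ then _ else _).
apply/mnm_lepP/idP => [/(_ v)|mv i]; rewrite mnm1E ?eqxx ?lt0n //.
by case: eqVneq => // <-; rewrite lt0n.
Qed.

Lemma mcoeff_qidx vs a m : uniq vs -> (qidx vs a)@_m =
  if (mdeg m == a) && [forall i, (m i != 0%N) ==> (i \in vs)]
  then 2 ^+ msuppc m else 0.
Proof.
have msupp0 : msuppc 0 = 0%N.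
  by apply/eqP; rewrite cards_eq0; apply/eqP/setP => i; rewrite !inE mnm0E.
elim: vs a m => [|v vs IH] a m.
  move=> _; rewrite /qidx /=; have [->|m0] := eqVneq m 0%MM.
    rewrite mdeg0 msupp0 expr0 -mpolyC_nat mcoeffC eqxx mulr1 eq_sym.
    rewrite (_ : [forall i, _]); last by apply/forallP => i; rewrite mnm0E.
    by rewrite andbT; case: ifP.
  rewrite -mpolyC_nat mcoeffC (negPf m0) mulr0; case: ifP => // /andP[_ /forallP ms].
  case/eqP: m0; apply/mnmP => i; rewrite mnm0E; apply/eqP.
  by have := ms i; rewrite in_nil implybF negbK.
rewrite cons_uniq => /andP[vvs /IH {}IH]; rewrite /qidx /= -/(qidx vs).
elim: a m => [|a IHa] m.
  rewrite mcoeff1 mdeg_eq0; have [->|//] := eqVneq m 0%MM.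
  rewrite msupp0 expr0 (_ : [forall i, _]) //.
  by apply/forallP => i; rewrite mnm0E.
rewrite /= !mcoeffD !mcoeffXvM IHa !IH.
have [mv|mv] := eqVneq (m v) 0%N.
  rewrite /= add0r addr0; congr (if _ && _ then _ else _).
  apply: eq_forallb => i; rewrite inE.
  by have [->|//] := eqVneq i v; rewrite mv.
have mE : m = (m - U_(v) + U_(v))%MM.
  rewrite submK //; apply/mnm_lepP => i; rewrite mnm1E.
  by case: eqVneq => // <-; rewrite lt0n.
move: mE; set m' := (m - U_(v))%MM => mE.
have mdE : mdeg m = (mdeg m').+1 by rewrite mE mdegD mdeg1 addn1.
have mi i : m i = (m' i + (v == i))%N by rewrite {1}mE mnmDE mnm1E.
have nvs : [forall i, (m i != 0%N) ==> (i \in vs)] = false.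
  by apply/negbTE/forallPn; exists v; rewrite negb_imply mv.
rewrite nvs andbF addr0 mdE eqSS /=.
have -> : [forall i, (m i != 0%N) ==> (i \in v :: vs)] =
          [forall i, (m' i != 0%N) ==> (i \in v :: vs)].
  apply: eq_forallb => i; rewrite mi !inE [i == v]eq_sym.
  by case: (eqVneq v i) => _ /=; rewrite ?implybT ?addn0.
have [_|_] := eqVneq (mdeg m') a; last by rewrite addr0.
have [m'v|m'v] := eqVneq (m' v) 0%N; last first.
  have -> : [forall i, (m' i != 0%N) ==> (i \in vs)] = false.
    by apply/negbTE/forallPn; exists v; rewrite negb_imply m'v.
  rewrite addr0 (_ : msuppc m = msuppc m') //; apply: eq_card => i.
  rewrite !inE mi; case: (eqVneq v i) => [<-|]; last by rewrite addn0.
  by rewrite addn1 m'v.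
have -> : [forall i, (m' i != 0%N) ==> (i \in v :: vs)] =
          [forall i, (m' i != 0%N) ==> (i \in vs)].
  by apply: eq_forallb => i; rewrite inE; have [->|//] := eqVneq i v; rewrite m'v.
case: ifP => _; last by rewrite addr0.
have -> : msuppc m = (msuppc m').+1.
  rewrite /msuppc (cardsD1 v) inE mv add1n; congr _.+1.
  apply: eq_card => i; rewrite !inE mi [i == v]eq_sym.
  by case: (eqVneq v i) => [<-|_] /=; rewrite ?m'v // addn0.
by rewrite exprS; ring.
Qed.

End MPoly.
End SchurQSeq.

Section SchurQCoefficients.

Variables (n : nat) (F : idomainType).
Hypothesis two_reg : forall x : F, x + x = 0 -> x = 0.
Local Notation MP := {mpoly F[n]}.
Local Notation qidx := (@qidx n F).

(** A polynomial fixed by this substitution does not involve [x_v]. *)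
Definition kill (v : 'I_n) : n.-tuple MP :=
  [tuple if i == v then 0 else 'X_i | i < n].

Lemma mcoeff_kill v (p : MP) (m : 'X_{1..n}) : m v != 0%N -> (p \mPo kill v)@_m = 0.
Proof.
move=> mv; rewrite comp_mpolyE raddf_sum big1 //= => k _; rewrite mcoeffZ.
have [kv|kv] := eqVneq (k v) 0%N; last first.
  by rewrite (bigD1 v) //= tnth_mktuple eqxx expr0n (negPf kv) mul0r mcoeff0 mulr0.
have -> : \prod_(i < n) tnth (kill v) i ^+ k i = 'X_[k] :> MP.
  rewrite [RHS]mpolyXE_id; apply: eq_bigr => i _; rewrite tnth_mktuple.
  by have [->|//] := eqVneq i v; rewrite kv !expr0.
rewrite mcoeffX; have [kE|] := eqVneq k m; last by rewrite mulr0.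
by move: mv; rewrite -kE kv.
Qed.

Lemma qidx_kill v vs a : v \notin vs -> qidx vs a \mPo kill v = qidx vs a.
Proof.
rewrite /qidx; elim: vs a => [|u vs IH] a.
  by move=> _; rewrite /= -mpolyC_nat comp_mpolyC.
rewrite inE negb_or => /andP[uv vvs] /=.
have {2}<- : 'X_u \mPo kill v = 'X_u :> MP.
  by rewrite comp_mpolyXU -tnth_nth tnth_mktuple eq_sym (negPf uv).
symmetry; apply: (qstep_rmorph (f := comp_mpoly (kill v))) => b.
exact: esym (IH b vvs).
Qed.

Definition moni (vs : seq 'I_n) (s : seq nat) : 'X_{1..n} :=
  [multinom nth 0%N s (index i vs) | i < n].

(** By [Qpf_top] the top coefficient in the first variable is twice the Q-function of the remaining
    parts in the remaining variables; hence one factor 2 for each part. *)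
Lemma mcoeff_Qpf vs s : uniq vs -> (size s <= size vs)%N ->
    sorted gtn s -> 0%N \notin s ->
  (Qpf (qidx vs) s)@_(moni vs s) = 2 ^+ size s.
Proof.
elim: s vs => [|a s IH] vs.
  move=> _ _ _ _; rewrite /Qpf /= mcoeff1 (_ : moni vs [::] = 0%MM) ?eqxx //.
  by apply/mnmP => i; rewrite mnmE mnm0E nth_nil.
case: vs => // v vs /andP[vvs uvs] szs srt s0.
set q := qidx vs; pose q' := qstep 'X (fun a => (q a)%:P).
have two_regMP (x : MP) : x + x = 0 -> x = 0.
  by move=> /mpolyP xx; apply/mpolyP => m; have := xx m; rewrite mcoeffD !mcoeff0 => /two_reg.
have [szP topP] : has_top a (Qpf q' (a :: s)) (Qpf q s + Qpf q s).
  apply: Qpf_top => //; try exact: qvars0; exact: qvars_skew.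
have -> : Qpf (qidx (v :: vs)) (a :: s) = (Qpf q' (a :: s)).['X_v].
  apply: (Qpf_rmorph (f := horner_eval 'X_v)) => b.
  rewrite /q' -(@qstep_rmorph _ _ (horner_eval 'X_v) _ _ q) => [|c].
    by congr (qstep _ q b); apply: esym; apply: hornerX.
  by apply: esym; apply: hornerC.
rewrite (horner_coef_wide _ szP) raddf_sum big_ord_recr /= topP.
(* The coefficients with respect to the new variable are free of [x_v], so only the one of degree
   [a] can contribute to the exponent [a] of [x_v]. *)
have freeP (e : nat) (m : 'X_{1..n}) : m v != 0%N -> ((Qpf q' (a :: s))`_e)@_m = 0.
  suff <- : map_poly (comp_mpoly (kill v)) (Qpf q' (a :: s)) = Qpf q' (a :: s).
    by rewrite coef_map; apply: mcoeff_kill.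
  symmetry; apply: (Qpf_rmorph (f := map_poly (comp_mpoly (kill v)))) => b.
  rewrite {2}/q' -(@qstep_rmorph _ _ (map_poly (comp_mpoly (kill v))) _ _
                     (fun c => (q c)%:P)) => [|c].
    by congr (qstep _ _ b); apply: esym; apply: map_polyX.
  by rewrite [RHS]map_polyC; congr (_%:P); apply: esym; apply: qidx_kill.
have mv : moni (v :: vs) (a :: s) v = a by rewrite mnmE /= eqxx.
rewrite big1 ?add0r => [|e _]; last first.
  rewrite mpolyXn mcoeffMXE; case: ifP => // _; apply: freeP.
  by rewrite mnmBE mv mulmnE mnm1E eqxx mul1n subn_eq0 -ltnNge.
rewrite mpolyXn mcoeffMXE.
have le_m : (U_(v) *+ a <= moni (v :: vs) (a :: s))%MM.
  apply/mnm_lepP => i; rewrite mulmnE mnm1E mnmE /=.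
  by case: eqVneq => _; rewrite ?mul1n.
rewrite le_m (_ : (_ - _)%MM = moni vs s).
  move: s0; rewrite inE negb_or => /andP[_ s0].
  by rewrite mcoeffD IH ?(path_sorted srt) // exprS; ring.
apply/mnmP => i; rewrite mnmBE mulmnE mnm1E !mnmE /=.
have [<-|_] := eqVneq v i; last by rewrite mul0n subn0.
rewrite mul1n subnn nth_default // leqNgt; apply: contra vvs => lti.
by rewrite -index_mem (leq_trans lti).
Qed.

End SchurQCoefficients.

(** * Coefficients of the Q-functions *)

Section SchurQ.

Variable n : nat.

Lemma two_reg_algC (x : algC) : x + x = 0 -> x = 0.
Proof. by move/eqP; rewrite -mulr2n mulrn_eq0 => /eqP. Qed.

Lemma schur_qE a : schur_q n a = qidx algC (enum 'I_n) a.
Proof.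
apply/mpolyP => m; rewrite mcoeff_qidx ?enum_uniq //.
rewrite (_ : [forall i, _]); last by apply/forallP => i; rewrite mem_enum implybT.
rewrite andbT /schur_q raddf_sum /=; case: eqP => [ma|ma]; last first.
  apply: big1 => k /eqP ka; rewrite mcoeffZ mcoeffX.
  by case: eqP => [km|]; rewrite ?mulr0 //; case: ma; rewrite -km.
have lt_m : (mdeg m < a.+1)%N by rewrite ma.
rewrite (bigD1 (BMultinom lt_m)) /= ?ma // mcoeffZ mcoeffX eqxx mulr1.
rewrite big1 ?addr0 // => k /andP[_ km]; rewrite mcoeffZ mcoeffX.
case: eqP => [kE|]; rewrite ?mulr0 //.
by case/eqP: km; apply: val_inj.
Qed.

Definition partn_mon (la : intpartn n) : 'X_{1..n} :=
  [multinom nth 0%N la i | i < n].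

Lemma partn_size_le (la : intpartn n) : (size la <= n)%N.
Proof. by case/andP: (partn_bounds la). Qed.

Lemma schur_QE (la : intpartn n) : schur_Q la = Qpf (qidx algC (enum 'I_n)) la.
Proof.
rewrite /schur_Q /Qpf; move: (uphalf _) (if _ then _ else _) => k s.
elim: k s => [|k IH] [|a s] //; rewrite pf_cons /=; apply: eq_bigr => j _.
rewrite -IH (set_nth_default a) // /schur_Q2 /Qpair !schur_qE.
by congr (_ * (_ + _ * _) * _); apply: eq_bigr => i _; rewrite !schur_qE.
Qed.

Lemma mcoeff_schur_Q (la : intpartn n) : distinct_parts la ->
  (schur_Q la)@_(partn_mon la) = 2 ^+ size la.
Proof.
move=> dla; rewrite schur_QE.
have -> : partn_mon la = moni (enum 'I_n) la.
  by apply/mnmP => i; rewrite !mnmE index_enum_ord.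
case/and3P: (pparts_proof la) => srt s0 _.
apply: mcoeff_Qpf => //; [exact: two_reg_algC | exact: enum_uniq | | ].
  by rewrite size_enum_ord partn_size_le.
rewrite gtn_sorted_uniq_geq; exact/andP.
Qed.

(** [Q_(n)] is [q_n], whose coefficients are powers of 2 counting the variables that occur; here
    there is one for each part of [la]. *)
Lemma mcoeff_schur_Q_row (ro la : intpartn n) : ro = [:: n] :> seq nat ->
  (schur_Q ro)@_(partn_mon la) = 2 ^+ size la.
Proof.
move=> roE; rewrite /schur_Q roE /= big_ord_recl big_ord0 /= expr0 mul1r mulr1 addr0.
rewrite -[schur_Q2 _ _ _]/(Qpair (schur_q n) n 0) Qpair0; last first.
  by rewrite schur_qE /qidx qvars0.
rewrite schur_qE mcoeff_qidx ?enum_uniq //.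
case/and3P: (pparts_proof la) => _ s0 /eqP sumla.
rewrite (_ : _ && _); last first.
  apply/andP; split; last by apply/forallP => i; rewrite mem_enum implybT.
  rewrite mdegE; apply/eqP; rewrite -[RHS]sumla sumnE (big_nth 0%N) big_mkord.
  under eq_bigr => i _ do rewrite mnmE.
  rewrite -(@big_mkord _ _ _ n xpredT (nth 0%N la)) (big_cat_nat (leq0n (size la)) (partn_size_le la)) /=.
  rewrite big_mkord -[RHS]addn0; congr (_ + _)%N.
  rewrite big_nat big1 // => i /andP[li _].
  by rewrite nth_default.
congr (_ ^+ _); rewrite /msuppc -[RHS](card_ord (size la)).
have widen_inj : injective (widen_ord (partn_size_le la)).
  by move=> i j /(congr1 val) /= /val_inj.
rewrite -(card_imset _ widen_inj).
apply: eq_card => i; rewrite !inE mnmE; apply/idP/imsetP => [ila|[j _ ->]] /=.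
  have li : (i < size la)%N by rewrite ltnNge; apply: contra ila => /(nth_default 0%N) ->.
  by exists (Ordinal li) => //; apply: val_inj.
by apply: contraNneq s0 => <-; apply: mem_nth.
Qed.

End SchurQ.

(** * Cycle types *)

Section CycleTypes.

(** Multiplying by [tperm x (s x)], a transposition inside a fibre of [f], fixes one more point. *)
Lemma perm_factor (T : finType) (S : eqType) (f : T -> S) (s : {perm T}) :
  (forall x, f (s x) = f x) ->
  exists2 ts : seq (T * T), s = (\prod_(e <- ts) tperm e.1 e.2)%g
    & all (fun e => (e.1 != e.2) && (f e.1 == f e.2)) ts.
Proof.
have [k] := ubnP #|[pred x | s x != x]|; elim: k s => // k IH s lek fs.
have [s1|] := posnP #|[pred x | s x != x]|; last case/card_gt0P=> x /=.
  exists [::] => //; rewrite big_nil; apply/permP => x; rewrite perm1.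
  by have := card0_eq s1 x; rewrite !inE => /negbFE/eqP.
rewrite inE => sx.
pose s' := (tperm x (s x) * s)%g.
have s'E y : s' y = if y == x then s (s x) else if y == s x then s x else s y.
  rewrite permM; case: tpermP => [->|->|/eqP yx /eqP ysx]; rewrite ?eqxx //.
    by rewrite (negPf sx).
  by rewrite (negPf yx) (negPf ysx).
have [||ts s'ts allts] := IH s'.
- rewrite ltnS in lek; apply: leq_trans lek.
  apply: proper_card; apply/properP; split.
    apply/subsetP => y; rewrite !inE s'E; case: (eqVneq y x) => [->//|_].
    by case: (eqVneq y (s x)) => [->|//]; rewrite eqxx.
  exists (s x); rewrite !inE; first by apply: contra_neq sx => /perm_inj.
  by rewrite s'E (negPf sx) !eqxx.
- by move=> y; rewrite s'E; case: (eqVneq y x) => [->|_]; rewrite ?fs //;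
  case: (eqVneq y (s x)) => [->|_]; rewrite ?fs.
exists ((x, s x) :: ts); last by rewrite /= allts fs eqxx eq_sym sx.
by rewrite big_cons -s'ts /s' mulgA tperm2 mul1g.
Qed.

Variable n : nat.
Implicit Types s t g : 'S_n.

Lemma geq_anti : antisymmetric geq.
Proof. by move=> x y /=; rewrite andbC => /anti_leq. Qed.

Lemma geq_trans : transitive geq.
Proof. by move=> x y z /= xy yz; apply: leq_trans yz xy. Qed.

Lemma cycle_type_eq s (l : seq nat) : sorted geq l ->
  perm_eq [seq #|(X : {set 'I_n})| | X in porbits s] l -> cycle_type s = l.
Proof.
move=> srt pe; apply: (sorted_eq geq_trans geq_anti) => //.
  by apply: sort_sorted => x y; apply: leq_total.
by rewrite perm_sort.
Qed.

Lemma perm_cycle_type s :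
  perm_eq (cycle_type s) [seq #|(X : {set 'I_n})| | X in porbits s].
Proof. by rewrite perm_sort. Qed.

Lemma size_cycle_type s : size (cycle_type s) = #|porbits s|.
Proof. by rewrite size_sort size_map -cardE. Qed.

Lemma porbit_sum s : (\sum_(X in porbits s) #|(X : {set 'I_n})| = n)%N.
Proof.
have part : partition (porbits s) [set: 'I_n].
  have -> : porbits s = preim_partition (porbit s) [set: 'I_n].
    apply/setP => X; apply/imsetP/imsetP => -[x _ ->]; exists x => //;
      by apply/setP => y; rewrite !inE -eq_porbit_mem eq_sym.
  exact: preim_partitionP.
by rewrite -(card_partition part) cardsT card_ord.
Qed.

Lemma cycle_type_is_partn s : is_partn n (cycle_type s).
Proof.
apply/and3P; split; first by apply: sort_sorted => x y; apply: leq_total.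
  rewrite (perm_mem (perm_cycle_type s)); apply/negP => /mapP[X].
  by rewrite mem_enum => /imsetP[x _ ->] /esym/eqP; rewrite (negPf (card_porbit_neq0 _ _)).
rewrite sumnE (perm_big _ (perm_cycle_type s)) /= big_map big_enum /=.
by rewrite porbit_sum.
Qed.

Lemma odd_perm_cycle_type s : odd_perm s = odd (n - size (cycle_type s)).
Proof.
have le_n : (#|porbits s| <= n)%N.
  by rewrite -[X in (_ <= X)%N]card_ord; apply: leq_imset_card.
by rewrite size_cycle_type oddB // /odd_perm card_ord.
Qed.

Lemma iter_porbit_mod s x k :
  iter k s x = iter (k %% #|porbit s x|) s x.
Proof.
rewrite {1}(divn_eq k #|porbit s x|) addnC iterD; congr iter.
by elim: (k %/ _)%N => //= m IH; rewrite mulSn iterD IH iter_porbit.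
Qed.

Section Conjugacy.

Let cardge (X Y : {set 'I_n}) := (#|Y| <= #|X|)%N.
Let orbs s := sort cardge (enum (porbits s)).
Let base (X : {set 'I_n}) : option 'I_n := [pick x in X].

Let orbs_card s : [seq #|(X : {set 'I_n})| | X <- orbs s] = cycle_type s.
Proof. by rewrite /orbs /cycle_type sort_map. Qed.

Let mem_orbs s X : (X \in orbs s) = (X \in porbits s).
Proof. by rewrite mem_sort mem_enum. Qed.

Let uniq_orbs s : uniq (orbs s).
Proof. by rewrite sort_uniq enum_uniq. Qed.

(** Cycles are listed by decreasing size, so equal cycle types match cycles of equal size. The
    [k]-th iterate of the base point of a cycle of [s] goes to the [k]-th iterate of the base point
    of the matching cycle of [t]. *)
Let transfer s t (x : 'I_n) : 'I_n :=
  let X := porbit s x in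
  let b := odflt x (base X) in
  iter (index x (traject s b #|X|)) t
       (odflt x (base (nth set0 (orbs t) (index X (orbs s))))).

Lemma transferE s t x y k : cycle_type s = cycle_type t ->
    base (porbit s x) = Some x ->
    base (nth set0 (orbs t) (index (porbit s x) (orbs s))) = Some y ->
  transfer s t (iter k s x) = iter k t y
  /\ porbit t y = nth set0 (orbs t) (index (porbit s x) (orbs s)).
Proof.
move=> st bx byy.
have xin : porbit s x \in orbs s by rewrite mem_orbs imset_f.
have szE : size (orbs s) = size (orbs t).
  by rewrite -(size_map (fun X : {set 'I_n} => #|X|)) orbs_card st -orbs_card size_map.
have lti : (index (porbit s x) (orbs s) < size (orbs t))%N by rewrite -szE index_mem.
set Y := nth set0 (orbs t) _.
have Yt : Y \in porbits t by rewrite -mem_orbs mem_nth.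
have yY : y \in Y by move: byy; rewrite /base -/Y; case: pickP => // w wY [<-].
have yYE : porbit t y = Y.
  by case/imsetP: Yt yY => w _ -> yw; apply/eqP; rewrite eq_porbit_mem.
split=> //.
have cXY : #|porbit s x| = #|porbit t y|.
  have e : nth 0%N [seq #|(X : {set 'I_n})| | X <- orbs s] (index (porbit s x) (orbs s)) =
     nth 0%N [seq #|(X : {set 'I_n})| | X <- orbs t] (index (porbit s x) (orbs s)).
    by rewrite !orbs_card st.
  by move: e; rewrite !(nth_map set0) ?szE // nth_index // yYE.
have pE : porbit s (iter k s x) = porbit s x by rewrite -permX porbit_perm.
rewrite /transfer pE bx byy /= [iter k s x]iter_porbit_mod.
have ltk : (k %% #|porbit s x| < #|porbit s x|)%N.
  by rewrite ltn_mod lt0n card_porbit_neq0.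
rewrite -(nth_traject _ ltk) index_uniq ?size_traject // ?uniq_traject_porbit //.
by rewrite [RHS]iter_porbit_mod cXY.
Qed.

Lemma cycle_type_conj s t : cycle_type s = cycle_type t -> exists g, t = (s ^ g)%g.
Proof.
move=> st.
have repr s' t' x : cycle_type s' = cycle_type t' -> exists k b y,
   [/\ x = iter k s' b, base (porbit s' b) = Some b
     & base (nth set0 (orbs t') (index (porbit s' b) (orbs s'))) = Some y].
  move=> st'.
  have [b bx] : exists b, base (porbit s' x) = Some b.
    rewrite /base; case: pickP => [b _|/(_ x)]; first by exists b.
    by rewrite porbit_id.
  have bin : b \in porbit s' x.
    by move: bx; rewrite /base; case: pickP => // w wx [<-].
  have pE : porbit s' b = porbit s' x by apply/eqP; rewrite eq_porbit_mem.
  have : x \in porbit s' b by rewrite pE porbit_id.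
  rewrite porbit_traject => /trajectP[k _ xE].
  have szE : size (orbs s') = size (orbs t').
    by rewrite -(size_map (fun X : {set 'I_n} => #|X|)) orbs_card st' -orbs_card size_map.
  have lti : (index (porbit s' b) (orbs s') < size (orbs t'))%N.
    by rewrite -szE index_mem mem_orbs imset_f.
  have := mem_nth set0 lti; rewrite mem_orbs => /imsetP[w _ wE].
  have [y yE] : exists y, base (nth set0 (orbs t') (index (porbit s' b) (orbs s'))) = Some y.
    rewrite /base wE; case: pickP => [y _|/(_ w)]; first by exists y.
    by rewrite porbit_id.
  by exists k, b, y; split=> //; rewrite pE.
have cancelT s' t' : cycle_type s' = cycle_type t' ->
    cancel (transfer s' t') (transfer t' s').
  move=> st' x; have [k [b [y [-> bb yy]]]] := repr s' t' x st'.
  have [-> yE] := transferE k st' bb yy.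
  have bE : nth set0 (orbs s') (index (porbit t' y) (orbs t')) = porbit s' b.
    rewrite yE index_uniq //.
      by rewrite nth_index // mem_orbs imset_f.
    rewrite -(size_map (fun X : {set 'I_n} => #|X|)) orbs_card -st' -orbs_card size_map.
    by rewrite index_mem mem_orbs imset_f.
  have [| |-> //] := @transferE t' s' y b k (esym st').
    by rewrite yE.
  by rewrite bE.
exists (perm (can_inj (cancelT _ _ st))); apply/permP => x.
have [y ->] : exists y, x = perm (can_inj (cancelT _ _ st)) y.
  by exists ((perm (can_inj (cancelT _ _ st)))^-1%g x); rewrite permKV.
rewrite permJ !permE.
have [k [b [w [-> bb ww]]]] := repr s t y st.
have [-> _] := transferE k st bb ww.
by rewrite -iterS; have [-> _] := transferE k.+1 st bb ww.
Qed.

End Conjugacy.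

Lemma single_cycle_type s (C : {set 'I_n}) : C != set0 ->
    {in C, forall x, porbit s x = C} -> {in ~: C, forall x, s x = x} ->
  cycle_type s = #|C| :: nseq (n - #|C|) 1%N.
Proof.
move=> C0 sC s1; have fix1 x : x \in ~: C -> porbit s x = [set x].
  move=> /s1 sx; apply/setP => y; rewrite inE porbit_traject.
  apply/trajectP/eqP => [[k _ ->]|->]; first by elim: k => //= k ->.
  by exists 0%N; rewrite ?lt0n ?card_porbit_neq0.
have EE : porbits s = C |: [set [set x] | x in ~: C].
  apply/setP => X; rewrite !inE; apply/imsetP/orP => [[x _ ->]|].
    case xC: (x \in C); [left; by rewrite sC | right].
    by rewrite fix1 ?imset_f // inE xC.
  case=> [/eqP->|/imsetP[x xC ->]]; last by exists x; rewrite ?fix1.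
  by case/set0Pn: C0 => x xC; exists x; rewrite ?sC.
have C1 : (0 < #|C|)%N by rewrite card_gt0.
apply: cycle_type_eq.
  by case: (n - _)%N => //= k; rewrite C1 /=; elim: k.
have CS : C \notin [set [set x] | x in ~: C].
  apply/imsetP => -[x + CE]; rewrite inE CE inE eqxx //.
have pe : perm_eq (enum (porbits s)) (C :: enum [set [set x] | x in ~: C]).
  apply: uniq_perm; rewrite /= ?enum_uniq ?mem_enum ?CS // => X.
  by rewrite inE !mem_enum EE !inE.
rewrite (perm_trans (perm_map _ pe)) //= perm_cons.
set S := [set [set x] | x in ~: C].
have -> : (n - #|C|)%N = size (enum S).
  rewrite -cardE card_imset; last exact: set1_inj.
  by have := cardsC C; rewrite card_ord; lia.
have : {in enum S, forall X : {set 'I_n}, #|X| = 1%N}.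
  by move=> X; rewrite mem_enum => /imsetP[x _ ->]; apply: cards1.
by elim: (enum S) => //= X r IH c1; rewrite c1 ?mem_head // perm_cons IH // => Y Yr;
  rewrite c1 // inE Yr orbT.
Qed.

End CycleTypes.

Section MoreCycleTypes.

Variable n : nat.
Implicit Types s t g : 'S_n.

Lemma perm_adjacent (P : 'S_n -> Prop) : P 1%g -> (forall s t, P s -> P t -> P (s * t)%g) ->
  (forall i j : 'I_n, j = i.+1 :> nat -> P (tperm i j)) -> forall s, P s.
Proof.
move=> P1 PM Padj s.
have Plt k (i j : 'I_n) : j = (i + k.+1)%N :> nat -> P (tperm i j).
  elim: k i j => [|k IH] i j ij; first by apply: Padj; rewrite ij addn1.
  have lt_j : (j.-1 < n)%N by have := ltn_ord j; lia.
  pose j' := Ordinal lt_j.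
  have ij' : i != j' by rewrite -val_eqE /= ij; lia.
  have ijn : i != j by rewrite -val_eqE /= ij; lia.
  have jj' : P (tperm j' j) by apply: Padj; rewrite /= ij; lia.
  have -> : tperm i j = (tperm j' j * (tperm i j' * tperm j' j))%g.
    rewrite -{1}(tpermV j' j) -[RHS]conjgE tpermJ tpermL.
    by rewrite tpermD 1?eq_sym // eq_sym.
  by apply: (PM) => //; apply: (PM) => //; apply: IH; rewrite /= ij; lia.
have Pt i j : P (tperm i j).
  have [ij|ji|/val_inj ->] := ltngtP i j; last by rewrite tperm1.
    by apply: (Plt (j - i).-1); lia.
  by rewrite tpermC; apply: (Plt (i - j).-1); lia.
have [ts -> _] := @perm_factor _ unit (fun=> tt) s (fun=> erefl).
by elim: ts => [|e ts IH]; rewrite ?big_nil // big_cons; apply: PM.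
Qed.

(** An even permutation with a cycle of even length is the product of that
    cycle and an odd permutation fixing its points. *)
Lemma split_even_cycle s : ~~ odd_perm s -> ~~ all odd (cycle_type s) ->
  exists C : {set 'I_n}, exists c d : 'S_n,
    [/\ s = (c * d)%g, odd_perm c, odd_perm d, {in ~: C, forall x, c x = x}
      & {in C, forall x, c x \in C /\ d x = x}].
Proof.
move=> evs; rewrite (eq_all_r (perm_mem (perm_cycle_type s))).
case/allPn => _ /mapP[C +] ->; rewrite mem_enum => /imsetP[x0 _ CE] evC.
have sC x : (s x \in C) = (x \in C).
  by rewrite CE -!eq_porbit_mem -{1}[s x]/((s ^+ 1)%g x) porbit_perm.
have inj : injective (fun x => if x \in C then s x else x).
  move=> x y; case: ifP => xC; case: ifP => yC //; first exact: perm_inj.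
    by move=> e; move: yC; rewrite -e sC xC.
  by move=> e; move: xC; rewrite e sC yC.
pose c := perm inj; pose d := (c^-1 * s)%g.
have cC x : x \in C -> c x = s x by move=> xC; rewrite permE xC.
have cN x : x \in ~: C -> c x = x by rewrite inE => /negPf xC; rewrite permE xC.
have sd : s = (c * d)%g by rewrite /d mulKVg.
have oddc : odd_perm c.
  have iterc k x : x \in C -> iter k c x = iter k s x.
    elim: k => //= k IH xC; rewrite IH // cC //.
    by elim: k {IH} => //= k IH; rewrite sC.
  have cporb : {in C, forall x, porbit c x = C}.
    move=> x xC; have CEx : porbit s x = C by rewrite CE; apply/eqP; rewrite eq_porbit_mem -CE.
    apply/setP => y; rewrite -[in RHS]CEx; apply/idP/idP; rewrite !porbit_traject.
      by case/trajectP=> k _ ->; rewrite -porbit_traject iterc // -permX mem_porbit.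
    by case/trajectP=> k _ ->; rewrite -porbit_traject -iterc // -permX mem_porbit.
  have C0 : C != set0 by apply/set0Pn; exists x0; rewrite CE porbit_id.
  rewrite odd_perm_cycle_type (single_cycle_type C0 cporb cN) /= size_nseq.
  have leC : (#|C| <= n)%N by rewrite -[X in (_ <= X)%N]card_ord max_card.
  have h k : (k <= n)%N -> ~~ odd k -> (0 < k)%N -> odd (n - (n - k).+1) by lia.
  by apply: h => //; rewrite card_gt0.
exists C, c, d; split=> // [|x xC].
  by move: evs; rewrite {1}sd odd_permM oddc /=; case: (odd_perm d).
split; first by rewrite cC ?sC.
rewrite permM; have yC : (c^-1)%g x \in C.
  apply: contraLR xC; rewrite -in_setC => yC.
  by rewrite -[x](permKV c) cN // -in_setC.
by rewrite -(cC _ yC) permKV.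
Qed.

End MoreCycleTypes.

(** * Blocks of a Young subgroup *)

Section Blocks.

Variables (n : nat) (la : intpartn n).

Definition blk (i : nat) := reshape_index la i.

Lemma la_sum : sumn la = n.
Proof. by case/and3P: (pparts_proof la) => _ _ /eqP. Qed.

Lemma la_pos : 0%N \notin pparts la.
Proof. by case/and3P: (pparts_proof la). Qed.

Lemma la_sorted : sorted geq la.
Proof. by case/and3P: (pparts_proof la). Qed.

Lemma blk_lt (i : 'I_n) : (blk i < size la)%N.
Proof. by apply: reshape_indexP; rewrite la_sum. Qed.

Lemma card_blk j : #|[set i : 'I_n | blk i == j]| = nth 0%N la j.
Proof.
have [lej|ltj] := leqP (size la) j.
  rewrite nth_default //; apply/eqP; rewrite cards_eq0; apply/eqP/setP => i.
  by rewrite !inE; apply/negbTE; rewrite neq_ltn (leq_trans (blk_lt i)).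
have lt_n c : (c < nth 0%N la j)%N -> (flatten_index la j c < n)%N.
  by move=> cj; rewrite -[X in (_ < X)%N]la_sum flatten_indexP.
pose g (c : 'I_(nth 0%N la j)) : 'I_n := Ordinal (lt_n c (ltn_ord c)).
rewrite -[RHS]card_ord -(card_imset predT (f := g)); last first.
  move=> c d /(congr1 val) /= e; apply: val_inj => /=.
  by rewrite -(flatten_indexKr (ltn_ord c)) e flatten_indexKr.
apply: eq_card => i; rewrite inE; apply/eqP/imsetP => [ij|[c _ ->]]; last first.
  by rewrite /blk /= flatten_indexKl.
have lti : (i < sumn la)%N by rewrite la_sum.
have lt_o : (reshape_offset la i < nth 0%N la j)%N by rewrite -ij; apply: reshape_offsetP.
exists (Ordinal lt_o) => //; apply: val_inj => /=.
by rewrite -ij /blk reshape_indexK.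
Qed.

(** On a Young subgroup, the elements of cycle type [la] have the blocks as
    their cycles. *)
Definition block_cycles (s : 'S_n) :=
  [forall i : 'I_n, forall j : 'I_n, (blk i == blk j) ==> (j \in porbit s i)].

Hypothesis dla : distinct_parts la.

Lemma row_stabP (s : 'S_n) : reflect (forall i, blk (s i) = blk i) (s \in row_stab la).
Proof. by rewrite inE; apply: (iffP forallP) => h i; apply/eqP. Qed.

Lemma porbit_blk (s : 'S_n) (i j : 'I_n) : s \in row_stab la -> j \in porbit s i -> blk j = blk i.
Proof.
move=> /row_stabP sY; rewrite porbit_traject => /trajectP[k _ ->].
by elim: k => //= k IH; rewrite sY.
Qed.

Lemma block_cycles_porbit (s : 'S_n) (i : 'I_n) : s \in row_stab la -> block_cycles s ->
  porbit s i = [set j : 'I_n | blk j == blk i].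
Proof.
move=> sY /forallP full; apply/setP => j; rewrite inE; apply/idP/eqP.
  exact: porbit_blk.
by move=> ji; have /forallP/(_ j) := full i; rewrite ji eqxx.
Qed.

Lemma block_cycles_type s : s \in row_stab la -> block_cycles s -> cycle_type s = la.
Proof.
move=> sY full; apply: cycle_type_eq; first exact: la_sorted.
pose fib j := [set i : 'I_n | blk i == j].
have pe : perm_eq (enum (porbits s)) [seq fib j | j <- iota 0 (size la)].
  apply: uniq_perm; rewrite ?enum_uniq // ?map_inj_in_uniq ?iota_uniq //.
    move=> j k; rewrite !mem_iota /= !add0n => jl kl jk.
    have : (0 < #|fib j|)%N.
      by rewrite card_blk lt0n; apply: contra la_pos => /eqP <-; apply: mem_nth.
    rewrite card_gt0 => /set0Pn[i ij]; move: (ij); rewrite jk !inE => /eqP <-.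
    by move: ij; rewrite inE => /eqP.
  move=> X; rewrite mem_enum; apply/imsetP/mapP => [[i _ ->]|[j]].
    by exists (blk i); rewrite ?mem_iota ?blk_lt // block_cycles_porbit.
  rewrite mem_iota /= add0n => jl ->.
  have : (0 < #|fib j|)%N.
    by rewrite card_blk lt0n; apply: contra la_pos => /eqP <-; apply: mem_nth.
  rewrite card_gt0 => /set0Pn[i]; rewrite inE => /eqP <-.
  by exists i; rewrite ?block_cycles_porbit.
rewrite (perm_trans (perm_map _ pe)) // -map_comp.
rewrite (@eq_map _ _ _ (nth 0%N la)); last by move=> j; apply: card_blk.
by rewrite -/(mkseq _ _) mkseq_nth.
Qed.

(** A block is a cycle of [s], so [g] maps it into a single block, and the size of the block of a
    point does not decrease under [g]. The sum of these sizes over all points is unchanged, so they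
    are preserved; as the parts are distinct, the size determines the block. *)
Lemma block_cycles_fusion (s g : 'S_n) : s \in row_stab la -> block_cycles s ->
  (s ^ g)%g \in row_stab la -> g \in row_stab la.
Proof.
move=> sY full sgY.
pose h (i : 'I_n) := nth 0%N la (blk i).
have le_h i : (h i <= h (g i))%N.
  rewrite /h -!card_blk -(block_cycles_porbit i sY full).
  rewrite -(card_imset _ (@perm_inj _ g)).
  apply: subset_leq_card; apply/subsetP => _ /imsetP[j ji ->]; rewrite inE; apply/eqP.
  apply: (porbit_blk sgY); move: ji; rewrite !porbit_traject.
  case/trajectP => k _ ->; apply/trajectP.
  have -> : g (iter k s i) = iter k (s ^ g)%g (g i).
    by elim: k => //= k <-; rewrite permJ.
  have := mem_porbit (s ^ g) k (g i); rewrite permX porbit_traject.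
  by move/trajectP.
have eq_h i : h i = h (g i).
  have [_] := leqif_sum (P := xpredT) (fun i _ => leqif_eq (le_h i)).
  have <- : (\sum_i h i = \sum_i h (g i))%N by rewrite (reindex_inj (@perm_inj _ g)).
  by rewrite eqxx => /esym/forallP/(_ i)/eqP.
apply/row_stabP => i; have := eq_h i; rewrite /h => /eqP; rewrite eq_sym.
by rewrite nth_uniq ?blk_lt // => /eqP.
Qed.

End Blocks.

(** * Coefficients of power sums as permutation characters *)

Section Frobenius.

Variables (n : nat) (la : intpartn n).
Hypothesis n_gt0 : (0 < n)%N.
Implicit Types (s w : 'S_n) (f : {ffun 'I_n -> 'I_n}).

Let j0 : 'I_n := Ordinal n_gt0.

Definition content f := [multinom #|[set i | f i == j]| | j < n].

Definition colourings s : {set {ffun 'I_n -> 'I_n}} :=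
  [set f : {ffun 'I_n -> 'I_n} | [forall i, f (s i) == f i] && (content f == partn_mon la)].

Lemma ffun_perm f f0 : content f = content f0 -> exists w, f = [ffun i => f0 (w i)].
Proof.
move=> ff0; pose t := [tuple f0 i | i < n].
have : perm_eq [seq f i | i <- enum 'I_n] t.
  apply/allP => j _ /=; apply/eqP.
  have cE (g : {ffun 'I_n -> 'I_n}) : count_mem j [seq g i | i <- enum 'I_n] = content g j.
    by rewrite mnmE count_map -sum1_count big_enum_cond /= sum1dep_card.
  by rewrite !cE ff0.
case/tuple_permP => w fw; exists w; apply/ffunP => i; rewrite ffunE.
have := congr1 (fun r => nth j0 r i) fw.
by rewrite (nth_map j0) ?size_enum_ord // nth_ord_enum -tnth_nth !tnth_mktuple => ->.
Qed.

(** Expanding the product chooses a variable for each cycle of [s], that is, a colouring constant on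
    the cycles. *)
Lemma power_prod_coeff s :
  (\prod_(k <- cycle_type s) \sum_(i < n) 'X_i ^+ k : {mpoly algC[n]})@_(partn_mon la)
    = #|colourings s|%:R.
Proof.
rewrite (perm_big _ (perm_cycle_type s)) /= big_map big_enum /=.
rewrite (big_distr_big_dep j0) /= raddf_sum /=.
pose Fs := pfamily j0 (mem (porbits s)) (fun=> predT) : {pred {ffun {set 'I_n} -> 'I_n}}.
pose col_of (F : {ffun {set 'I_n} -> 'I_n}) := [ffun i : 'I_n => F (porbit s i)].
have FX (F : {ffun {set 'I_n} -> 'I_n}) :
    (\prod_(O in porbits s) 'X_(F O) ^+ #|(O : {set 'I_n})|)
    = 'X_[content (col_of F)] :> {mpoly algC[n]}.
  under eq_bigr => O _ do rewrite mpolyXn.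
  rewrite mprodXE; congr 'X_[_]; apply/mnmP => j.
  rewrite mnm_sumE mnmE.
  transitivity (\sum_(O in porbits s) (F O == j) * #|(O : {set 'I_n})|)%N.
    by apply: eq_bigr => O _; rewrite mulmnE mnm1E.
  rewrite -sum1dep_card (partition_big (porbit s) (mem (porbits s))) /=; last first.
    by move=> i _; apply: imset_f.
  apply: eq_bigr => _ /imsetP[x _ ->].
  rewrite -sum1_card big_distrr /= [RHS]big_mkcond /= [LHS]big_mkcond /=.
  apply: eq_bigr => i _; rewrite ffunE -eq_porbit_mem.
  by case: (eqVneq (porbit s i) (porbit s x)) => [->|_]; rewrite ?andbT ?andbF //;
    case: eqP.
transitivity (#|[set F in Fs | content (col_of F) == partn_mon la]|%:R : algC).
  rewrite -sum1dep_card natr_sum big_mkcondr /=; apply: eq_bigr => F _.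
  by rewrite FX mcoeffX; case: eqP.
congr _%:R; rewrite -(card_in_imset (f := col_of)); last first.
  move=> F H; rewrite !inE => /andP[/pfamilyP[Fsup _] _] /andP[/pfamilyP[Hsup _] _] FH.
  apply/ffunP => O; have [/imsetP[x _ ->]|nO] := boolP (O \in porbits s).
    by have /ffunP/(_ x) := FH; rewrite !ffunE.
  have out (H' : {ffun {set 'I_n} -> 'I_n}) : j0.-support H' \subset mem (porbits s) -> H' O = j0.
    by move=> /subsetP sub; apply: contraNeq nO => HO; apply: sub.
  by rewrite !out.
congr #|pred_of_set _|; apply/setP => f; rewrite inE; apply/imsetP/andP.
  case=> F; rewrite inE => /andP[_ cF] ->; split=> //.
  apply/forallP => i; rewrite !ffunE (_ : porbit s (s i) = porbit s i) //.
  by rewrite -{1}[s i]/((s ^+ 1)%g i) porbit_perm.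
case=> /forallP fs cf.
pose F := [ffun O : {set 'I_n} => if O \in porbits s then
             if [pick x in O] is Some x then f x else j0 else j0].
have fE : f = col_of F.
  apply/ffunP => i; rewrite !ffunE imset_f //; case: pickP => [x|/(_ i)]; last first.
    by rewrite porbit_id.
  rewrite porbit_traject => /trajectP[k _ ->].
  by elim: k => //= k IH; rewrite (eqP (fs _)).
exists F => //; rewrite inE -fE cf andbT; apply/pfamilyP; split=> //.
by apply/subsetP => O; rewrite !inE ffunE; case: ifP => //; rewrite eqxx.
Qed.

Let f0 := [ffun i : 'I_n => Ordinal (leq_trans (blk_lt la i) (partn_size_le la))].

Let content_f0 : content f0 = partn_mon la.
Proof.
apply/mnmP => j; rewrite !mnmE -(card_blk la j); apply: eq_card => i.
by rewrite !inE ffunE -val_eqE.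
Qed.

(** The colourings of content [la] are the translates of [f0], the colouring by blocks, and the
    translating permutation is unique up to a coset of the Young subgroup. *)
Lemma card_colourings s :
  (#|row_stab la| * #|colourings s| = #|[set w : 'S_n | (s ^ w)%g \in row_stab la]|)%N.
Proof.
pose fw w := [ffun i => f0 (w i)].
have f0E (i j : 'I_n) : (f0 i == f0 j) = (blk la i == blk la j).
  by rewrite !ffunE -val_eqE.
have fw_content w : content (fw w) = partn_mon la.
  rewrite -content_f0; apply/mnmP => j; rewrite !mnmE.
  rewrite -[RHS](card_imset _ (@perm_inj _ (w^-1)%g)); apply: eq_card => i.
  rewrite !inE ffunE; apply/idP/imsetP => [h|[k + ->]].
    by exists (w i); rewrite ?inE // permK.
  by rewrite inE permKV.
have fw_inv w : (fw w \in colourings s) = ((s ^ w)%g \in row_stab la).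
  rewrite inE fw_content eqxx andbT; apply/forallP/row_stabP => h i.
    have := h (w^-1%g i); rewrite [fw w _]ffunE [X in _ == X]ffunE f0E permKV => /eqP <-.
    by rewrite -permJ permKV.
  by rewrite [fw w _]ffunE [X in _ == X]ffunE f0E -permJ h.
rewrite -[RHS]sum1dep_card (partition_big fw (mem (colourings s))) /=; last first.
  by move=> w; rewrite fw_inv.
rewrite mulnC -sum_nat_const; apply: eq_bigr => f fcol.
have [|w0 fE] := @ffun_perm f f0.
  by move: fcol; rewrite inE content_f0 => /andP[_ /eqP].
rewrite sum1dep_card -(card_lcoset (row_stab la) w0).
apply: eq_card => w; rewrite mem_lcoset [RHS]inE -/(row_stab la).
have <- : (fw w == f) = ((w0^-1 * w)%g \in row_stab la).
  rewrite fE; apply/eqP/row_stabP => [/ffunP h i|h].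
    have /eqP := h (w0^-1%g i).
    by rewrite [fw w _]ffunE [X in _ == X]ffunE f0E permM permKV => /eqP.
  apply/ffunP => i; apply/eqP; rewrite [fw w i]ffunE [X in _ == X]ffunE f0E.
  by rewrite -(h (w0 i)) permM permK.
by rewrite -[_ \in fibre_perms _]fw_inv; case: eqP => [->|_]; rewrite ?fcol ?andbF.
Qed.

Lemma power_sum_coeff (a : intpartn n) s : cycle_type s = a ->
  (power_sum a)@_(partn_mon la)
    = #|[set w : 'S_n | (s ^ w)%g \in row_stab la]|%:R / #|row_stab la|%:R.
Proof.
move=> sa; rewrite /power_sum -sa power_prod_coeff -card_colourings natrM mulrC.
by rewrite mulKf // pnatr_eq0 -lt0n cardG_gt0.
Qed.

End Frobenius.

(** * Clifford relations in basic spin representations *)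

Section DoubleCoverFacts.

Variables (n : nat) (hn : (4 <= n)%N) (b0 : bool).
Variables (gT : finGroupType) (G : {group gT}) (z : gT) (t : nat -> gT).
Variable p : {morphism G >-> 'S_n}.
Hypothesis hG : double_cover b0 z t p.

Lemma dc_zG : z \in G.
Proof. by have /setIP[] := dc_central hG. Qed.

Lemma dc_tG i : (i.+1 < n)%N -> t i \in G.
Proof.
move=> i_n; rewrite (dc_gen hG) mem_gen // !inE; apply/orP; right.
have lt_i : (i < n.-1)%N by lia.
by apply/imsetP; exists (Ordinal lt_i).
Qed.

Lemma dc_z2 : (z * z = 1)%g.
Proof. by have := expg_order z; rewrite (dc_order hG). Qed.

Lemma dc_zz x : x \in <[z]>%g -> x = 1%g \/ x = z.
Proof.
case/cycleP => k ->; rewrite -(odd_double_half k) expgD -muln2 mulnC expgM.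
rewrite [(z ^+ 2)%g]dc_z2 expg1n mulg1.
by case: odd; [right | left].
Qed.

Lemma dc_pz : p z = 1%g.
Proof. by apply: mker; rewrite (dc_ker hG) cycle_id. Qed.

Lemma dc_fibre g h : g \in G -> h \in G -> p g = p h -> g = h \/ g = (z * h)%g.
Proof.
move=> gG hG' pgh; have : (g * h^-1)%g \in ('ker p)%g.
  by rewrite !inE groupM ?groupV //= morphM ?groupV // morphV // pgh mulgV.
rewrite (dc_ker hG) => /dc_zz[e|e]; [left|right].
  by rewrite -[g](mulgKV h) e mul1g.
by rewrite -[g](mulgKV h) e.
Qed.

Lemma dc_onto s : exists2 g, g \in G & p g = s.
Proof.
move: s; apply: perm_adjacent => [|s u [g gG <-] [h hG' <-]|i j ij].
- by exists 1%g; rewrite ?morph1.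
- by exists (g * h)%g; rewrite ?groupM ?morphM.
have i_n : (i.+1 < n)%N by rewrite -ij.
by exists (t i); [apply: dc_tG | apply: (dc_proj hG)].
Qed.

Lemma dc_im : (p @* G)%g = [set: 'S_n].
Proof.
apply/setP => s; rewrite inE; have [g gG <-] := dc_onto s.
by rewrite mem_morphim.
Qed.

Lemma dc_cover_ind (P : gT -> Prop) :
    P 1%g -> P z -> (forall g h, g \in G -> h \in G -> P g -> P h -> P (g * h)%g) ->
    (forall i, (i.+1 < n)%N -> P (t i)) -> forall g, g \in G -> P g.
Proof.
move=> P1 Pz PM Pt g gG.
suff H s : forall g, g \in G -> p g = s -> P g by apply: H gG erefl.
move: s; apply: perm_adjacent => [h hG'|s u IHs IHu h hG' hsu|i j ij h hG'].
- rewrite -(morph1 p) => /(dc_fibre hG' (group1 G)); case=> -> //.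
  by apply: PM; rewrite ?dc_zG.
- have [x xG xs] := dc_onto s.
  rewrite -(mulKVg x h); apply: PM; rewrite ?groupM ?groupV //; first exact: IHs.
  by apply: IHu; rewrite ?groupM ?groupV // morphM ?groupV // morphV // hsu xs mulKg.
have i_n : (i.+1 < n)%N by rewrite -ij.
rewrite -(dc_proj hG ij) => /(dc_fibre hG' (dc_tG i_n)); case=> ->; first exact: Pt.
by apply: PM; rewrite ?dc_zG ?dc_tG //; apply: Pt.
Qed.

Definition dcsgn g : algC := (-1) ^+ odd_perm (p g).

Lemma dcsgnM g h : g \in G -> h \in G -> dcsgn (g * h)%g = dcsgn g * dcsgn h.
Proof. by move=> gG hG'; rewrite /dcsgn morphM // odd_permM signr_addb. Qed.

Section Clifford.

Variables (N : nat) (rG : mx_representation algC G N.+1).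
Hypothesis rz : rG z = - 1.
Let kappa : algC := (-1) ^+ b0.
Let T i : 'M[algC]_N.+1 := rG (t i).
(** Satisfied by basic spin representations ([braid_acomm]) only: with it the
    [T i] generate a Clifford algebra. *)
Hypothesis T_adj : forall i, (i.+2 < n)%N -> T i * T i.+1 + T i.+1 * T i = - kappa *: 1.

Let rM g h : g \in G -> h \in G -> rG (g * h)%g = rG g * rG h.
Proof. exact: repr_mxM. Qed.

Lemma T_sq i : (i.+1 < n)%N -> T i * T i = kappa *: 1.
Proof.
move=> i_n; rewrite -rM ?dc_tG // -[(_ * _)%g]/(t i ^+ 2)%g (dc_square hG i_n) /kappa.
by case: b0; rewrite ?rz ?repr_mx1 ?expr1 ?scaleN1r ?scale1r.
Qed.

Lemma T_far i j : (i.+1 < j)%N -> (j.+1 < n)%N -> T i * T j = - (T j * T i).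
Proof.
move=> ij jn; have i_n : (i.+1 < n)%N by lia.
rewrite -!rM ?dc_tG // (dc_far hG ij jn) -mulgA !rM ?groupM ?dc_zG ?dc_tG //.
by rewrite rz mulN1r.
Qed.

Definition acomm (A B : 'M[algC]_N.+1) := A * B + B * A.

Lemma acommDl A B C : acomm (A + B) C = acomm A C + acomm B C.
Proof. by rewrite /acomm mulrDl mulrDr addrACA. Qed.

Lemma acommDr A B C : acomm A (B + C) = acomm A B + acomm A C.
Proof. by rewrite /acomm mulrDl mulrDr addrACA. Qed.

Lemma acommNl A B : acomm (- A) B = - acomm A B.
Proof. by rewrite /acomm mulNr mulrN opprD. Qed.

Lemma acommNr A B : acomm A (- B) = - acomm A B.
Proof. by rewrite /acomm mulNr mulrN opprD. Qed.

Lemma acommC A B : acomm A B = acomm B A.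
Proof. by rewrite /acomm addrC. Qed.

Lemma acomm_suml (I : Type) (r : seq I) (Q : pred I) F A :
  acomm (\sum_(i <- r | Q i) F i) A = \sum_(i <- r | Q i) acomm (F i) A.
Proof. by rewrite /acomm mulr_suml mulr_sumr -big_split. Qed.

Lemma acomm_sumr (I : Type) (r : seq I) (Q : pred I) F A :
  acomm A (\sum_(i <- r | Q i) F i) = \sum_(i <- r | Q i) acomm A (F i).
Proof. by rewrite acommC acomm_suml; apply: eq_bigr => i _; rewrite acommC. Qed.

Definition dlt (i j : nat) : algC := (i == j)%:R.

Lemma T_acomm i j : (i.+1 < n)%N -> (j.+1 < n)%N -> acomm (T i) (T j) =
  (kappa * (2 * dlt i j - dlt i j.+1 - dlt i.+1 j)) *: 1.
Proof.
have Tlt k l : (k < l)%N -> (l.+1 < n)%N ->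
    acomm (T k) (T l) = (- kappa * dlt k.+1 l) *: 1.
  rewrite leq_eqVlt /acomm => /orP[/eqP <-|kl] ln.
    by rewrite T_adj // /dlt eqxx mulr1.
  by rewrite T_far // addNr /dlt (ltn_eqF kl) mulr0 scale0r.
move=> i_n jn; have [ij|ji|->] := ltngtP i j.
- rewrite Tlt //; congr (_ *: _).
  by rewrite /dlt (ltn_eqF ij) (ltn_eqF (leqW ij)) /=; ring.
- rewrite acommC Tlt //; congr (_ *: _); rewrite /dlt (gtn_eqF ji) (gtn_eqF (leqW ji)).
  by rewrite [j.+1 == i]eq_sym /=; ring.
rewrite /acomm T_sq // -scalerDl; congr (_ *: _).
by rewrite /dlt eqxx (ltn_eqF (ltnSn j)) (gtn_eqF (ltnSn j)) /=; ring.
Qed.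

(** The image of [e_0 - e_a]; the constants in [TD_acomm] and [DD_acomm] are inner products of such
    vectors, up to [kappa]. *)
Definition Dmx a : 'M[algC]_N.+1 := \sum_(j < a) T j.

Lemma TD_acomm j a : (j.+1 < n)%N -> (a < n)%N -> acomm (T j) (Dmx a) =
  (kappa * (dlt j 0 - dlt j a + dlt j.+1 a)) *: 1.
Proof.
move=> jn; elim: a => [|a IH] an.
  rewrite /Dmx big_ord0 /acomm mulr0 mul0r addr0.
  by rewrite subrr add0r /dlt /= mulr0 scale0r.
rewrite /Dmx big_ord_recr /= acommDr IH 1?ltnW // T_acomm // -scalerDl.
by congr (_ *: _); rewrite [dlt j.+1 a.+1]/dlt eqSS -/(dlt j a); ring.
Qed.

Lemma DD_acomm a b : (a < n)%N -> (b < n)%N -> acomm (Dmx a) (Dmx b) =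
  (kappa * (1 - dlt a 0 - dlt b 0 + dlt a b)) *: 1.
Proof.
move=> an; elim: b => [|b IH] bn.
  rewrite /Dmx big_ord0 /acomm mulr0 mul0r addr0.
  by rewrite [dlt 0 0]/dlt eqxx /= (_ : _ * _ = 0) ?scale0r //; ring.
rewrite /Dmx big_ord_recr /= -/(Dmx _) acommDr IH 1?ltnW // acommC TD_acomm // -scalerDl.
congr (_ *: _); rewrite [dlt b.+1 0]/dlt /= [dlt b a]/dlt eq_sym -/(dlt a b).
by rewrite [dlt b.+1 a]/dlt eq_sym -/(dlt a b.+1); ring.
Qed.

(** The image of [e_a - e_b] under the Clifford map of the root space, scaled so
    that [t_i] is represented by [root_mx i i.+1]. *)
Definition root_mx (a b : 'I_n) := Dmx b - Dmx a.
Local Notation R := root_mx.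

Lemma root_acomm a b c d : acomm (R a b) (R c d) =
  (kappa * (dlt a c - dlt a d - dlt b c + dlt b d)) *: 1.
Proof.
rewrite /R !(acommDl, acommDr, acommNl, acommNr) !DD_acomm // -!scaleNr -!scalerDl.
by congr (_ *: _); ring.
Qed.

Lemma root_adj (i j : 'I_n) : j = i.+1 :> nat -> R i j = T i.
Proof. by move=> ij; rewrite /R /Dmx ij big_ord_recr /= addrAC subrr add0r. Qed.

Lemma root_sq a b : a != b -> R a b * R a b = kappa *: 1.
Proof.
move=> ab; have := root_acomm a b a b; rewrite /acomm -mulr2n => e.
have {}e : (R a b * R a b) *+ 2 = (kappa *: 1) *+ 2.
  rewrite e scalerMnl; congr (_ *: _).
  rewrite /dlt !eqxx [_ == _ :> nat](negPf ab).
  by rewrite [(b : nat) == a]eq_sym [_ == _ :> nat](negPf ab) /=; ring.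
have := congr1 (fun M => 2^-1 *: M) e.
by rewrite -!scaler_nat !scalerA ?mulrA !mulVf ?pnatr_eq0 // ?mul1r ?scale1r.
Qed.

(** Both sides are multiplicative in [g]; for a generator this is the Clifford form of the
    reflection in a simple root. *)
Lemma root_conj g a b : g \in G ->
  rG g * R (p g a) (p g b) = dcsgn g *: (R a b * rG g).
Proof.
move=> gG; move: g gG a b; apply: dc_cover_ind.
- by move=> a b; rewrite /dcsgn morph1 !perm1 odd_perm1 scale1r repr_mx1 mulr1 mul1r.
- move=> a b; rewrite /dcsgn dc_pz !perm1 odd_perm1 scale1r rz.
  by rewrite mulrN1 mulN1r.
- move=> g h gG hG' IHg IHh a b.
  rewrite morphM // !permM rM // -mulrA IHh -scalerAr mulrA IHg dcsgnM //.
  by rewrite -scalerAl scalerA mulrC mulrA.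
move=> i i_n a b; pose i' := Ordinal (ltnW i_n); pose j' := Ordinal i_n.
rewrite /dcsgn (dc_proj hG (i := i') (j := j')) //.
have ij : i' != j' by rewrite -val_eqE /= ltn_eqF.
have DE c : Dmx (tperm i' j' c) = Dmx c + (dlt i' c - dlt j' c) *: R i' j'.
  case: tpermP => [->|->|/eqP ci /eqP cj].
  - rewrite /dlt eqxx [_ == _ :> nat]eq_sym [_ == _ :> nat](negPf ij) subr0 scale1r.
    by rewrite /R addrC subrK.
  - by rewrite /dlt eqxx [_ == _ :> nat](negPf ij) sub0r scaleN1r /R opprB addrC subrK.
  rewrite /dlt ![_ == c :> nat]eq_sym [_ == _ :> nat](negPf ci) [_ == _ :> nat](negPf cj).
  by rewrite subrr scale0r addr0.
have -> : R (tperm i' j' a) (tperm i' j' b) =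
    R a b - (dlt i' a - dlt i' b - dlt j' a + dlt j' b) *: R i' j'.
  rewrite /R !DE opprD addrACA -scaleNr -scalerDl -scaleNr -/(R i' j').
  by congr (_ + _ *: _); ring.
have <- : R i' j' = rG (t i) by apply: (root_adj (i := i') (j := j')).
rewrite mulrBr -scalerAr root_sq // scalerA.
have := root_acomm i' j' a b; rewrite /acomm [kappa * _]mulrC => <-.
by rewrite odd_tperm ij expr1 scaleN1r opprD addrA subrr sub0r.
Qed.

Lemma root_lift g a b : g \in G -> a != b -> p g = tperm a b ->
  rG g = R a b \/ rG g = - R a b.
Proof.
move=> gG ab pg.
have lt0 : (0 < n)%N by lia. have lt1 : (1 < n)%N by lia.
pose i0 := Ordinal lt0; pose i1 := Ordinal lt1.
(* This permutation sends 0 to [a] and 1 to [b], so the conjugate of [t 0] by [h] lifts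
   [tperm a b]. *)
have [h hG' ph] := dc_onto (tperm i0 a * tperm (tperm i0 a i1) b)%g.
have h0 : p h i0 = a.
  have ba : b != a by rewrite eq_sym.
  have ca : tperm i0 a i1 != a by rewrite -{2}(tpermL i0 a) (inj_eq perm_inj).
  by rewrite ph permM (tpermL i0 a); apply: tpermD.
have h1 : p h i1 = b by rewrite ph permM tpermL.
have t0G : t 0%N \in G by apply: dc_tG; lia.
have pt0 : p (t 0%N) = tperm i0 i1 by apply: (dc_proj hG (i := i0)).
have [e|e] : rG (t 0%N ^ h)%g = R a b \/ rG (t 0%N ^ h)%g = - R a b.
- have := root_conj i0 i1 hG'; rewrite h0 h1 (root_adj (i := i0) (j := i1)) // => e.
  have e2 : rG (t 0%N ^ h)%g = dcsgn h *: R a b.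
    rewrite conjgE !rM ?groupM ?groupV //.
    have -> : rG (t 0%N) * rG h = dcsgn h *: (rG h * R a b).
      by rewrite e scalerA -expr2 sqrr_sign scale1r.
    by rewrite -scalerAr mulrA -rM ?groupV // mulVg repr_mx1 mul1r.
  by rewrite e2 /dcsgn; case: odd_perm; [right|left]; rewrite ?scaleN1r ?scale1r.
- have := dc_fibre gG (groupJ t0G hG') _; rewrite morphJ // pt0 tpermJ h0 h1 pg.
  case=> // ->; [by left | right].
  by rewrite rM ?dc_zG ?groupJ // rz mulN1r e.
have := dc_fibre gG (groupJ t0G hG') _; rewrite morphJ // pt0 tpermJ h0 h1 pg.
case=> // ->; [by right | left].
by rewrite rM ?dc_zG ?groupJ // rz mulN1r e opprK.
Qed.

Definition word (ts : seq ('I_n * 'I_n)) := \prod_(e <- ts) R e.1 e.2.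

Lemma word_lift ts g : g \in G -> all (fun e => e.1 != e.2) ts ->
  p g = (\prod_(e <- ts) tperm e.1 e.2)%g -> rG g = word ts \/ rG g = - word ts.
Proof.
elim: ts g => [|e ts IH] g gG /=.
  move=> _; rewrite big_nil /word big_nil -(morph1 p) => /(dc_fibre gG (group1 G)).
  by case=> ->; [left | right]; rewrite ?mulg1 ?rz ?repr_mx1.
case/andP=> e12 ets; rewrite big_cons /word big_cons -/(word ts) => pg.
have [h hG' ph] := dc_onto (tperm e.1 e.2).
have hgG : (h^-1 * g)%g \in G by rewrite groupM ?groupV.
have [|y1|y2] := IH _ hgG ets.
- by rewrite morphM ?groupV // morphV // pg ph mulKg.
- rewrite -(mulKVg h g) rM ?groupM ?groupV // y1.
  by case: (root_lift hG' e12 ph) => ->; [left | right; rewrite mulNr].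
rewrite -(mulKVg h g) rM ?groupM ?groupV // y2.
by case: (root_lift hG' e12 ph) => ->; [right; rewrite mulrN | left; rewrite mulrNN].
Qed.

End Clifford.

End DoubleCoverFacts.

(** * Traces of products of roots *)

Section CliffordTraces.

Variables (n : nat) (hn : (4 <= n)%N) (b0 : bool).
Variables (gT : finGroupType) (G : {group gT}) (z : gT) (t : nat -> gT).
Variable p : {morphism G >-> 'S_n}.
Hypothesis hG : double_cover b0 z t p.
Variables (N : nat) (rG : mx_representation algC G N.+1).
Hypothesis rz : rG z = - 1.
Hypothesis T_adj : forall i, (i.+2 < n)%N ->
  rG (t i) * rG (t i.+1) + rG (t i.+1) * rG (t i) = - ((-1) ^+ b0) *: 1.
Local Notation kappa := ((-1) ^+ b0 : algC).
Local Notation R := (@root_mx n gT G t N rG).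
Local Notation word := (@word n gT G t N rG).

Let rM g h : g \in G -> h \in G -> rG (g * h)%g = rG g * rG h.
Proof. exact: repr_mxM. Qed.

Lemma root_acommute a b c d : acomm (R a b) (R c d) =
  (kappa * (dlt a c - dlt a d - dlt b c + dlt b d)) *: 1.
Proof. exact: (root_acomm hn hG rz T_adj). Qed.

Lemma word_anticomm (A : 'M_N.+1) ts : {in ts, forall e, A * R e.1 e.2 = - (R e.1 e.2 * A)} ->
  A * word ts = (-1) ^+ size ts *: (word ts * A).
Proof.
elim: ts => [|e ts IH] Ae; first by rewrite /word !big_nil mulr1 mul1r scale1r.
have -> : word (e :: ts) = R e.1 e.2 * word ts by rewrite /word big_cons.
rewrite mulrA Ae ?mem_head // mulNr -[R e.1 e.2 * A * _]mulrA IH; last first.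
  by move=> f fts; apply: Ae; rewrite inE fts orbT.
by rewrite -scalerAr mulrA exprS mulN1r scaleNr.
Qed.

(** The lift of a cycle of even length is, up to sign, an odd number of roots supported on [C]. The
    lift of the other factor is odd and fixes [C] pointwise, so it anticommutes with each of these
    roots, hence with their product; cyclicity makes the trace its own opposite. *)
Lemma mxtrace_even_cycle x : x \in G -> ~~ odd_perm (p x) ->
  ~~ all odd (cycle_type (p x)) -> \tr (rG x) = 0.
Proof.
move=> xG evx /(split_even_cycle evx) [C [c [d [cd oc od cN cC]]]].
have [h hG' hc] := dc_onto hn hG c.
pose y := (h^-1 * x)%g; have yG : y \in G by rewrite groupM ?groupV.
have yd : p y = d by rewrite morphM ?groupV // morphV // hc cd mulKg.
pose f i := if i \in C then None else Some i.
have fc i : f (c i) = f i.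
  rewrite /f; case: (boolP (i \in C)) => iC; first by have [-> _] := cC i iC.
  by rewrite cN ?inE // (negPf iC).
have [ts cts tsP] := perm_factor fc.
have ts12 : all (fun e => e.1 != e.2) ts by apply: sub_all tsP => e /andP[].
have odd_ts : odd (size ts) by rewrite -(odd_perm_prod ts12) -cts.
have yts : {in ts, forall e, rG y * R e.1 e.2 = - (R e.1 e.2 * rG y)}.
  move=> e ets; have /andP[e12 /eqP fe] := allP tsP e ets.
  have [e1 e2] : e.1 \in C /\ e.2 \in C.
    move: fe; rewrite /f; case: ifP => e1C; case: ifP => e2C // [fe].
    by rewrite fe eqxx in e12.
  have := root_conj hn hG rz T_adj e.1 e.2 yG; rewrite yd /dcsgn yd od expr1 scaleN1r.
  by have [_ ->] := cC _ e1; have [_ ->] := cC _ e2.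
have ah : rG y * rG h = - (rG h * rG y).
  have := word_anticomm yts; rewrite -signr_odd odd_ts expr1 scaleN1r => yw.
  have [->|->] := word_lift hn hG rz T_adj hG' ts12 (etrans hc cts) => //.
  by rewrite mulrN yw mulNr.
have : \tr (rG x) = - \tr (rG x).
  rewrite -{1}(mulKVg h x) -/y rM // -mulmxE mxtrace_mulC mulmxE ah linearN /=.
  by rewrite -rM // mulKVg.
by move/eqP; rewrite -addr_eq0 -mulr2n mulrn_eq0 => /eqP.
Qed.

Section Commutant.

Variables (S : eqType) (f : 'I_n -> S) (P : 'M[algC]_N.+1).
Hypothesis PR : forall a b, f a = f b -> P * R a b = R a b * P.

(** How far [tr (P M)] is from the multiple of [tr M] with which it agrees at [M = 1]. *)
Let defect (M : 'M[algC]_N.+1) := \tr (P * M) * N.+1%:R - \tr P * \tr M.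

Let defectD A B : defect (A + B) = defect A + defect B.
Proof. by rewrite /defect mulrDr !raddfD /=; ring. Qed.

Let defectN A : defect (- A) = - defect A.
Proof. by rewrite /defect mulrN !raddfN /=; ring. Qed.

Let defectZ c A : defect (c *: A) = c * defect A.
Proof. by rewrite /defect -scalerAr !linearZ /=; ring. Qed.

(** Exchanging the first root with the next costs a sign and a shorter word of even length, whose
    defect is 0 by induction. After an odd number of exchanges the root stands last; it commutes
    with [P], so cyclicity of the trace brings it back to the front, and the defect equals its
    opposite. *)
Lemma commutant_word k ts : size ts = k.*2 -> all (fun e => f e.1 == f e.2) ts ->
  defect (word ts) = 0.
Proof.
elim: k ts => [|k IH] ts sz tsf.
  rewrite (size0nil sz) /word big_nil /defect mulr1.
  by rewrite [\tr 1%R]mxtrace1; ring.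
case: ts sz tsf => // e ts [sz] /= /andP[/eqP fe tsf].
have move_e ts1 ts2 : (size ts1 + size ts2 = k.*2.+1)%N ->
    all (fun e => f e.1 == f e.2) (ts1 ++ ts2) ->
    defect (R e.1 e.2 * word ts1 * word ts2) =
    (-1) ^+ size ts1 * defect (word ts1 * R e.1 e.2 * word ts2).
  elim/last_ind: ts1 ts2 => [|ts1 g IH1] ts2 sz12 f12.
    by rewrite /word big_nil mulr1 mul1r expr0 mul1r.
  have wE : word (rcons ts1 g) = word ts1 * R g.1 g.2.
    by rewrite /word big_rcons.
  have wE2 : word (g :: ts2) = R g.1 g.2 * word ts2 by rewrite /word big_cons.
  rewrite size_rcons in sz12 *; rewrite wE.
  have -> : R e.1 e.2 * (word ts1 * R g.1 g.2) * word ts2 =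
            R e.1 e.2 * word ts1 * word (g :: ts2) by rewrite wE2 !mulrA.
  rewrite IH1 /=; [|by rewrite addnS|by rewrite -cat_rcons].
  rewrite wE2 exprS -mulrA; have := root_acommute e.1 e.2 g.1 g.2.
  set c := kappa * _; rewrite /acomm => /(canRL (addrK _)) eg.
  rewrite -!mulrA [R e.1 e.2 * (R g.1 g.2 * _)]mulrA eg mulrDl mulrDr -scalerAl mul1r -scalerAr.
  have -> : word ts1 * word ts2 = word (ts1 ++ ts2) by rewrite /word big_cat.
  rewrite defectD defectZ IH ?mulr0 ?add0r; last 2 first.
  - by rewrite size_cat; lia.
  - by move: f12; rewrite cat_rcons !all_cat /= => /and3P[-> _ ->].
  by rewrite !mulNr mulrN defectN !mulrA; ring.
have w1 : word (e :: ts) = R e.1 e.2 * word ts by rewrite /word big_cons.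
have cyc : defect (word ts * R e.1 e.2) = defect (R e.1 e.2 * word ts).
  rewrite /defect; congr (_ * _ - _ * _); last by rewrite -!mulmxE mxtrace_mulC.
  by rewrite mulrA -mulmxE mxtrace_mulC mulmxE mulrA -PR // mulrA.
have w0 : word [::] = 1 by rewrite /word big_nil.
have := move_e ts [::]; rewrite cats0 addn0 w0 !mulr1 => me.
rewrite w1.
have e1 : defect (R e.1 e.2 * word ts) = - defect (R e.1 e.2 * word ts).
  by rewrite {1}me // cyc sz exprS -signr_odd odd_double mulr1 mulN1r.
by move/eqP: e1; rewrite -addr_eq0 -mulr2n mulrn_eq0 => /eqP.
Qed.

Lemma commutant_trace y : y \in G -> ~~ odd_perm (p y) -> (forall i, f (p y i) = f i) ->
  \tr (P * rG y) * N.+1%:R = \tr P * \tr (rG y).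
Proof.
move=> yG evy fy; have [ts yts tsP] := perm_factor fy.
have ts12 : all (fun e => e.1 != e.2) ts by apply: sub_all tsP => e /andP[].
have tsf : all (fun e => f e.1 == f e.2) ts by apply: sub_all tsP => e /andP[].
have ev_ts : size ts = (size ts)./2.*2.
  by rewrite -[LHS]odd_double_half -(odd_perm_prod ts12) -yts (negPf evy).
have /eqP := commutant_word ev_ts tsf; rewrite /defect subr_eq0 => /eqP d0.
have [->|->] := word_lift hn hG rz T_adj yG ts12 yts => //.
by rewrite mulrN !raddfN /= mulNr mulrN d0.
Qed.

End Commutant.

End CliffordTraces.

(** * Vectors of the root space attached to two cycles *)

Section OrbitVectors.

Variables (n : nat) (hn : (4 <= n)%N) (b0 : bool).
Variables (gT : finGroupType) (G : {group gT}) (z : gT) (t : nat -> gT).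
Variable p : {morphism G >-> 'S_n}.
Hypothesis hG : double_cover b0 z t p.
Variables (N : nat) (rG : mx_representation algC G N.+1).
Hypothesis rz : rG z = - 1.
Hypothesis T_adj : forall i, (i.+2 < n)%N ->
  rG (t i) * rG (t i.+1) + rG (t i.+1) * rG (t i) = - ((-1) ^+ b0) *: 1.
Local Notation kappa := ((-1) ^+ b0 : algC).
Local Notation R := (@root_mx n gT G t N rG).
Local Notation D := (@Dmx gT G t N rG).

(** The image of [|O_j|] times the sum of the [e_a] over [O_i], minus [|O_i|] times the sum of the
    [e_b] over [O_j], for the cycles [O_i] and [O_j] of [s]: a vector fixed by [s]. *)
Definition orbit_mx (s : 'S_n) i j := \sum_(a in porbit s i) \sum_(b in porbit s j) R a b.

Lemma orbit_mx_conj x i j : x \in G ->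
  rG x * orbit_mx (p x) i j = dcsgn p x *: (orbit_mx (p x) i j * rG x).
Proof.
move=> xG; set s := p x.
have mem_s k a : (s a \in porbit s k) = (a \in porbit s k).
  by rewrite -!eq_porbit_mem -{1}[s a]/((s ^+ 1)%g a) porbit_perm.
rewrite {1}/orbit_mx mulr_sumr (reindex_inj (@perm_inj _ s)) /=.
rewrite (eq_bigl (mem (porbit s i))) => [|a]; last by rewrite mem_s.
rewrite mulr_suml scaler_sumr; apply: eq_bigr => a _.
rewrite mulr_sumr (reindex_inj (@perm_inj _ s)) /=.
rewrite (eq_bigl (mem (porbit s j))) => [|b]; last by rewrite mem_s.
rewrite mulr_suml scaler_sumr; apply: eq_bigr => b _.
exact: (root_conj hn hG rz T_adj).
Qed.

(** Since [D a] stands for [e_0 - e_a], weights of sum 0 remove the base point [e_0], and the usual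
    square norm is left. *)
Lemma weighted_sq (u : 'I_n -> algC) : \sum_a u a = 0 ->
  acomm (\sum_a u a *: D a) (\sum_a u a *: D a) = (kappa * \sum_a u a ^+ 2) *: 1.
Proof.
move=> u0; rewrite acomm_suml.
have step a : acomm (u a *: D a) (\sum_b u b *: D b) =
   (kappa * (u a * (- (\sum_b u b * dlt b 0) + u a))) *: 1.
  rewrite acomm_sumr.
  have e b : acomm (u a *: D a) (u b *: D b) =
    (kappa * u a * (u b * (1 - dlt a 0) - u b * dlt b 0 + u b * dlt a b)) *: 1.
    rewrite /acomm -!scalerAl -!scalerAr !scalerA [u b * u a]mulrC -scalerDr.
    have := DD_acomm hn hG rz T_adj (ltn_ord a) (ltn_ord b); rewrite /acomm => ->.
    by rewrite scalerA; congr (_ *: _); ring.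
  under eq_bigr => b _ do rewrite e.
  rewrite -scaler_suml; congr (_ *: _); rewrite -mulr_sumr !big_split /= sumrN -mulr_suml u0.
  have -> : \sum_b u b * dlt a b = u a.
    rewrite (bigD1 a) //= /dlt eqxx mulr1 big1 ?addr0 // => b /negPf ba.
    by rewrite [_ == _]eq_sym [_ == _]ba mulr0.
  ring.
under eq_bigr => a _ do rewrite step.
rewrite -scaler_suml -mulr_sumr; congr ((_ * _) *: _).
under eq_bigr => a _ do rewrite mulrDr -expr2.
by rewrite big_split /= -mulr_suml u0 mul0r add0r.
Qed.

Lemma orbit_mx_sq s i j : j \notin porbit s i ->
  exists2 c, c != 0 & orbit_mx s i j * orbit_mx s i j = c *: 1.
Proof.
move=> ji; pose m k : algC := #|porbit s k|%:R.
pose u (a : 'I_n) := m i * (a \in porbit s j)%:R - m j * (a \in porbit s i)%:R.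
have sum_in k : \sum_a (a \in porbit s k)%:R = m k.
  by rewrite /m -sum1_card natr_sum [RHS]big_mkcond; apply: eq_bigr => a _; case: ifP.
have u0 : \sum_a u a = 0 by rewrite sumrB -!mulr_sumr !sum_in mulrC subrr.
have D_in k : \sum_(a in porbit s k) D a = \sum_a (a \in porbit s k)%:R *: D a.
  rewrite big_mkcond /=; apply: eq_bigr => a _.
  by case: ifP; rewrite ?scale1r ?scale0r.
have UE : orbit_mx s i j = \sum_a u a *: D a.
  rewrite /orbit_mx; under eq_bigr => a _ do rewrite sumrB sumr_const.
  rewrite sumrB sumr_const sumrMnl -!scaler_nat.
  rewrite !D_in !scaler_sumr -sumrB.
  by apply: eq_bigr => a _; rewrite !scalerA -scalerBl.
have := weighted_sq u0; rewrite -UE /acomm -mulr2n -scaler_nat => e.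
have {}e : orbit_mx s i j * orbit_mx s i j = (2^-1 * (kappa * \sum_a u a ^+ 2)) *: 1.
  by rewrite -scalerA -e scalerA mulVf ?pnatr_eq0 // scale1r.
exists (2^-1 * (kappa * \sum_a u a ^+ 2)) => //.
rewrite !mulf_neq0 ?invr_eq0 ?pnatr_eq0 ?signr_eq0 //.
have u_real a : u a \is Num.real.
  by rewrite rpredB ?rpredM ?realn.
rewrite psumr_neq0 => [|a _]; last by rewrite -realEsqr.
apply/hasP; exists i; first by rewrite mem_index_enum.
rewrite /= lt_def -realEsqr u_real andbT expf_eq0 /= /u porbit_id mulr1.
rewrite porbit_sym (negPf ji) mulr0 sub0r oppr_eq0 pnatr_eq0.
exact: card_porbit_neq0.
Qed.

End OrbitVectors.

(** * The Clifford relation deduced from degree and trace *)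

Section BraidRelation.

Lemma mxtrace_idem (F : fieldType) m (A : 'M[F]_m) :
  A *m A = A -> \tr A = (\rank A)%:R.
Proof.
move=> AA; have CB : row_base A *m col_base A = 1%:M.
  have : col_base A *m (row_base A *m col_base A) *m row_base A =
         col_base A *m 1%:M *m row_base A.
    by rewrite mulmx1 mulmxA mulmx_base -mulmxA mulmx_base AA.
  by move/(row_free_inj (row_base_free A))/(row_full_inj (col_base_full A)).
by rewrite -{1}(mulmx_base A) mxtrace_mulC CB mxtrace1.
Qed.

Lemma two_pow_third k r : (3 * r <> 2 ^ k)%N.
Proof.
move=> e; have := Euclid_dvdX 2 k (isT : prime 3).
by rewrite -e dvdn_mulr.
Qed.

Variables (n : nat) (hn : (4 <= n)%N) (b0 : bool).
Variables (gT : finGroupType) (G : {group gT}) (z : gT) (t : nat -> gT).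
Variable p : {morphism G >-> 'S_n}.
Hypothesis hG : double_cover b0 z t p.
Variables (N : nat) (rG : mx_representation algC G N.+1).
Hypothesis rz : rG z = - 1.
Hypothesis N2 : exists k, N.+1 = (2 ^ k)%N.
Hypothesis tr3 : forall i, (i.+2 < n)%N -> exists b : bool,
  \tr (rG (t i * t i.+1)%g) = (-1) ^+ b * (N.+1%:R / 2).

(** The eigenvalue 1 of the order 3 element [kappa t_i t_(i+1)] would have
    multiplicity [2 N / 3] or [0], so it does not occur. *)
Lemma braid_acomm i : (i.+2 < n)%N ->
  rG (t i) * rG (t i.+1) + rG (t i.+1) * rG (t i) = - ((-1) ^+ b0) *: 1.
Proof.
move=> i_n; set ka : algC := (-1) ^+ b0.
have ka2 : ka * ka = 1 by rewrite -expr2 sqrr_sign.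
have tiG := dc_tG hn hG (ltnW i_n); have tjG := dc_tG hn hG i_n.
set A := rG (t i); set B := rG (t i.+1).
have AA : A * A = ka *: 1.
  rewrite -[A * A]repr_mxM // -[(_ * _)%g]/(t i ^+ 2)%g (dc_square hG (ltnW i_n)) /ka.
  by case: (b0); rewrite ?rz ?repr_mx1 ?expr1 ?scaleN1r ?scale1r.
have BB : B * B = ka *: 1.
  rewrite -[B * B]repr_mxM // -[(_ * _)%g]/(t i.+1 ^+ 2)%g (dc_square hG i_n) /ka.
  by case: (b0); rewrite ?rz ?repr_mx1 ?expr1 ?scaleN1r ?scale1r.
have AB3 : A * B * (A * B) * (A * B) = ka *: 1.
  have -> : A * B = rG (t i * t i.+1)%g by rewrite repr_mxM.
  set x := (t i * t i.+1)%g; have xG : x \in G by rewrite groupM.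
  rewrite -[rG x * rG x]repr_mxM // -[_ * rG x]repr_mxM ?groupM // -mulgA.
  rewrite -[(x * (x * x))%g]/(x ^+ 3)%g (dc_braid hG i_n) /ka.
  by case: (b0); rewrite ?rz ?repr_mx1 ?expr1 ?scaleN1r ?scale1r.
have ABBA : A * B * (B * A) = 1.
  by rewrite mulrA -(mulrA A) BB -scalerAr mulr1 -scalerAl AA scalerA ka2 scale1r.
have BAAB : B * A * (A * B) = 1.
  by rewrite mulrA -(mulrA B) AA -scalerAr mulr1 -scalerAl BB scalerA ka2 scale1r.
have ABAB : A * B * (A * B) = ka *: (B * A).
  rewrite -[LHS]mulr1 -ABBA mulrA AB3 -scalerAl mul1r.
  by [].
set X := A * B in ABBA BAAB ABAB *; set Y := B * A in ABBA BAAB ABAB *.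
have YE : Y = ka *: (X * X) by rewrite ABAB scalerA ka2 scale1r.
have YY : Y * Y = ka *: X by rewrite {1}YE -scalerAl -mulrA ABBA mulr1.
(* The powers of [ka X] are [1], [ka X] and [ka Y], so [W / 3] is the projection onto its eigenspace
   for the eigenvalue 1. *)
set W := 1 + ka *: X + ka *: Y.
have XW : (ka *: X) * W = W.
  rewrite /W !mulrDr mulr1 -!scalerAl -!scalerAr !scalerA ka2 !scale1r ABAB ABBA.
  by rewrite addrC addrA.
have YW : (ka *: Y) * W = W.
  rewrite /W !mulrDr mulr1 -!scalerAl -!scalerAr !scalerA ka2 !scale1r BAAB YY.
  by rewrite addrAC [ka *: Y + _]addrC addrAC [_ + 1]addrC.
have WW : W * W = 3%:R *: W.
  rewrite {1}/W !mulrDl mul1r XW YW.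
  by rewrite -[in LHS](scale1r W) -!scalerDl; congr (_ *: _); ring.
pose Q := 3^-1 *: W.
have QQ : Q *m Q = Q.
  by rewrite mulmxE /Q -scalerAl -scalerAr WW !scalerA -mulrA mulVf ?pnatr_eq0 // mulr1.
have := mxtrace_idem QQ.
have -> : \tr Q = 3^-1 * (N.+1%:R + 2 * (ka * \tr X)).
  have trY : \tr Y = \tr X by rewrite /Y /X -!mulmxE mxtrace_mulC.
  by rewrite /Q linearZ /= /W !linearD !linearZ /= [\tr 1%R]mxtrace1 trY; ring.
have [b] := tr3 i_n; rewrite repr_mxM // mulmxE -/A -/B -/X => ->.
move=> trQ.
have {}trQ : 3 * (\rank Q)%:R = N.+1%:R + ka * (-1) ^+ b * N.+1%:R :> algC.
  by rewrite -trQ; field.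
have Q0 : Q = 0.
  apply/eqP; rewrite -mxrank_eq0 -(@pnatr_eq0 algC).
  have [e|e] : ka * (-1) ^+ b = 1 \/ ka * (-1) ^+ b = -1 :> algC.
  - rewrite /ka; case: (b0); case: (b); rewrite ?expr0 ?expr1 ?mulrNN ?mulr1 ?mul1r;
      by [left | right].
  - case: N2 => k Nk; move/eqP: trQ.
    rewrite e mul1r -natrM -natrD eqr_nat addnn -mul2n => /eqP.
    by rewrite [in RHS]Nk -expnS => /two_pow_third.
  by move/eqP: trQ; rewrite e mulN1r subrr mulf_eq0 !pnatr_eq0.
have W0 : W = 0.
  by apply/eqP; move/eqP: Q0; rewrite /Q scaler_eq0 invr_eq0 pnatr_eq0.
have -> : X + Y = ka *: (W - 1).
  have -> : W - 1 = ka *: (X + Y).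
    by rewrite /W scalerDr -[1 + _ + _]addrA addrAC subrr add0r.
  by rewrite scalerA ka2 scale1r.
by rewrite W0 sub0r scalerN scaleNr.
Qed.

End BraidRelation.

(** * Basic spin characters *)

Section SpinCharacters.

Variables (n : nat) (hn : (4 <= n)%N) (b0 : bool).
Variables (gT : finGroupType) (G : {group gT}) (z : gT) (t : nat -> gT).
Variable p : {morphism G >-> 'S_n}.
Hypothesis hG : double_cover b0 z t p.

Lemma spin_repr (chi : 'CF(G)) : irr_spin z chi ->
  exists N, exists2 rG : mx_representation algC G N.+1, chi = cfRepr rG & rG z = - 1.
Proof.
have zG := dc_zG hG.
case/andP=> /irrP[i ->]; have : z \in 'Z('chi_i)%CF.
  by have := dc_central hG; rewrite -cap_cfcenter_irr => /bigcapP/(_ i); apply.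
have /char_reprP[[[|N] rG] chiE] := irr_char i.
  by have := irr1_neq0 i; rewrite chiE cfRepr1 eqxx.
rewrite chiE cfcenter_repr cfker_repr => zc zk; exists N, rG => //.
move: zc zk; rewrite !inE zG /= mul1mx => /is_scalar_mxP[a za] z1.
have : rG z *m rG z = 1%:M by rewrite -repr_mxM // (dc_z2 hG) repr_mx1.
rewrite za -scalar_mxM => /matrixP/(_ 0 0); rewrite !mxE eqxx !mulr1n => /eqP.
rewrite -expr2 sqrf_eq1 => /orP[/eqP a1|/eqP ->]; last first.
  by rewrite raddfN /=.
by case/negP: z1; rewrite za a1.
Qed.

Lemma spin_z (chi : 'CF(G)) g : irr_spin z chi -> g \in G -> chi (z * g)%g = - chi g.
Proof.
move=> /spin_repr[N [rG -> rz]] gG; rewrite !cfunE groupM ?(dc_zG hG) // gG !mulr1n.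
by rewrite repr_mxM ?(dc_zG hG) // rz mulNmx mul1mx raddfN.
Qed.

Lemma cycle_type_fibre g h : g \in G -> h \in G ->
    cycle_type (p g) = cycle_type (p h) ->
  exists2 k, k \in G & h = (g ^ k)%g \/ h = (z * g ^ k)%g.
Proof.
move=> gG hG' /cycle_type_conj[s hs]; have [k kG ks] := dc_onto hn hG s.
exists k => //; apply: (dc_fibre hG); rewrite ?groupJ //.
by rewrite morphJ // ks.
Qed.

Variables (c : intpartn n -> gT) (sp : intpartn n -> bool -> 'CF(G)).
Hypothesis hsp : spin_labelling z p c sp.

Lemma row_partn_subproof : is_partn n [:: n].
Proof. by rewrite /is_partn /= addn0 eqxx inE; lia. Qed.
Definition row_partn := IntPartn row_partn_subproof.

Lemma row_distinct : distinct_parts row_partn.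
Proof. by []. Qed.

Definition zeta := sp row_partn true.

Lemma zeta_spin : irr_spin z zeta.
Proof. exact: (sl_spin hsp). Qed.

Lemma zeta_odd (a : intpartn n) : odd_parts a -> zeta (c a) = 2 ^+ (size a).-1./2.
Proof. exact: (sl_basic hsp). Qed.

Lemma ones_partn_subproof : is_partn n (nseq n 1%N).
Proof.
apply/and3P; split; last by rewrite sumn_nseq mul1n.
  by elim: (n) => // -[|m] //= IH; rewrite IH.
by rewrite mem_nseq andbF.
Qed.

Lemma zeta1 : zeta 1%g = 2 ^+ n.-1./2.
Proof.
pose a := IntPartn ones_partn_subproof.
rewrite -(sl_class1 hsp (a := a)) // zeta_odd /= ?size_nseq //.
by rewrite /odd_parts /= all_nseq orbT.
Qed.

Lemma three_partn_subproof : is_partn n (3 :: nseq (n - 3) 1%N).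
Proof.
apply/and3P; split; last by rewrite /= sumn_nseq mul1n; lia.
  by case: (n - 3)%N => // m /=; elim: m.
by rewrite inE /= mem_nseq andbF.
Qed.

Lemma braid_cycle_type i : (i.+2 < n)%N ->
  cycle_type (p (t i * t i.+1)%g) = 3 :: nseq (n - 3) 1%N.
Proof.
move=> i_n; have lt1 := ltnW i_n; have lt0 := ltnW lt1.
pose x := Ordinal lt0; pose y := Ordinal lt1; pose w := Ordinal i_n.
have xy : x != y by rewrite -val_eqE /= ltn_eqF.
have yw : y != w by rewrite -val_eqE /= ltn_eqF.
have xw : x != w by rewrite -val_eqE /= ltn_eqF.
set s := p _; have sE : s = (tperm x y * tperm y w)%g.
  rewrite /s morphM ?(dc_tG hn hG) // (dc_proj hG (i := x) (j := y)) //.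
  by rewrite (dc_proj hG (i := y) (j := w)).
have sx : s x = w by rewrite sE permM tpermL tpermL.
have sy : s y = x by rewrite sE permM tpermR tpermD // eq_sym.
have sw : s w = y by rewrite sE permM (tpermD xw yw) tpermR.
pose C := [set x; y; w].
have C3 : #|C| = 3%N.
  by rewrite /C -setUA cardsU1 cards2 !inE yw (negPf xy) (negPf xw).
have sC : {in C, forall v, s v \in C}.
  by move=> v; rewrite !inE => /orP[/orP[]|] /eqP ->; rewrite ?sx ?sy ?sw eqxx ?orbT.
have := @single_cycle_type n s C; rewrite C3; apply.
- by rewrite -card_gt0 C3.
- have sub v : v \in C -> porbit s v \subset C.
    move=> vC; apply/subsetP => u; rewrite porbit_traject => /trajectP[k _ ->].
    by elim: k => //= k; apply: sC.
  move=> v vC; apply/eqP; rewrite eqEsubset sub //=.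
  have mem u : u \in porbit s v -> s u \in porbit s v.
    by rewrite -!eq_porbit_mem -{1}[s u]/((s ^+ 1)%g u) porbit_perm.
  have vin := porbit_id s v.
  apply/subsetP => u uC; move: vC uC vin (mem _ vin) (mem _ (mem _ vin)).
  rewrite !inE => /orP[/orP[]|] /eqP -> /orP[/orP[]|] /eqP ->;
    by rewrite ?(sx, sy, sw).
move=> v; rewrite !inE !negb_or -andbA => /and3P[vx vy vw].
by rewrite sE permM !tpermD // eq_sym.
Qed.

Lemma zeta_repr : exists N, exists2 rG : mx_representation algC G N.+1,
  zeta = cfRepr rG & rG z = - 1 /\ (forall i, (i.+2 < n)%N ->
     rG (t i) * rG (t i.+1) + rG (t i.+1) * rG (t i) = - ((-1) ^+ b0) *: 1).
Proof.
have [N [rG zE rz]] := spin_repr zeta_spin; exists N, rG => //; split=> // i i_n.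
have N2 : N.+1 = (2 ^ n.-1./2)%N.
  by apply/eqP; rewrite -(@eqr_nat algC) natrX -zeta1 zE cfRepr1.
apply: (braid_acomm hn hG rz) => //; first by exists n.-1./2.
move=> j jn; pose a := IntPartn three_partn_subproof.
have oa : odd_parts a by rewrite /odd_parts /= all_nseq orbT.
have [caG cat] := sl_class hsp oa.
have gG : (t j * t j.+1)%g \in G by rewrite groupM ?(dc_tG hn hG) // ltnW.
(* A 3-cycle has [n - 2] cycles and the identity [n], so the exponent of 2 drops by one: the value
   is half the degree. *)
have val : zeta (c a) = N.+1%:R / 2.
  rewrite zeta_odd // N2 /= size_nseq natrX.
  have -> : n.-1./2 = ((n - 3)./2.+1)%N by lia.
  by rewrite exprSr mulfK ?pnatr_eq0.
have [|k kG tk] := cycle_type_fibre caG gG.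
  by rewrite cat braid_cycle_type.
have -> : \tr (rG (t j * t j.+1)%g) = zeta (t j * t j.+1)%g by rewrite zE cfunE gG mulr1n.
case: tk => ->; [exists false | exists true].
  by rewrite cfunJ // val mul1r.
by rewrite (spin_z zeta_spin) ?groupJ // cfunJ // val mulN1r.
Qed.

End SpinCharacters.

Lemma cycle_typeJ n (s g : 'S_n) : cycle_type (s ^ g)%g = cycle_type s.
Proof.
have porbitJ x : porbit (s ^ g)%g (g x) = g @: porbit s x.
  have iterJ k : iter k (s ^ g)%g (g x) = g (iter k s x).
    by elim: k => //= k ->; rewrite permJ.
  apply/setP => y; apply/porbitP/imsetP => [[k ->]|[u /porbitP[k ->] ->]].
    by exists ((s ^+ k)%g x); rewrite ?mem_porbit // !permX iterJ.
  by exists k; rewrite !permX iterJ.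
apply: cycle_type_eq; first by have /and3P[] := cycle_type_is_partn s.
rewrite perm_sym (perm_trans (perm_cycle_type s)) //.
have pe : perm_eq (enum (porbits (s ^ g)%g)) [seq g @: (X : {set 'I_n}) | X in porbits s].
  apply: uniq_perm; rewrite ?enum_uniq ?map_inj_uniq ?enum_uniq //.
    exact: (imset_inj (@perm_inj _ g)).
  move=> X; rewrite mem_enum; apply/imsetP/mapP => [[x _ ->]|[Y + ->]].
    exists (porbit s (g^-1%g x)); first by rewrite mem_enum imset_f.
    by rewrite -porbitJ permKV.
  by rewrite mem_enum => /imsetP[x _ ->]; exists (g x); rewrite ?porbitJ.
rewrite perm_sym (perm_trans (perm_map _ pe)) // -map_comp.
rewrite (@eq_map _ _ _ (fun X : {set 'I_n} => #|X|)) // => X /=.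
by rewrite card_imset //; apply: perm_inj.
Qed.

(** * Sums over Young subgroups *)

Section YoungSums.

Variables (n : nat) (hn : (4 <= n)%N) (b0 : bool).
Variables (gT : finGroupType) (G : {group gT}) (z : gT) (t : nat -> gT).
Variable p : {morphism G >-> 'S_n}.
Hypothesis hG : double_cover b0 z t p.

Lemma z_neq1 : z != 1%g.
Proof. by rewrite -order_eq1 (dc_order hG). Qed.

Lemma cover_sum (F : 'S_n -> algC) : \sum_(g in G) F (p g) = 2 * \sum_s F s.
Proof.
rewrite (partition_big p predT) //= mulr_sumr; apply: eq_bigr => s _.
have [h hG' hs] := dc_onto hn hG s.
rewrite (eq_bigl (mem [set h; (z * h)%g])) => [|g].
  rewrite big_setU1 ?big_set1 /=; last first.
    by rewrite inE -{1}[h]mul1g (inj_eq (mulIg h)) eq_sym z_neq1.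
  by rewrite morphM ?(dc_zG hG) // (dc_pz hG) mul1g hs; ring.
rewrite !inE; apply/andP/orP => [[gG /eqP pg]|].
  by have := dc_fibre hG gG hG'; rewrite pg hs => /(_ erefl)[] ->; rewrite eqxx; [left|right].
case=> /eqP ->; rewrite ?groupM ?(dc_zG hG) ?hs //.
by rewrite morphM ?(dc_zG hG) // (dc_pz hG) mul1g hs.
Qed.

Lemma card_cover : #|G|%:R = 2 * n`!%:R :> algC.
Proof.
have := cover_sum (fun=> 1); rewrite !sumr_const => ->.
by congr (_ * _%:R); rewrite card_Sn.
Qed.

Lemma card_type (a : intpartn n) (s : 'S_n) : cycle_type s = a ->
  #|[set u : 'S_n | cycle_type u == a]|%:R = n`!%:R / #|('C[s])%g|%:R :> algC.
Proof.
move=> sa; have -> : [set u : 'S_n | cycle_type u == a] = (s ^: [set: 'S_n])%g.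
  apply/setP => u; rewrite inE; apply/eqP/imsetP => [ua|[g _ ->]].
    have [|g ->] := @cycle_type_conj n s u; first by rewrite sa ua.
    by exists g.
  by rewrite cycle_typeJ.
have := Lagrange (subcent1_sub s [set: 'S_n]%G).
rewrite index_cent1 /= setTI cardsT card_Sn => <-.
by rewrite natrM mulrC mulKf // pnatr_eq0 -lt0n cardG_gt0.
Qed.

Variable c : intpartn n -> gT.
Hypothesis cO : forall a, odd_parts a -> c a \in G /\ cycle_type (p (c a)) = a.

Definition type_of (s : 'S_n) : intpartn n := IntPartn (cycle_type_is_partn s).

Lemma type_sum (H : gT -> algC) :
    (forall g h, g \in G -> h \in G -> cycle_type (p g) = cycle_type (p h) -> H g = H h) ->
    (forall g, g \in G -> ~~ all odd (cycle_type (p g)) -> H g = 0) ->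
  \sum_(g in G) H g =
  #|G|%:R * \sum_(a : intpartn n | odd_parts a) (#|('C[p (c a)])%g|%:R)^-1 * H (c a).
Proof.
move=> Htype Hodd; rewrite (bigID (fun g => odd_parts (type_of (p g)))) /= addrC big1 ?add0r.
  rewrite (partition_big (fun g => type_of (p g)) (@odd_parts n)) /= => [|g /andP[]//].
  rewrite mulr_sumr; apply: eq_bigr => a oa; have [caG cat] := cO oa.
  transitivity (\sum_(g in G) (cycle_type (p g) == a)%:R * H (c a)).
    rewrite [RHS]big_mkcond [LHS]big_mkcond /=; apply: eq_bigr => g _.
    case: (boolP (g \in G)) => //= gG; rewrite -val_eqE /=.
    case: eqP => [ga|]; last by rewrite andbF mul0r.
    have -> : odd_parts (type_of (p g)) by rewrite /odd_parts /= ga.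
    by rewrite mul1r; apply: Htype => //; rewrite ga cat.
  rewrite -mulr_suml (cover_sum (fun s => (cycle_type s == a)%:R)) mulrA card_cover.
  congr (_ * _); rewrite -mulrA -(card_type cat) -sum1dep_card natr_sum; congr (_ * _).
  by rewrite [RHS]big_mkcond; apply: eq_bigr => s _; case: eqP.
by move=> g /andP[gG /Hodd]; apply.
Qed.

Variable la : intpartn n.

Definition young : {group gT} := (p @*^-1 (row_stab la))%G.

Lemma youngP g : (g \in young) = (g \in G) && (p g \in row_stab la).
Proof. by rewrite !inE. Qed.

Lemma young_sub : young \subset G.
Proof. exact: subsetIl. Qed.

Lemma card_young : #|young|%:R = 2 * #|row_stab la|%:R :> algC.
Proof.
rewrite card_morphpre; last by rewrite (dc_im hn hG) subsetT.
by rewrite (dc_ker hG) natrM -[#|<[z]>%g|]/(#[z]%g) (dc_order hG).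
Qed.

(** The order of the Young subgroup times its permutation character at [s]. *)
Definition fusion_count (s : 'S_n) := #|[set w : 'S_n | (s ^ w)%g \in row_stab la]|.

Lemma fusion_countJ s w : fusion_count (s ^ w)%g = fusion_count s.
Proof.
rewrite /fusion_count -(card_imset _ (mulgI w)); apply: eq_card => v; rewrite inE.
apply/imsetP/idP => [[u + ->]|vs]; first by rewrite inE -conjgM.
by exists (w^-1 * v)%g; rewrite ?mulKVg // inE -conjgM mulKVg.
Qed.

Lemma young_sum (H : gT -> algC) :
    (forall g k, g \in G -> k \in G -> H (g ^ k)%g = H g) ->
  n`!%:R * \sum_(y in young) H y = \sum_(g in G) H g * (fusion_count (p g))%:R.
Proof.
move=> HJ; transitivity (\sum_(w : 'S_n) \sum_(g in G) ((p g ^ w)%g \in row_stab la)%:R * H g).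
  rewrite mulr_natl -card_Sn -sumr_const; apply: eq_bigr => w _.
  have [k kG kw] := dc_onto hn hG w.
  rewrite [RHS](reindex_inj (conjg_inj k^-1)%g) /= [LHS]big_mkcond [RHS]big_mkcond /=.
  apply: eq_bigr => g _; rewrite youngP groupJr ?groupV //.
  case: (boolP (g \in G)) => //= gG; rewrite HJ ?groupV // morphJ ?groupV //.
  by rewrite morphV // kw conjgKV; case: ifP; rewrite ?mul1r ?mul0r.
rewrite exchange_big /=; apply: eq_bigr => g gG; rewrite -mulr_suml mulrC; congr (_ * _).
by rewrite /fusion_count -sum1dep_card natr_sum [RHS]big_mkcond; apply: eq_bigr => w _; case: ifP.
Qed.

End YoungSums.

(** Splits the exponent of 2 in the expansion of a Q-function at a class with [L] parts into that of
    [zeta] at this class and a remainder depending on [L] only through its parity, which for odd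
    parts is that of [n]. *)
Lemma half_parity A L : (0 < L)%N -> odd A = odd L ->
  (A + L)./2 = (L.-1./2 + (A + (~~ odd L).+1)./2)%N.
Proof.
move=> L0 AL; apply: double_inj; rewrite doubleD.
have oL : odd L.-1 = ~~ odd L by case: L L0 {AL} => //= L _; rewrite negbK.
rewrite even_halfK ?oddD ?AL ?addbb //.
case o : (odd L) oL AL => oL AL; rewrite /= in oL *.
  by rewrite !even_halfK ?oddD ?AL ?oL //; lia.
rewrite odd_halfK ?oL // even_halfK ?oddD ?AL //.
by case: L L0 o {oL AL} => [|[|L]] //= _ _; lia.
Qed.

Section ZetaProducts.

Variables (n : nat) (hn : (4 <= n)%N) (b0 : bool).
Variables (gT : finGroupType) (G : {group gT}) (z : gT) (t : nat -> gT).
Variable p : {morphism G >-> 'S_n}.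
Hypothesis hG : double_cover b0 z t p.
Variables (c : intpartn n -> gT) (sp : intpartn n -> bool -> 'CF(G)).
Hypothesis hsp : spin_labelling z p c sp.
Variable la : intpartn n.
Local Notation zeta := (zeta hn sp).
Local Notation Y := (young p la).

Lemma odd_parts_even (a : intpartn n) (s : 'S_n) :
  odd_parts a -> cycle_type s = a -> ~~ odd_perm s /\ odd (size a) = odd n.
Proof.
move=> oa sa; have par : odd (size a) = odd n.
  rewrite -[in RHS](la_sum a); have := oa; rewrite /odd_parts.
  by elim: (pparts a) => //= k r IH /andP[ok /IH]; rewrite oddD ok => <-.
split=> //; rewrite odd_perm_cycle_type sa oddB ?partn_size_le // par.
by case: odd.
Qed.

Lemma zeta_vanish g : g \in G -> ~~ odd_perm (p g) ->
  ~~ all odd (cycle_type (p g)) -> zeta g = 0.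
Proof.
move=> gG evg ng; have [N [rG zE [rz T_adj]]] := zeta_repr hn hG hsp.
by rewrite zE cfunE gG mulr1n (mxtrace_even_cycle hn hG rz T_adj).
Qed.

Lemma spin_val_type (chi : 'CF(G)) g h : irr_spin z chi -> g \in G -> h \in G ->
  cycle_type (p g) = cycle_type (p h) ->
  chi g * (zeta g)^* = chi h * (zeta h)^*.
Proof.
move=> sc gG hG' /(cycle_type_fibre hn hG gG hG')[k kG [->|->]].
  by rewrite !cfunJ.
by rewrite !(spin_z hG) ?groupJ ?(zeta_spin hn hsp) // !cfunJ // rmorphN mulrNN.
Qed.

(** The even elements only are taken, as the class labelling says nothing about
    the values of [zeta] at odd ones. *)
Definition zeta_prod (chi : 'CF(G)) : algC :=
  #|Y|%:R^-1 * \sum_(y in Y | ~~ odd_perm (p y)) chi y * (zeta y)^*.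

(** Even elements with a cycle of even length do not contribute, as [zeta] vanishes there. On the
    classes with odd parts, [zeta] supplies the power of 2 and the fusion count the coefficient of
    [p_a] in the expansion of [Q_lb]. *)
Lemma zeta_prodE (lb : intpartn n) b : distinct_parts lb ->
  zeta_prod (sp lb b) = (schur_Q lb)@_(partn_mon la)
     / 2 ^+ (size lb + eps lb + (~~ odd n).+1)./2.
Proof.
move=> dlb; set chi := sp lb b; have sc : irr_spin z chi by apply: (sl_spin hsp).
pose H g := (~~ odd_perm (p g))%:R * (chi g * (zeta g)^*).
have HJ g k : g \in G -> k \in G -> H (g ^ k)%g = H g.
  by move=> gG kG; rewrite /H morphJ // odd_permJ !cfunJ.
have HW := young_sum hn hG la HJ.
have Htype g h : g \in G -> h \in G -> cycle_type (p g) = cycle_type (p h) ->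
    H g * (fusion_count la (p g))%:R = H h * (fusion_count la (p h))%:R.
  move=> gG hG' gh; rewrite /H (spin_val_type sc gG hG' gh) !odd_perm_cycle_type gh.
  by have [s ->] := cycle_type_conj gh; rewrite fusion_countJ.
rewrite (type_sum hn hG (sl_class hsp) Htype) in HW; last first.
  move=> g gG ng; rewrite /H; case: (boolP (odd_perm (p g))) => og.
    by rewrite !mul0r.
  by rewrite (zeta_vanish gG og ng) conjC0 mulr0 mulr0 mul0r.
rewrite (card_cover hn hG) in HW.
have n0 : n`!%:R != 0 :> algC by rewrite pnatr_eq0 -lt0n fact_gt0.
have {}HW : \sum_(y in Y) H y = 2 * \sum_(a : intpartn n | odd_parts a)
    (#|('C[p (c a)])%g|%:R)^-1 * (H (c a) * (fusion_count la (p (c a)))%:R).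
  by apply: (mulfI n0); rewrite HW !mulrA [n`!%:R * 2]mulrC.
have -> : zeta_prod chi = #|Y|%:R^-1 * \sum_(y in Y) H y.
  rewrite /zeta_prod big_mkcondr /=; congr (_ * _); apply: eq_bigr => y _.
  by rewrite /H; case: ifP; rewrite ?mul1r ?mul0r.
rewrite HW (card_young hn hG) (sl_Q hsp b dlb) raddf_sum /= invfM mulrACA mulVf ?pnatr_eq0 //.
rewrite mul1r mulr_sumr mulr_suml; apply: eq_bigr => a oa.
have [caG cat] := sl_class hsp oa.
have [evc oddn] := odd_parts_even oa cat.
rewrite mcoeffZ (power_sum_coeff la _ cat); last by lia.
rewrite /H evc mul1r (zeta_odd hn hsp oa) -/chi.
have -> : (2 ^+ (size a).-1./2 : algC)^* = 2 ^+ (size a).-1./2.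
  by rewrite rmorphXn /= conjC_nat.
have a0 : (0 < size a)%N.
  by have := la_sum a; case: (pparts a) => //= e; lia.
have -> : (size lb + size a + eps lb)./2 =
   ((size a).-1./2 + (size lb + eps lb + (~~ odd n).+1)./2)%N.
  rewrite addnAC -oddn; apply: half_parity => //.
  rewrite oddn /eps oddD oddb -oddD addnC subnK ?partn_size_le //.
set r := #|row_stab la|%:R; set W := #|_|%:R; set C := #|_|%:R.
rewrite exprD.
have r0 : r != 0 by rewrite /r pnatr_eq0 -lt0n; apply: cardG_gt0.
have C0 : C != 0 by rewrite /C pnatr_eq0 -lt0n; apply: cardG_gt0.
by field; rewrite r0 C0 expf_neq0 ?pnatr_eq0.
Qed.

(** The coefficient of [x ^ la] is [2 ^ l(la)] both in [Q_la] and in [Q_(n)], so the two products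
    differ by their normalising powers of 2 only. *)
Lemma zeta_prod_norm b : distinct_parts la ->
  zeta_prod zeta = zeta_prod (sp la b) ^+ 2 * 2 ^+ eps la
  /\ zeta_prod (sp la b) \is Num.real /\ zeta_prod (sp la b) != 0.
Proof.
move=> dla; rewrite /zeta -/zeta !zeta_prodE ?row_distinct // mcoeff_schur_Q //.
rewrite mcoeff_schur_Q_row //.
set k := size la; set h := (k + _ + _)./2.
have E1 : (size (row_partn hn) + eps (row_partn hn) + (~~ odd n).+1)./2 = (~~ odd n).+1.
  by rewrite /eps /=; have : (0 < n)%N; lia.
(* As [eps la] is the parity of [n - l(la)], the sum is even and the halving is exact. *)
have E2 : (h.*2 = k + eps la + (~~ odd n).+1)%N.
  rewrite /h /eps -[RHS]odd_double_half.
  have kn : (k <= n)%N by apply: partn_size_le.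
  have -> // : odd (k + odd (n - size la) + (~~ odd n).+1) = false.
  by rewrite -/k; lia.
have p2 j : 2 ^+ j != 0 :> algC by rewrite expf_neq0 ?pnatr_eq0.
rewrite E1; split; last first.
  by rewrite mulf_neq0 ?invr_eq0 //= rpredM ?rpredV ?rpredX ?realn.
have hh : (2 ^+ h) ^+ 2 = 2 ^+ k * 2 ^+ eps la * 2 ^+ (~~ odd n).+1 :> algC.
  by rewrite -exprM muln2 E2 !exprD.
by rewrite expr_div_n hh; field; rewrite !p2.
Qed.

End ZetaProducts.

(** * Characters induced from Young subgroups *)

Section Fusion.

Variables (gT : finGroupType) (K X : {group gT}) (f : 'CF(X)) (Q : gT -> bool).
Hypothesis XK : X \subset K.
Hypothesis fQ : forall x, x \in X -> f x != 0 -> Q x.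
Hypothesis Qfus : forall x k, x \in X -> Q x -> k \in K -> (x ^ k)%g \in X -> k \in X.

(** On the support of [f] the induced function agrees with [f], because only elements of [X]
    conjugate a point of the support into [X]; reciprocity does the rest. *)
Lemma fusion_norm : '['Ind[K] f] = '[f].
Proof.
rewrite -cfdot_Res_l !cfdotE; congr (_ * _); apply: eq_bigr => x xX.
have [->|fx] := eqVneq (f x) 0; first by rewrite conjC0 !mulr0.
congr (_ * _); rewrite cfResE // cfIndE // (big_setID X) /= (setIidPr XK).
rewrite [X in _ + X]big1 => [|k /setDP[kK kX]]; last first.
  apply/eqP; apply: contraNT kX => fxk; apply: (Qfus xX (fQ xX fx) kK).
  by apply: contraNT fxk => nX; rewrite cfun0.
rewrite addr0 (eq_bigr (fun=> f x)) => [|k kX]; last by rewrite cfunJ.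
by rewrite sumr_const -[f x *+ _]mulr_natl mulKf // pnatr_eq0 -lt0n cardG_gt0.
Qed.

Lemma fusion_support g : g \in K -> 'Ind[K] f g != 0 ->
  exists2 k, k \in K & ((g ^ k)%g \in X) && Q (g ^ k)%g.
Proof.
move=> gK; have [/existsP[k /andP[kK kQ]] _|/existsPn none] :=
  boolP [exists k, (k \in K) && (((g ^ k)%g \in X) && Q (g ^ k)%g)]; first by exists k.
rewrite cfIndE // big1 ?mulr0 ?eqxx // => k kK; apply/eqP.
have := none k; rewrite kK /=; apply: contraNT => fgk.
have gX : (g ^ k)%g \in X by apply: contraNT fgk => nX; rewrite cfun0.
by rewrite gX fQ.
Qed.

End Fusion.

(** The equality case of Cauchy-Schwarz: both norms are at most 2 and the inner product is 2 up to
    sign, so the norm of the difference is at most 0. *)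
Lemma assoc_diff (gT : finGroupType) (K : {group gT}) (F chi chi' : 'CF(K)) (b : bool) :
    chi \in irr K -> chi' \in irr K -> '[F] <= 2 -> '[F, chi - chi'] = (-1) ^+ b * 2 ->
  chi - chi' = (-1) ^+ b *: F /\ chi != chi'.
Proof.
move=> /irrP[i ->] /irrP[j ->] F2 Fd; set d := _ - _ in Fd *.
have d2 : '[d] <= 2.
  rewrite /d cfnormB !cfdot_irr !eqxx; case: (i == j); rewrite /= ?conjC1 ?conjC0.
    by rewrite subrr ler0n.
  by rewrite addr0 subr0 -natrD.
have s2 : (-1) ^+ b * (-1) ^+ b = 1 :> algC by rewrite -expr2 sqrr_sign.
have scj : ((-1) ^+ b : algC)^* = (-1) ^+ b by apply: rmorph_sign.
have : '[d - (-1) ^+ b *: F] <= 0.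
  rewrite cfnormB cfnormZ normr_sign expr1n mul1r cfdotZr scj.
  have -> : (-1) ^+ b * '[d, F] = 2.
    by rewrite cfdotC Fd rmorphM /= scj conjC_nat mulrA s2 mul1r.
  by rewrite conjC_nat subr_le0 lerD.
move=> le0; have : '[d - (-1) ^+ b *: F] == 0 by rewrite eq_le le0 cfnorm_ge0.
rewrite cfnorm_eq0 subr_eq0 => /eqP dE; split=> //.
apply/eqP => ij; move: Fd; rewrite /d ij subrr cfdot0r => /esym/eqP.
by rewrite mulf_eq0 signr_eq0 pnatr_eq0.
Qed.

(** * Projections onto isotypic components *)

Section Isotypic.

Variables (gT : finGroupType) (G X : {group gT}) (N : nat).
Variables (rG : mx_representation algC G N.+1) (j : Iirr X).
Hypothesis XG : X \subset G.

(** The central idempotent of ['chi_j] in the group algebra of [X], acting through [rG]. *)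
Definition isot_mx : 'M[algC]_N.+1 :=
  ('chi_j 1%g / #|X|%:R) *: \sum_(x in X) 'chi_j x^-1%g *: rG x.

Lemma isot_mx_comm x : x \in X -> isot_mx * rG x = rG x * isot_mx.
Proof.
move=> xX; have xG := subsetP XG x xX.
rewrite -scalerAl -scalerAr mulr_suml mulr_sumr; congr (_ *: _).
rewrite [RHS](reindex_inj (conjg_inj x)) /=.
rewrite [RHS](eq_bigl (mem X)) => [|y]; last by rewrite /= groupJr.
apply: eq_bigr => y yX; have yG := subsetP XG y yX.
rewrite -scalerAl -scalerAr -conjVg cfunJ //; congr (_ *: _).
rewrite -[LHS]repr_mxM // -[RHS]repr_mxM ?groupJ //.
by rewrite conjgC.
Qed.

Lemma isot_mx_trace y : y \in X ->
  \tr (isot_mx * rG y) = '['Res[X] (cfRepr rG), 'chi_j] * 'chi_j y.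
Proof.
move=> yX; have yG := subsetP XG y yX; set R := 'Res[X] _.
have -> : \tr (isot_mx * rG y) =
    'chi_j 1%g / #|X|%:R * \sum_(x in X) R (x * y)%g * 'chi_j x^-1%g.
  rewrite -scalerAl linearZ /= mulr_suml raddf_sum /=; congr (_ * _).
  apply: eq_bigr => x xX; have xG := subsetP XG x xX.
  rewrite -scalerAl linearZ /= mulrC cfResE ?groupM // cfunE groupM // mulr1n.
  by rewrite repr_mxM.
rewrite {1}(cfun_sum_cfdot R).
under eq_bigr => x xX.
  rewrite sum_cfunE mulr_suml.
  over.
rewrite exchange_big /= -mulrA mulr_sumr.
rewrite (bigD1 j) //= [X in _ + X]big1 ?addr0 => [|i ij].
  under eq_bigr => x _ do rewrite cfunE -mulrA.
  rewrite -mulr_sumr [_^-1 * (_ * _)]mulrCA generalized_orthogonality_relation eqxx mul1r.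
  by rewrite mulrCA; congr (_ * _); rewrite mulrC divfK ?irr1_neq0.
under eq_bigr => x _ do rewrite cfunE -mulrA.
by rewrite -mulr_sumr [_^-1 * (_ * _)]mulrCA generalized_orthogonality_relation (negPf ij) mul0r mulr0.
Qed.

End Isotypic.

(** The nonnegative number [nf] equals [2 (2 - M ^ 2)], which leaves only [M = 1]. *)
Lemma unit_mult (M i nf : algC) : M \is a Num.nat -> M != 0 -> M ^+ 2 = 1 + i ->
  nf = 2 - 2 * i -> 0 <= nf -> M = 1 /\ nf = 2.
Proof.
case/natrP=> m ->; rewrite pnatr_eq0 => m0 M2 ->.
have -> : i = m%:R ^+ 2 - 1 by rewrite M2; ring.
rewrite -natrX => le0; have m2 : (m ^ 2 <= 2)%N.
  rewrite -(@ler_nat algC) -subr_ge0.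
  have -> : 2 - (m ^ 2)%:R = (2 - 2 * ((m ^ 2)%:R - 1)) / 2 :> algC by field.
  by rewrite divr_ge0 // ler0n.
have -> : m = 1%N by move: m0 m2; case: m {M2 le0} => [|[|m]] //; rewrite expnS expn1; lia.
by split=> //; rewrite expn1 || rewrite exp1n; ring.
Qed.

Lemma nat_unit_sub (u v : algC) : u \is a Num.nat -> v \is a Num.nat -> u + v = 1 ->
  exists b : bool, u - v = (-1) ^+ b.
Proof.
case/natrP=> k -> /natrP[l ->]; rewrite -natrD => /eqP.
rewrite (@eqr_nat _ _ 1) => /eqP kl.
have [[-> ->]|[-> ->]] : k = 0%N /\ l = 1%N \/ k = 1%N /\ l = 0%N by lia.
  by exists true; rewrite sub0r.
by exists false; rewrite subr0.
Qed.

(** * Constituents on the Young subgroup, and the case of two associate characters *)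

Section YoungConstituents.

Variables (n : nat) (hn : (4 <= n)%N) (b0 : bool).
Variables (gT : finGroupType) (G : {group gT}) (z : gT) (t : nat -> gT).
Variable p : {morphism G >-> 'S_n}.
Hypothesis hG : double_cover b0 z t p.
Variable la : intpartn n.
Local Notation Y := (young p la).

Section Roots.

Variables (N : nat) (rG : mx_representation algC G N.+1).
Hypothesis rz : rG z = - 1.
Hypothesis T_adj : forall i, (i.+2 < n)%N ->
  rG (t i) * rG (t i.+1) + rG (t i.+1) * rG (t i) = - ((-1) ^+ b0) *: 1.
Local Notation R := (@root_mx n gT G t N rG).

Lemma root_young (a b : 'I_n) : blk la a = blk la b -> a != b ->
  exists2 y, (y \in Y) && odd_perm (p y) & R a b = rG y \/ R a b = - rG y.
Proof.
move=> ab nab; have [y yG py] := dc_onto hn hG (tperm a b); exists y.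
  rewrite youngP yG py odd_tperm nab !andbT; apply/row_stabP => i.
  by case: tpermP => [->|->|//].
by case: (root_lift hn hG rz T_adj yG nab py) => ->; [left | right; rewrite opprK].
Qed.

(** Two matrices, to serve both cases: on [Y] they coincide with one isotypic projection; on the
    even subgroup they are the projections for a constituent and for its conjugate by an odd
    element. *)
Variables P Q : 'M[algC]_N.+1.
Hypothesis PQ : {in Y, forall y, odd_perm (p y) -> P * rG y = rG y * Q}.

Lemma root_intertwine (a b : 'I_n) : blk la a = blk la b -> P * R a b = R a b * Q.
Proof.
have [->|ab] := eqVneq a b; first by rewrite /root_mx subrr mulr0 mul0r.
move=> bab; have [y /andP[yY oy] [->|->]] := root_young bab ab; first exact: PQ.
by rewrite mulrN mulNr PQ.
Qed.

Lemma orbit_intertwine s (i j : 'I_n) : s \in row_stab la -> blk la i = blk la j ->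
  P * orbit_mx t rG s i j = orbit_mx t rG s i j * Q.
Proof.
move=> sY ij; rewrite /orbit_mx mulr_sumr mulr_suml; apply: eq_bigr => a ai.
rewrite mulr_sumr mulr_suml; apply: eq_bigr => b bj; apply: root_intertwine.
by rewrite (porbit_blk sY ai) (porbit_blk sY bj).
Qed.

(** Commuting with the vector [orbit_mx] fixed by [x] up to the sign of [x]
    compares the two traces. *)
Lemma nonfull_trace x : x \in Y -> ~~ block_cycles la (p x) ->
  \tr (P * rG x) = dcsgn p x * \tr (Q * rG x).
Proof.
move=> xY nfull; have := xY; rewrite youngP => /andP[xG px].
have [i [j [ij nij]]] : exists i j : 'I_n, blk la i = blk la j /\ j \notin porbit (p x) i.
  move: nfull; case/forallPn => i /forallPn[j]; rewrite negb_imply => /andP[/eqP ij nij].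
  by exists i, j.
set U := orbit_mx t rG (p x) i j.
have PU : P * U = U * Q by apply: orbit_intertwine.
have xU : rG x * U = dcsgn p x *: (U * rG x) by apply: (orbit_mx_conj hn hG rz T_adj).
have [c c0 UU] := orbit_mx_sq hn hG rz T_adj nij.
apply: (mulfI c0).
have -> : c * \tr (P * rG x) = \tr (P * rG x * (U * U)).
  by rewrite UU -scalerAr mulr1 linearZ.
have -> : P * rG x * (U * U) = dcsgn p x *: (U * (Q * rG x * U)).
  by rewrite mulrA -(mulrA P) xU -scalerAr -scalerAl [P * (U * _)]mulrA PU -!mulrA.
have trC (A B : 'M[algC]_N.+1) : \tr (A * B) = \tr (B * A) by apply: mxtrace_mulC.
rewrite linearZ /= trC -mulrA UU -scalerAr mulr1.
by rewrite linearZ /= mulrCA.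
Qed.

End Roots.

Variables (c : intpartn n -> gT) (sp : intpartn n -> bool -> 'CF(G)).
Hypothesis hsp : spin_labelling z p c sp.
Local Notation zeta := (zeta hn sp).

Lemma inflateE (chi : 'CF([set: 'S_n])) g : g \in G -> inflate p chi g = chi (p g).
Proof. by move=> gG; rewrite cfMorphE // cfResE ?subsetT // mem_morphim. Qed.

Lemma sgnE g : g \in G -> inflate p (sym_sgn n) g = dcsgn p g.
Proof. by move=> gG; rewrite inflateE // cfunE. Qed.

Lemma dcsgn_sq g : dcsgn p g * dcsgn p g = 1.
Proof. by rewrite -expr2 sqrr_sign. Qed.

Lemma dcsgn_conj g : (dcsgn p g)^* = dcsgn p g.
Proof. exact: rmorph_sign. Qed.

Hypothesis dla : distinct_parts la.

Lemma zeta1_neq0 : zeta 1%g != 0.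
Proof. by rewrite (zeta1 hn hsp) expf_neq0 ?pnatr_eq0. Qed.

Lemma block_fusion x k : x \in Y -> block_cycles la (p x) -> k \in G -> (x ^ k)%g \in Y -> k \in Y.
Proof.
rewrite !youngP => /andP[xG px] full kG; rewrite groupJ // morphJ //= kG.
exact: block_cycles_fusion.
Qed.

Lemma assoc_diff_induced : eps la -> exists b : bool, exists f : 'CF(Y),
  [/\ sp la true - sp la false = (-1) ^+ b *: 'Ind[G] f,
      sp la true != sp la false
    & forall x, x \in Y -> f x != 0 -> block_cycles la (p x)].
Proof.
move=> epsla; have [N [rG zE [rz T_adj]]] := zeta_repr hn hG hsp.
have YG : Y \subset G by apply: young_sub.
have NE : zeta 1%g = N.+1%:R by rewrite zE cfRepr1.
have Rz0 : 'Res[Y] zeta != 0.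
  by apply: contraNneq zeta1_neq0 => R0; rewrite -(cfRes1 Y) R0 cfunE.
have [j jR] := neq0_has_constt Rz0.
pose P := isot_mx rG j; pose th := 'chi_j.
have [a [a0 Ptr]] : exists a, a != 0 /\ forall y, y \in Y -> \tr (P * rG y) = a * th y.
  exists '['Res[Y] zeta, 'chi_j]; split=> [|y yY]; first by rewrite -irr_consttE.
  by rewrite (isot_mx_trace rG j YG yY) -zE.
have PY : {in Y, forall y, odd_perm (p y) -> P * rG y = rG y * P}.
  by move=> y yY _; apply: isot_mx_comm.
have trP : \tr P = a * th 1%g by rewrite -Ptr ?group1 // repr_mx1 mulr1.
pose r := th 1%g / zeta 1%g.
have th_even y : y \in Y -> ~~ odd_perm (p y) -> th y = r * zeta y.
  move=> yY ev; have := yY; rewrite youngP => /andP[yG /row_stabP py].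
  have := commutant_trace hn hG rz T_adj (root_intertwine rz T_adj PY) yG ev py.
  have -> : \tr (rG y) = zeta y by rewrite zE cfunE yG mulr1n.
  rewrite Ptr // trP -NE -!mulrA => /(mulfI a0) e.
  by apply: (mulIf zeta1_neq0); rewrite e; field; apply: zeta1_neq0.
have th_odd y : y \in Y -> odd_perm (p y) -> ~~ block_cycles la (p y) -> th y = 0.
  move=> yY oy nfull; have := nonfull_trace rz T_adj PY yY nfull.
  rewrite Ptr // /dcsgn oy expr1 mulN1r => /eqP; rewrite -addr_eq0 -mulr2n mulrn_eq0 /=.
  by rewrite mulf_eq0 (negPf a0) => /eqP.
pose sg := 'Res[Y] (inflate p (sym_sgn n)); pose th' := sg * th.
have sgY y : y \in Y -> sg y = dcsgn p y.
  by move=> yY; rewrite cfResE // sgnE // (subsetP YG).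
have th'E y : y \in Y -> th' y = dcsgn p y * th y by move=> yY; rewrite cfunE sgY.
set chi := sp la true; set chi' := sp la false.
have chi'E y : y \in Y -> chi' y = dcsgn p y * chi y.
  move=> yY; rewrite /chi' (sl_assoc hsp true dla) cfunE sgnE //.
  exact: (subsetP YG).
have [irrc irrc'] : chi \in irr G /\ chi' \in irr G.
  by split; [have /andP[] := sl_spin hsp true dla | have /andP[] := sl_spin hsp false dla].
have char_of (phi : 'CF(G)) : phi \in irr G -> 'Res[Y] phi \is a character.
  by move=> /irrP[k ->]; apply/cfRes_char/irr_char.
set u := '[th, 'Res[Y] chi]; set v := '[th, 'Res[Y] chi'].
have uN : u \is a Num.nat by apply: Cnat_cfdot_char; rewrite ?irr_char ?char_of.
have vN : v \is a Num.nat by apply: Cnat_cfdot_char; rewrite ?irr_char ?char_of.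
(* The factor [1 + sgn] cuts a sum down to the even elements, where [th] is a multiple of [zeta]. *)
have half (F : gT -> algC) :
    \sum_(y in Y) (1 + dcsgn p y) * F y = 2 * \sum_(y in Y | ~~ odd_perm (p y)) F y.
  rewrite mulr_sumr [RHS]big_mkcondr /=; apply: eq_bigr => y _; rewrite /dcsgn.
  by case: odd_perm; rewrite ?expr1 ?expr0 ?subrr ?mul0r.
have [A_B [Breal B0]] := zeta_prod_norm hn hG hsp true dla.
set A := zeta_prod hn p sp la zeta in A_B.
set B := zeta_prod hn p sp la chi in A_B Breal B0.
have rconj : r^* = r.
  by rewrite /r rmorphM fmorphV /= (zeta1 hn hsp) rmorphXn /= conjC_nat conj_natr ?Cnat_irr1.
have uv : u + v = 2 * r * B.
  rewrite /u /v !cfdotE -mulrDr -big_split /=.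
  rewrite (eq_bigr (fun y => (1 + dcsgn p y) * (th y * (chi y)^*))) => [|y yY]; last first.
    rewrite !cfResE // chi'E // rmorphM /= dcsgn_conj; ring.
  rewrite half mulrCA -[2 * r * B]mulrA; congr (_ * _).
  have -> : B = B^* by apply/esym/CrealP.
  rewrite /B /zeta_prod rmorphM fmorphV /= conjC_nat mulrCA; congr (_ * _).
  rewrite rmorph_sum mulr_sumr; apply: eq_bigr => y /andP[yY ev].
  by rewrite th_even // rmorphM /= conjCK; ring.
set i := '[th, th'].
have normth : '[th] = 1 by rewrite cfnorm_irr.
have i1 : 1 + i = 2 * r ^+ 2 * A.
  rewrite -[X in X + _]normth /i !cfdotE -mulrDr -big_split /=.
  rewrite (eq_bigr (fun y => (1 + dcsgn p y) * (th y * (th y)^*))) => [|y yY]; last first.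
    rewrite th'E // rmorphM /= dcsgn_conj; ring.
  rewrite half mulrCA -[2 * _ * A]mulrA; congr (_ * _).
  rewrite /A /zeta_prod mulrCA; congr (_ * _).
  rewrite mulr_sumr; apply: eq_bigr => y /andP[yY ev].
  by rewrite th_even // rmorphM /= rconj; ring.
(* The relation [A = 2 B ^ 2] enters here: [(u + v) ^ 2 = 4 r ^ 2 B ^ 2 = 2 r ^ 2 A]. *)
have M2 : (u + v) ^+ 2 = 1 + i.
  by rewrite uv i1 A_B epsla expr1; ring.
have ireal : i^* = i.
  rewrite /i cfdotE rmorphM rmorph_sum fmorphV /= conjC_nat; congr (_ * _).
  by apply: eq_bigr => y yY; rewrite th'E // !rmorphM /= !conjCK !dcsgn_conj; ring.
have normth' : '[th'] = 1.
  rewrite -normth !cfdotE; congr (_ * _); apply: eq_bigr => y yY.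
  by rewrite th'E // rmorphM /= dcsgn_conj mulrACA dcsgn_sq mul1r.
have normf : '[th - th'] = 2 - 2 * i.
  by rewrite cfnormB normth normth' -/i ireal; ring.
have uv0 : u + v != 0.
  have r0 : r != 0 by rewrite mulf_neq0 ?invr_eq0 ?zeta1_neq0 ?irr1_neq0.
  by rewrite uv; apply: (mulf_neq0 (mulf_neq0 _ r0) B0); rewrite pnatr_eq0.
have [uv1 f2] := unit_mult (rpredD uN vN) uv0 M2 normf (cfnorm_ge0 _).
have v' : '[th', 'Res[Y] chi] = v.
  rewrite /v !cfdotE; congr (_ * _); apply: eq_bigr => y yY.
  by rewrite th'E // !cfResE // chi'E // rmorphM /= dcsgn_conj; ring.
have u' : '[th', 'Res[Y] chi'] = u.
  rewrite /u !cfdotE; congr (_ * _); apply: eq_bigr => y yY.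
  rewrite th'E // !cfResE // chi'E // rmorphM /= dcsgn_conj mulrACA dcsgn_sq.
  by rewrite mul1r.
pose f := th - th'.
have fQ x : x \in Y -> f x != 0 -> block_cycles la (p x).
  move=> xY; apply: contraNT => nfull; rewrite !cfunE sgY //.
  case: (boolP (odd_perm (p x))) => ox; first by rewrite th_odd // mulr0 subrr.
  by rewrite /dcsgn (negPf ox) expr0 mul1r subrr.
have F2 : '['Ind[G] f] <= 2.
  by rewrite (fusion_norm (Q := fun x => block_cycles la (p x))) ?f2 // => x k; apply: block_fusion.
have Fd : '['Ind[G] f, chi - chi'] = 2 * (u - v).
  rewrite -Frobenius_reciprocity linearB /= cfdotBl !cfdotBr -/u -/v v' u'; ring.
have [b ub] := nat_unit_sub uN vN uv1.
have Fd' : '['Ind[G] f, chi - chi'] = (-1) ^+ b * 2 by rewrite Fd ub mulrC.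
have [dE neq] := assoc_diff irrc irrc' F2 Fd'.
by exists b, f.
Qed.

End YoungConstituents.

Lemma sqrn_neq2 m : (m ^ 2 == 2)%N = false.
Proof. by case: m => [|[|m]] //; rewrite expnS expn1; lia. Qed.

(** * The self-associate case, on the even subgroup *)

Section EvenCase.

Variables (n : nat) (hn : (4 <= n)%N) (b0 : bool).
Variables (gT : finGroupType) (G : {group gT}) (z : gT) (t : nat -> gT).
Variable p : {morphism G >-> 'S_n}.
Hypothesis hG : double_cover b0 z t p.
Variable la : intpartn n.
Hypothesis dla : distinct_parts la.
Local Notation Y := (young p la).

Definition even_cover : {group gT} := (p @*^-1 'Alt_('I_n))%G.
Local Notation K := even_cover.

Lemma even_coverP g : (g \in K) = (g \in G) && ~~ odd_perm (p g).
Proof. by rewrite inE; congr (_ && _); rewrite inE Alt_even. Qed.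

Lemma even_cover_sub : K \subset G.
Proof. exact: subsetIl. Qed.

Lemma even_cover_normal : (K <| G)%g.
Proof.
apply/andP; split; first exact: even_cover_sub.
apply/subsetP => g gG; rewrite inE; apply/subsetP => _ /imsetP[x + ->].
rewrite !even_coverP => /andP[xG ex]; rewrite groupJ //= morphJ // odd_permJ.
exact: ex.
Qed.

(** Distinct parts of sum at least 4 include one larger than 1. The transposition of two points of
    its block provides an odd element of the Young subgroup. *)
Lemma block_pair : exists i j : 'I_n, i != j /\ blk la i = blk la j.
Proof.
have a1 : (1 < nth 0%N la 0)%N.
  have := la_sum la; have := la_sorted la; have := la_pos la; move: (dla); rewrite /distinct_parts.
  case: (pparts la) => [|a [|b r]] /=; first by move=> *; lia.
    by rewrite addn0 => _ _ _ ->; lia.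
  rewrite !inE !negb_or => /andP[/andP[ab _] _] /andP[a0 /andP[b0' _]] /andP[ba _] _.
  by move: ab a0 b0' ba; rewrite /geq /=; lia.
have : (1 < #|[set i : 'I_n | blk la i == 0%N]|)%N by rewrite card_blk.
case/card_gt1P => i [j [+ + ij]]; rewrite !inE => /eqP i0 /eqP j0.
by exists i, j; rewrite ij i0 j0.
Qed.

Lemma odd_young : exists2 y, y \in Y & odd_perm (p y).
Proof.
have [i [j [ij bij]]] := block_pair.
have [y yG py] := dc_onto hn hG (tperm i j); exists y; last by rewrite py odd_tperm.
rewrite youngP yG py; apply/row_stabP => k.
by case: tpermP => [->|->|//].
Qed.

Lemma card_even (H : {group gT}) y : H \subset G -> y \in H -> odd_perm (p y) ->
  #|H|%:R = 2 * #|H :&: K|%:R :> algC.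
Proof.
move=> HG yH oy.
have S0 : \sum_(x in H) dcsgn p x = 0.
  have : \sum_(x in H) dcsgn p x = - \sum_(x in H) dcsgn p x.
    rewrite {1}(reindex_inj (mulIg y)) /= -sumrN.
    rewrite (eq_bigl (mem H)) => [|x]; last by rewrite /= groupMr.
    apply: eq_bigr => x xH; rewrite dcsgnM ?(subsetP HG) //.
    by rewrite /dcsgn oy expr1 mulrN1.
  by move/eqP; rewrite -addr_eq0 -mulr2n mulrn_eq0 => /eqP.
have : \sum_(x in H) (1 + dcsgn p x) = 2 * #|H :&: K|%:R.
  rewrite -sum1_card natr_sum mulr_sumr [RHS]big_mkcond [LHS]big_mkcond.
  apply: eq_bigr => x _; rewrite inE even_coverP; case: (boolP (x \in H)) => //= xH.
  by rewrite (subsetP HG) //= /dcsgn; case: odd_perm; rewrite ?expr1 ?expr0 ?subrr ?mulr1.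
by rewrite big_split /= S0 addr0 sumr_const.
Qed.

Variables (c : intpartn n -> gT) (sp : intpartn n -> bool -> 'CF(G)).
Hypothesis hsp : spin_labelling z p c sp.
Local Notation zeta := (zeta hn sp).

Hypothesis epsla : ~~ eps la.

Lemma self_assoc_odd g : g \in G -> odd_perm (p g) -> sp la true g = 0.
Proof.
move=> gG og; have := sl_assoc hsp true dla; rewrite /=.
have -> : sp la false = sp la true by apply/esym/eqP; rewrite (sl_self hsp dla).
move/cfunP/(_ g); rewrite cfunE sgnE // /dcsgn og expr1 mulN1r => /eqP.
by rewrite -addr_eq0 -mulr2n mulrn_eq0 => /eqP.
Qed.

Lemma even_diff_induced : exists psi psi' : 'CF(K), exists b : bool, exists f : 'CF(Y :&: K),
  [/\ psi \in irr K, psi' \in irr K, 'Res[K] (sp la true) = psi + psi', psi != psi' &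
      (exists2 y, y \in G & psi' = (psi ^ y)%CF /\ psi = (psi' ^ y)%CF)
      /\ psi - psi' = (-1) ^+ b *: 'Ind[K] f /\
      forall x, x \in Y -> f x != 0 -> block_cycles la (p x)].
Proof.
have [N [rG zE [rz T_adj]]] := zeta_repr hn hG hsp.
have YG : Y \subset G by apply: young_sub.
pose X := (Y :&: K)%G.
have XY : X \subset Y by apply: subsetIl.
have XK : X \subset K by apply: subsetIr.
have XG : X \subset G := subset_trans XY YG.
have XP x : (x \in X) = (x \in Y) && ~~ odd_perm (p x).
  by rewrite inE even_coverP; case: (boolP (x \in Y)) => // /(subsetP YG) ->.
have [tau tauY otau] := odd_young; have tauG := subsetP YG _ tauY.
have KG := even_cover_normal.
have tauNK : tau \in 'N(K)%g by rewrite (subsetP (normal_norm KG)).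
have tauNX : tau \in 'N(X)%g.
  by rewrite (subsetP (normsI (normG Y) (subset_trans YG (normal_norm KG)))).
have NE : zeta 1%g = N.+1%:R by rewrite zE cfRepr1.
have Rz0 : 'Res[X] zeta != 0.
  by apply: contraNneq (zeta1_neq0 hn hsp) => R0; rewrite -(cfRes1 X) R0 cfunE.
have [j jR] := neq0_has_constt Rz0.
pose P := isot_mx rG j; pose th := 'chi_j.
have [a [a0 Ptr]] : exists a, a != 0 /\ forall y, y \in X -> \tr (P * rG y) = a * th y.
  exists '['Res[X] zeta, 'chi_j]; split=> [|y yX]; first by rewrite -irr_consttE.
  by rewrite (isot_mx_trace rG j XG yX) -zE.
(* The isotypic projection for the conjugate of [th] by the odd element [tau]. The odd elements of
   [Y] form the coset of [X] containing [tau], so each of them intertwines [P] and [Q]. *)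
pose Q := rG tau^-1%g * P * rG tau.
have rM g h : g \in G -> h \in G -> rG (g * h)%g = rG g * rG h by apply: repr_mxM.
have PX x : x \in X -> P * rG x = rG x * P by apply: isot_mx_comm.
have oddM y w : y \in Y -> w \in Y -> odd_perm (p y) -> odd_perm (p w) -> (y * w)%g \in X.
  move=> yY wY oy ow; rewrite XP groupM //= morphM ?(subsetP YG) //.
  by rewrite odd_permM oy ow.
have oddV y : y \in Y -> odd_perm (p y) -> odd_perm (p y^-1%g).
  by move=> yY oy; rewrite morphV ?(subsetP YG) // odd_permV.
have PQ : {in Y, forall y, odd_perm (p y) -> P * rG y = rG y * Q}.
  move=> y yY oy; have yG := subsetP YG y yY.
  have ytX : (y * tau^-1)%g \in X by rewrite oddM ?groupV // oddV.
  rewrite -{1}(mulgKV tau y) rM ?groupM ?groupV // mulrA PX //.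
  rewrite /Q !mulrA -rM ?groupV //.
have QP : {in Y, forall y, odd_perm (p y) -> Q * rG y = rG y * P}.
  move=> y yY oy; have yG := subsetP YG y yY.
  rewrite /Q -mulrA -rM // -mulrA PX ?oddM // rM //.
  by rewrite !mulrA -rM ?groupV // mulVg repr_mx1 mul1r.
pose th' := (th ^ tau)%CF.
have th'E x : th' x = th (x ^ tau^-1)%g by rewrite /th' cfConjgE.
have th'1 : th' 1%g = th 1%g by rewrite th'E conj1g.
have XJ x : x \in X -> (x ^ tau^-1)%g \in X by move=> xX; rewrite memJ_norm ?groupV.
have Qtr x : x \in X -> \tr (Q * rG x) = a * th' x.
  move=> xX; have xG := subsetP XG x xX.
  have trC (A B : 'M[algC]_N.+1) : \tr (A * B) = \tr (B * A) by apply: mxtrace_mulC.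
  rewrite th'E -Ptr ?XJ // conjgE invgK !rM ?groupM ?groupV // /Q.
  by rewrite -!mulrA [LHS]trC -!mulrA.
have trP : \tr P = a * th 1%g by rewrite -Ptr ?group1 // repr_mx1 mulr1.
have trQ : \tr Q = a * th 1%g by rewrite -th'1 -Qtr ?group1 // repr_mx1 mulr1.
(* It is [P + Q] that commutes with the roots, so [zeta] is compared with [th + th'], of degree
   [2 th(1)]. *)
pose r := 2 * (th 1%g / zeta 1%g).
have th_sum x : x \in X -> th x + th' x = r * zeta x.
  move=> xX; have := xX; rewrite XP youngP => /andP[/andP[xG /row_stabP px] ev].
  have comm (a1 b1 : 'I_n) : blk la a1 = blk la b1 ->
      (P + Q) * root_mx t rG a1 b1 = root_mx t rG a1 b1 * (P + Q).
    move=> ab; have e1 := root_intertwine hn hG rz T_adj PQ ab.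
    have e2 := root_intertwine hn hG rz T_adj QP ab.
    by move: (root_mx _ _ _ _) e1 e2 => R e1 e2; rewrite mulrDl mulrDr e1 e2 addrC.
  have := commutant_trace hn hG rz T_adj comm xG ev px.
  have -> : \tr (rG x) = zeta x by rewrite zE cfunE xG mulr1n.
  rewrite mulrDl !mxtraceD Ptr // Qtr // trP trQ -NE -!mulrDr -!mulrA => /(mulfI a0) e.
  by apply: (mulIf (zeta1_neq0 hn hsp)); rewrite e; field; apply: (zeta1_neq0 hn hsp).
have th_nonfull x : x \in X -> ~~ block_cycles la (p x) -> th x = th' x.
  move=> xX nfull; have := xX; rewrite XP => /andP[xY ev].
  have := nonfull_trace hn hG rz T_adj PQ xY nfull; rewrite Ptr // Qtr //.
  by rewrite /dcsgn (negPf ev) expr0 mul1r => /(mulfI a0).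
have KsG : K \subset G := even_cover_sub.
set chi := sp la true.
have irrc : chi \in irr G by have /andP[] := sl_spin hsp true dla.
have chiN : chi \is a character by apply: irrWchar.
have [A_B [Breal B0]] := zeta_prod_norm hn hG hsp true dla.
set A := zeta_prod hn p sp la zeta in A_B.
set B := zeta_prod hn p sp la (sp la true) in A_B Breal B0.
have cY : #|Y|%:R = 2 * #|X|%:R :> algC by apply: (card_even YG tauY).
have X0 : #|X|%:R != 0 :> algC by rewrite pnatr_eq0 -lt0n cardG_gt0.
have zprod (F : 'CF(G)) : \sum_(x in X) F x * (zeta x)^* = 2 * #|X|%:R * zeta_prod hn p sp la F.
  rewrite /zeta_prod cY mulrA mulfV ?mul1r ?mulf_neq0 ?X0 ?pnatr_eq0 //.
  by apply: eq_bigl => x; rewrite XP.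
have rconj : r^* = r.
  by rewrite /r !rmorphM fmorphV /= (zeta1 hn hsp) rmorphXn /= !conjC_nat conj_natr ?Cnat_irr1.
have r0 : r != 0 by rewrite /r !mulf_neq0 ?invr_eq0 ?pnatr_eq0 ?(zeta1_neq0 hn hsp) ?irr1_neq0.
have XNY : (X <| Y)%g.
  by rewrite /normal XY (normsI (normG Y) (subset_trans YG (normal_norm KG))).
set M := '[th, 'Res[X] chi].
have MN : M \is a Num.nat by rewrite Cnat_cfdot_char ?irr_char ?cfRes_char.
have M' : '[th', 'Res[X] chi] = M.
  rewrite /M -(cfResRes chi XY YG) cfdotC /th' cfdot_Res_conjg //.
  by rewrite -cfdotC.
have Mr : M = r * B.
  have : '[th + th', 'Res[X] chi] = 2 * (r * B).
    rewrite cfdotE (eq_bigr (fun x => r * (chi x * (zeta x)^* )^* )) => [|x xX].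
      have conjB : (2 * #|X|%:R * B)^* = 2 * #|X|%:R * B.
        by apply/CrealP; rewrite -natrM rpredM // realn.
      by rewrite -mulr_sumr -rmorph_sum /= (zprod chi : _ = 2 * #|X|%:R * B) conjB; field.
    by rewrite cfunE th_sum // cfResE // rmorphM /= conjCK; ring.
  rewrite cfdotDl M' -/M -mulr2n -[M *+ 2]mulr_natl; apply: mulfI.
  by rewrite pnatr_eq0.
have M0 : M != 0 by rewrite Mr mulf_neq0.
have normth : '[th] = 1 by rewrite cfnorm_irr.
have normth' : '[th'] = 1 by rewrite cfConjg_iso.
set i := '[th, th'].
have ireal : i^* = i.
  by rewrite conj_natr // Cnat_cfdot_char ?irr_char ?irrWchar ?cfConjg_irr ?mem_irr.
have M2 : M ^+ 2 = 1 + i.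
  have : '[th + th'] = r * r * (2 * A).
    rewrite cfdotE (eq_bigr (fun x => r * r * (zeta x * (zeta x)^* ))) => [|x xX].
      by rewrite -mulr_sumr (zprod zeta : _ = 2 * #|X|%:R * A); field.
    by rewrite cfunE th_sum // rmorphM /= rconj; ring.
  rewrite cfnormD normth normth' -/i ireal A_B (negPf epsla) expr0 Mr => e.
  have h : 2 * (1 + i) = 2 * ((r * B) ^+ 2)
    by transitivity (1 + 1 + (i + i)); [ring | rewrite e; ring].
  by apply/esym/(mulfI _ h); rewrite pnatr_eq0.
have normf : '[th - th'] = 2 - 2 * i.
  by rewrite cfnormB normth normth' -/i ireal; ring.
have [M1 f2] := unit_mult MN M0 M2 normf (cfnorm_ge0 _).
set Rc := 'Res[K] chi.
have RcXK : 'Res[X] Rc = 'Res[X] chi by rewrite cfResRes.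
(* [chi] vanishes at odd elements and [K] has index 2 in [G], so restriction doubles the norm. *)
have Rcn : '[Rc] = 2.
  have : #|G|%:R * '[chi] = #|K|%:R * '[Rc].
    rewrite !cfdotE !mulVKf ?pnatr_eq0 -?lt0n ?cardG_gt0 // (big_setID K) /=.
    rewrite (setIidPr KsG) [X in _ + X]big1 ?addr0 => [|g /setDP[gG]].
      by apply: eq_bigr => g gK; rewrite cfResE.
    by rewrite even_coverP gG negbK => og; rewrite self_assoc_odd // mul0r.
  rewrite (card_even (subxx G) tauG otau) (setIidPr KsG).
  have /irrP[k ->] := irrc; rewrite cfnorm_irr mulr1 mulrC => /mulfI -> //.
  by rewrite pnatr_eq0 -lt0n cardG_gt0.
have Rc_tau : (Rc ^ tau)%CF = Rc.
  by apply/cfun_inP => x xK; rewrite cfConjgE // !cfResE ?memJ_norm ?groupV // cfunJ ?groupV.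
have [k kR kth] : exists2 k, k \in irr_constt Rc & '['Ind[K] th, 'chi_k] != 0.
  have : '['Ind[K] th, Rc] != 0 by rewrite -Frobenius_reciprocity RcXK -/M M1 oner_neq0.
  rewrite {1}[Rc]cfun_sum_constt cfdot_sumr.
  have [/exists_inP[k kR kth] _|/exists_inPn none] :=
    boolP [exists k in irr_constt Rc, '['Ind[K] th, 'chi_k] != 0]; first by exists k.
  rewrite big1 ?eqxx // => k kR; rewrite cfdotZr; have := none k kR; rewrite negbK => /eqP ->.
  by rewrite mulr0.
set psi := 'chi_k; pose psi' := (psi ^ tau)%CF.
have irp' : psi' \in irr K by rewrite cfConjg_irr ?mem_irr.
have psi'' : psi = (psi' ^ tau)%CF.
  rewrite /psi' -cfConjgMnorm // cfConjg_id // even_coverP groupM //=.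
  by rewrite morphM // odd_permM otau.
(* Otherwise [psi] is invariant in [G], and by Clifford's theorem [Rc] is [e] times [psi] for a
   natural number [e], with norm [e ^ 2 = 2]. *)
have npsi : psi != psi'.
  apply/eqP => ep; have inv : G \subset 'I[psi]%g.
    apply/subsetP => g gG; case: (boolP (odd_perm (p g))) => og; last first.
      by rewrite (subsetP (sub_inertia psi)) // even_coverP gG.
    have tI : tau \in 'I[psi]%g by rewrite inE tauNK eq_sym /= -/psi' -ep.
    rewrite -(mulgKV tau g) groupM // (subsetP (sub_inertia psi)) // even_coverP.
    by rewrite groupM ?groupV //= morphM ?groupV // odd_permM morphV // odd_permV og otau.
  have /irrP[m cm] := irrc; move: (kR); rewrite /Rc cm => kR'.
  have := Clifford_Res_sum_cfclass KG kR'; rewrite cfclass_invariant // big_seq1 -cm => e.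
  have : '[Rc] = '[Rc, psi] ^+ 2.
    have e' : Rc = '[Rc, psi] *: psi by exact: e.
    have -> : '[Rc] = '['[Rc, psi] *: psi] by rewrite -e'.
    rewrite cfnormZ cfnorm_irr mulr1 ger0_norm //.
    by rewrite natr_ge0 // Cnat_cfdot_char ?irr_char ?cfRes_char.
  rewrite Rcn; have /natrP[e' ->] : '[Rc, psi] \is a Num.nat.
    by rewrite Cnat_cfdot_char ?irr_char ?cfRes_char.
  by rewrite -natrX => /eqP; rewrite eqr_nat eq_sym sqrn_neq2.
have cN : '[Rc, psi] \is a Num.nat by rewrite Cnat_cfdot_char ?irr_char ?cfRes_char.
have c' : '[Rc, psi'] = '[Rc, psi] by rewrite -{1}Rc_tau cfConjg_iso.
have c0 : '[Rc, psi] != 0 by rewrite -irr_consttE.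
have npp : '[psi, psi'] = 0.
  have /irrP[l el] := irp'; rewrite el cfdot_irr; case: eqP => // kl.
  by have := npsi; rewrite el /psi kl eqxx.
have np' : '[psi'] = 1 by rewrite cfConjg_iso cfnorm_irr.
(* With [e] the multiplicity of [psi], the difference of the two sides has norm [4 - 4 e]; this is
   nonnegative and [e] is positive, so [e = 1] and the norm is 0. *)
have RE : Rc = psi + psi'.
  have npsi1 : '[psi] = 1 by rewrite cfnorm_irr.
  have npp' : '[psi', psi] = 0 by rewrite cfdotC npp conjC0.
  have cc : '[psi, Rc] = '[Rc, psi] by rewrite cfdotC conj_natr.
  have cc' : '[psi', Rc] = '[Rc, psi] by rewrite cfdotC c' conj_natr.
  have nE : '[Rc - (psi + psi')] = 4 - 4 * '[Rc, psi].
    rewrite cfdotBl !cfdotBr !cfdotDl !cfdotDr Rcn c' cc cc' npsi1 np' npp npp'; ring.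
  have ge0 := cfnorm_ge0 (Rc - (psi + psi')).
  apply/eqP; rewrite -subr_eq0 -cfnorm_eq0 nE; move: ge0; rewrite nE.
  case/natrP: cN c0 => m ->; rewrite pnatr_eq0 subr_ge0 -natrM ler_nat => m0 m1.
  have -> : m = 1%N.
    by apply/eqP; rewrite eqn_leq lt0n m0 -(leq_pmul2l (isT : 0 < 4)%N) muln1 andbT.
  by rewrite muln1 subrr.
have psiN : psi \is a character by apply: irr_char.
have psi'N : psi' \is a character by apply: irrWchar.
set u := '[th, 'Res[X] psi]; set v := '[th, 'Res[X] psi'].
have uN : u \is a Num.nat by rewrite Cnat_cfdot_char ?irr_char ?cfRes_char.
have vN : v \is a Num.nat by rewrite Cnat_cfdot_char ?irr_char ?cfRes_char.
have uv1 : u + v = 1 by rewrite -M1 /M -RcXK RE linearD /= cfdotDr.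
have resJ (F : 'CF(K)) : ('Res[X] F ^ tau)%CF = 'Res[X] (F ^ tau)%CF.
  by apply/cfun_inP => x xX; rewrite cfConjgE // !cfResE ?memJ_norm ?groupV // cfConjgE.
have u' : '[th', 'Res[X] psi'] = u by rewrite -resJ cfConjg_iso.
have v' : '[th', 'Res[X] psi] = v by rewrite [in LHS]psi'' -resJ cfConjg_iso.
pose f := th - th'.
have fQ x : x \in X -> f x != 0 -> block_cycles la (p x).
  by move=> xX; apply: contraNT => nfull; rewrite !cfunE (th_nonfull x) // subrr.
have F2 : '['Ind[K] f] <= 2.
  rewrite (fusion_norm (Q := fun x => block_cycles la (p x))) ?f2 // => x l xX full lK xlX.
  rewrite inE lK andbT; apply: (block_fusion dla (subsetP XY _ xX) full (subsetP KsG _ lK)).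
  exact: (subsetP XY _ xlX).
have Fd : '['Ind[K] f, psi - psi'] = 2 * (u - v).
  rewrite -Frobenius_reciprocity linearB /= cfdotBl !cfdotBr -/u -/v v' u'; ring.
have [b ub] := nat_unit_sub uN vN uv1.
have Fd' : '['Ind[K] f, psi - psi'] = (-1) ^+ b * 2 by rewrite Fd ub mulrC.
have [dE neq] := assoc_diff (mem_irr k) irp' F2 Fd'.
exists psi, psi', b, f; split; rewrite ?mem_irr //; split; first by exists tau.
split=> // x xY fx; apply: fQ (fx).
by apply: contraNT fx => xX; rewrite cfun0.
Qed.

End EvenCase.

(** Schur's lemma; it is applied to the halves on the even subgroup, where only the square of the
    scalar matters. *)
Lemma irr_central_mul (gT : finGroupType) (K : {group gT}) (psi : 'CF(K)) z :
  psi \in irr K -> z \in 'Z(K)%g ->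
  exists w, forall g, g \in K -> psi (z * g)%g = w * psi g.
Proof.
move=> /irrP[i ->] zZ; have /setIP[zK _] := zZ.
have : z \in 'Z('chi_i)%CF by move: zZ; rewrite -cap_cfcenter_irr => /bigcapP/(_ i); apply.
have /char_reprP[[N rG] chiE] := irr_char i.
rewrite chiE cfcenter_repr inE zK /= => /is_scalar_mxP[a za].
exists a => g gK; rewrite !cfunE groupM // gK !mulr1n.
by rewrite repr_mxM // za mul_scalar_mx linearZ.
Qed.

(** * The square of the difference character *)

Section SquareMoment.

Variables (n : nat) (hn : (4 <= n)%N) (b0 : bool).
Variables (gT : finGroupType) (G : {group gT}) (z : gT) (t : nat -> gT).
Variable p : {morphism G >-> 'S_n}.
Hypothesis hG : double_cover b0 z t p.
Variable la : intpartn n.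
Local Notation Y := (young p la).

(** One statement for both cases, with [K] the cover or its even subgroup. All elements of type [la]
    in the cover are conjugate up to [z], so invariance of [d ^ 2] makes it constant on this type,
    and the inner product is a nonzero multiple of the conjugate of [chi s]. *)
Lemma square_moment (K X : {group gT}) (d : 'CF(K)) (b : bool) (f : 'CF(X))
    (chi : 'CF([set: 'S_n])) s :
  (K <| G)%g -> z \in K -> X \subset K -> X \subset Y ->
  d != 0 -> d = (-1) ^+ b *: 'Ind[K] f ->
  (forall x, x \in Y -> f x != 0 -> block_cycles la (p x)) ->
  (forall g k, g \in K -> k \in G -> d (g ^ k)%g ^+ 2 = d g ^+ 2) ->
  (forall g, g \in K -> d (z * g)%g ^+ 2 = d g ^+ 2) ->
  cycle_type s = la -> chi s != 0 ->
  '[d * d, 'Res[K] (inflate p chi)] != 0.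
Proof.
move=> KNG zK XK XY d0 dE fQ dJ dz sla chis; have KG := normal_sub KNG.
have d_type g : g \in K -> d g != 0 -> cycle_type (p g) = la.
  move=> gK; rewrite dE cfunE mulf_eq0 negb_or => /andP[_ fg].
  have fX x : x \in X -> f x != 0 -> block_cycles la (p x).
    by move=> xX; apply: fQ; apply: (subsetP XY).
  have [k kK /andP[/(subsetP XY)]] :=
    fusion_support (Q := fun x => block_cycles la (p x)) XK fX gK fg.
  rewrite youngP => /andP[_ px] full; rewrite -(block_cycles_type px full).
  by rewrite morphJ ?(subsetP KG) // cycle_typeJ.
have [g0 g0K dg0] : exists2 g, g \in K & d g != 0.
  have [/exists_inP[g gK dg]|/exists_inPn none] := boolP [exists g in K, d g != 0]; first by exists g.
  by case/eqP: d0; apply/cfun_inP => g gK; have := none g gK; rewrite negbK cfunE => /eqP.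
have sumE : \sum_(g in K) (d * d) g * ('Res[K] (inflate p chi) g)^* =
    \sum_(g in K | cycle_type (p g) == la) d g0 ^+ 2 * (chi s)^*.
  rewrite [RHS]big_mkcondr; apply: eq_bigr => g gK; have gG := subsetP KG g gK.
  rewrite cfunE; case: eqP => [gla|gla]; last first.
    have [->|/(d_type g gK)//] := eqVneq (d g) 0; by rewrite !mul0r.
  rewrite cfResE // inflateE //; congr (_ * _^* ); last first.
    have [h ->] := cycle_type_conj (etrans gla (esym sla)).
    by rewrite cfunJ ?inE.
  rewrite -expr2; have g0G := subsetP KG g0 g0K.
  have [k kG [->|->]] := cycle_type_fibre hn hG g0G gG (etrans (d_type g0 g0K dg0) (esym gla)).
    by rewrite dJ.
  by rewrite dz ?dJ // memJ_norm // (subsetP (normal_norm KNG)).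
rewrite cfdotE sumE sumr_const mulf_neq0 ?invr_eq0 ?neq0CG // mulrn_eq0 negb_or -lt0n.
apply/andP; split; last by rewrite mulf_neq0 ?expf_neq0 ?conjC_eq0.
by apply/card_gt0P; exists g0; rewrite unfold_in /= g0K (d_type g0) ?eqxx.
Qed.

End SquareMoment.

Theorem theorem4p3 (n : nat) (hn : (4 <= n)%N) (b0 : bool)
    (gT : finGroupType) (G : {group gT}) (z : gT) (t : nat -> gT)
    (p : {morphism G >-> 'S_n}) (hG : double_cover b0 z t p)
    (c : intpartn n -> gT) (sp : intpartn n -> bool -> 'CF(G))
    (hsp : spin_labelling z p c sp)
    (la mu : intpartn n) (hla : distinct_parts la)
    (s : 'S_n) (hs : cycle_type s = la) (hmu : sym_chi mu s != 0) :
  (forall b : bool,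
     constituent (inflate p (sym_chi mu)) (sp la b * spin_hat sp la))
  /\ (exists b1 b2 : bool,
     constituent (inflate p (sym_chi mu)) (sp la b1 * sp la b2)).
Proof.
rewrite /constituent; set I := inflate p (sym_chi mu).
have IN : I \is a character by rewrite cfMorph_char ?cfRes_char ?irr_char.
have natN (K : {group gT}) (a1 a2 : 'CF(K)) (KG : K \subset G) :
    a1 \is a character -> a2 \is a character -> '[a1 * a2, 'Res[K] I] \is a Num.nat.
  by move=> c1 c2; rewrite Cnat_cfdot_char ?cfRes_char ?rpredM.
have irrs b : sp la b \in irr G by have /andP[] := sl_spin hsp b hla.
have spN b : sp la b \is a character by apply: irrWchar.
have zG := dc_zG hG; have zZ := dc_central hG.
have [eps1|eps0] := boolP (eps la).
  have [b [f [dE neq fQ]]] := assoc_diff_induced hn hG hsp hla eps1.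
  have YG : young p la \subset G by apply: young_sub.
  set x := sp la true in dE neq *; set x' := sp la false in dE neq *.
  have dJ g k : g \in G -> k \in G -> (x - x') (g ^ k)%g ^+ 2 = (x - x') g ^+ 2.
    by move=> gG kG; rewrite cfunJ.
  have dz g : g \in G -> (x - x') (z * g)%g ^+ 2 = (x - x') g ^+ 2.
    by move=> gG; rewrite !cfunE !(spin_z hG) ?(sl_spin hsp) // -opprD sqrrN.
  have d0 : x - x' != 0 by rewrite subr_eq0.
  have := square_moment hn hG (normal_refl G) zG YG (subxx _) d0 dE fQ dJ dz hs hmu.
  rewrite -/I cfRes_id.
  (* The square of the sign character is trivial, so the square of [x - x'] is
     [2 (x ^ 2 - x x')]. *)
  have xx : x' * x' = x * x.
    apply/cfun_inP => g gG; rewrite /x' (sl_assoc hsp true hla) !cfunE sgnE // mulrACA.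
    by rewrite dcsgn_sq mul1r.
  have -> : (x - x') * (x - x') = (x * x - x * x') *+ 2.
    by rewrite mulrBl !mulrBr xx; ring.
  have := natN G x x (subxx G) (spN true) (spN true); rewrite cfRes_id.
  have := natN G x x' (subxx G) (spN true) (spN false); rewrite cfRes_id.
  rewrite cfdotMnl cfdotBl.
  set u := '[x * x', I]; set v := '[x * x, I] => uN vN uv.
  (* [v] and [u] are natural numbers with a nonzero difference, so their sum is nonzero. *)
  have uv0 : v + u != 0.
    apply: contraNneq uv => /eqP; rewrite paddr_eq0 ?natr_ge0 //.
    by case/andP=> /eqP-> /eqP->; rewrite subrr mul0rn.
  rewrite /spin_hat eps1; split=> [b'|].
    case: b'; rewrite mulrDr cfdotDl -/x -/x' //.
    by rewrite xx [x' * x]mulrC -/u -/v addrC.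
  have [v0|v0] := eqVneq v 0; last by exists true, true.
  by exists true, false; rewrite -/u; move: uv0; rewrite v0 add0r.
have e10 : sp la false = sp la true by apply/esym/eqP; rewrite (sl_self hsp hla).
suff main : '[sp la true * sp la true, I] != 0.
  by split; [case; rewrite /spin_hat (negPf eps0) ?e10 | exists true, true].
have [psi [psi' [b [f [irp irp' RE neq [[y yG [yp yp']] [dE fQ]]]]]]] := even_diff_induced hn hG hla hsp eps0.
pose K := even_cover p.
have KNG : (K <| G)%g := even_cover_normal p; have KG := normal_sub KNG.
have zK : z \in K by rewrite even_coverP zG (dc_pz hG) odd_perm1.
have zKZ : z \in 'Z(K)%g.
  by rewrite inE zK; apply: (subsetP (centS KG)); case/setIP: zZ.
have NK g : g \in G -> g \in 'N(K)%g by apply: subsetP (normal_norm KNG) g.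
have yodd : odd_perm (p y).
  apply: contraNT neq => ye; rewrite yp cfConjg_id //.
  by rewrite even_coverP yG.
pose d := psi - psi'.
(* An odd element exchanges the two halves; thus [d] is invariant under [G] up to sign, and its
   square is invariant. *)
have dy g : d (g ^ y^-1)%g = - d g.
  by rewrite !cfunE -!cfConjgE ?NK // -yp -yp' opprB.
have dJ g k : g \in K -> k \in G -> d (g ^ k)%g ^+ 2 = d g ^+ 2.
  move=> gK kG; case: (boolP (odd_perm (p k))) => ok; last by rewrite cfunJ // even_coverP kG.
  rewrite -sqrrN -dy -conjgM cfunJ // even_coverP groupM ?groupV //=.
  by rewrite morphM ?groupV // odd_permM morphV // odd_permV ok yodd.
have dz g : g \in K -> d (z * g)%g ^+ 2 = d g ^+ 2.
  have [w psiz] := irr_central_mul irp zKZ => gK.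
  have psiz' h : h \in K -> psi' (z * h)%g = w * psi' h.
    move=> hK; rewrite yp !cfConjgE ?NK // conjMg.
    have -> : (z ^ y^-1)%g = z.
      by apply/conjg_fixP/commgP; case/setIP: zZ => _ /centP; apply; rewrite groupV.
    by rewrite psiz // memJ_norm // groupV NK.
  have w2 : w ^+ 2 = 1.
    have /irrP[i ei] := irp; apply: (mulIf (irr1_neq0 i)).
    by rewrite -ei expr2 -mulrA -!psiz ?groupM // mulg1 (dc_z2 hG) mul1r.
  by rewrite !cfunE psiz // psiz' // -mulrBr exprMn w2 mul1r.
have d0 : d != 0 by rewrite subr_eq0.
have XK : (young p la :&: K)%G \subset K by apply: subsetIr.
have XY : (young p la :&: K)%G \subset young p la by apply: subsetIl.
have := square_moment hn hG KNG zK XK XY d0 dE fQ dJ dz hs hmu.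
(* Multiplicities in products of characters are natural numbers: if those in the square of
   [psi + psi'] add up to 0, each is 0, and so is the signed sum belonging to [d ^ 2]. *)
rewrite -/I; apply: contraNneq => main.
have [pN pN'] : psi \is a character /\ psi' \is a character by split; apply: irrWchar.
have RS : '['Res[K] (sp la true * sp la true), 'Res[K] I] = 0.
  have : #|G|%:R * '[sp la true * sp la true, I] =
         #|K|%:R * '['Res[K] (sp la true * sp la true), 'Res[K] I].
    rewrite !cfdotE !mulVKf ?pnatr_eq0 -?lt0n ?cardG_gt0 // (big_setID K) /=.
    rewrite (setIidPr KG) [X in _ + X]big1 ?addr0 => [|g /setDP[gG]].
      by apply: eq_bigr => g gK; rewrite !cfResE.
    rewrite even_coverP gG negbK => og; rewrite cfunE.
    by rewrite (self_assoc_odd hla hsp eps0) // mul0r mul0r.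
  rewrite main mulr0 => /esym/eqP; rewrite mulf_eq0 pnatr_eq0 => /orP[|/eqP//].
  by rewrite -leqn0 leqNgt cardG_gt0.
have RM : 'Res[K] (sp la true * sp la true) =
    psi * psi + psi * psi' + (psi * psi' + psi' * psi').
  by transitivity ((psi + psi') * (psi + psi')); [rewrite -RE; apply: rmorphM | ring].
have dd : d * d = psi * psi - psi * psi' - (psi * psi' - psi' * psi') by rewrite /d; ring.
have uN := natN K psi psi KG pN pN; have vN := natN K psi psi' KG pN pN'.
have wN := natN K psi' psi' KG pN' pN'; move: RS; rewrite RM dd !(cfdotDl, cfdotNl).
move: uN vN wN; move: '[psi * psi, _] '[psi * psi', _] '[psi' * psi', _] => u v w uN vN wN S0.
have [u0 v0 w0] : [/\ u = 0, v = 0 & w = 0].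
  have : u + v + (v + w) == 0 by rewrite S0.
  by rewrite !paddr_eq0 ?addr_ge0 ?natr_ge0 // => /andP[/andP[/eqP-> /eqP->] /andP[_ /eqP->]].
by rewrite u0 v0 w0 !(oppr0, addr0).
Qed.
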